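(* Let $p$ be a probability density on $\mathbb R^d$ with $Z_S:=\int_Sp(\omega)\,d\omega>0$. Fix a nonempty $I\subseteq[d]$. Let $\varphi:\mathbb R^d\to\mathbb R$ be measurable and assume $$\int_{\mathbb R^d\setminus S}|\varphi(\omega)|p(\omega)\,d\omega<\infty.$$ Then the following hold. (i) If $p|_S\in BV(S)$ and $\varphi|_S\in L^\infty(S)$, then $$|\mathbb E_p[\varphi]|\le\frac1{2|I|}\Lambda_{\mathrm{sl}}^I(\mathcal P_I^S\varphi)\,\mathrm{TV}_I(p;S)+Z_S\|\mathcal R_I^S\varphi\|_{L^\infty(S)}+\int_{\mathbb R^d\setminus S}|\varphi|p.$$ (ii) If $p|_S\in C^{|I|}(\overline S)$ and $\varphi|_S\in L^\infty(S)$, then $$|\mathbb E_p[\varphi]|\le2^{-|I|}\Lambda_{\mathrm{mix}}^I(\mathcal P_I^S\varphi)\int_S|\partial_Ip(\omega)|\,d\omega+Z_S\|\mathcal R_I^S\varphi\|_{L^\infty(S)}+\int_{\mathbb R^d\setminus S}|\varphi|p.$$ (iii) If $V_I^{\mathrm{ext}}(p|_S;S)<\infty$ and $\varphi|_S\in L^\infty(S)$, then $$|\mathbb E_p[\varphi]|\le2^{-|I|}\Lambda_{\mathrm{mix}}^I(\mathcal P_I^S\varphi)\,V_I^{\mathrm{ext}}(p|_S;S)+Z_S\|\mathcal R_I^S\varphi\|_{L^\infty(S)}+\int_{\mathbb R^d\setminus S}|\varphi|p.$$ If $D_Ip\in\mathcal M(\mathbb R^d)$, then $V_I^{\mathrm{ext}}(p|_S;S)\le|D_Ip|(\mathbb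 R^d)$.
   Context: Let $d\ge 1$, $[d]=\{1,\dots,d\}$, and let $S=\prod_{i=1}^d[a_i,b_i]\subset\mathbb R^d$ be a box with $a_i<b_i$. For $I\subseteq[d]$ write $\omega_I=(\omega_i)_{i\in I}$, $\omega_{-I}=(\omega_j)_{j\notin I}$, $S_I=\prod_{i\in I}[a_i,b_i]$, $S_{-I}=\prod_{j\notin I}[a_j,b_j]$ (a singleton if $I=[d]$), and $-i$ for $-\{i\}$. A probability density is a nonnegative integrable function with integral $1$; $\mathbb E_p[\varphi]=\int_{\mathbb R^d}\varphi p\,d\omega$. For $\varphi$ on $S$, $(\Pi_i\varphi)(\omega)=\frac1{b_i-a_i}\int_{a_i}^{b_i}\varphi(\omega_{-i},t)\,dt$ ($t$ inserted in coordinate $i$); these operators commute. $\mathcal P_I=\prod_{i\in I}(\mathrm{Id}-\Pi_i)$, $\mathcal R_I=\mathrm{Id}-\mathcal P_I$; $\mathcal P_I^S\varphi$ and $\mathcal R_I^S\varphi$ denote $\mathcal P_I$ and $\mathcal R_I$ applied to the restriction $\varphi|_S$. Envelopes: $$\Lambda_{\mathrm{sl}}^I(\varphi)=\max_{i\in I}\operatorname*{ess\,sup}_{\omega_{-i}\in S_{-i}}\int_{a_i}^{b_i}|\varphi(\omega_{-i},t)|\,dt,\qquad \Lambda_{\mathrm{mix}}^I(\varphi)=\operatorname*{ess\,sup}_{\omega_{-I}\in S_{-I}}\int_{S_I}|\varphi(\omega_{-I},t_I)|\,dt_I.$$ For $f\in BV(S)$, $D_if$ is the $i$th distributional derivative measure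 on the interior of $S$, $|D_if|(S)$ its total variation mass there, $\mathrm{TV}_I(f;S)=\sum_{i\in I}|D_if|(S)$ (and $\mathrm{TV}_I(p;S)$ refers to $p|_S$). For $I=\{i_1<\cdots<i_k\}$, $\partial_I=\partial_{i_1}\cdots\partial_{i_k}$. $C^k(\overline S)$: functions $C^k$ up to the boundary of $S$. For $U\subset\mathbb R^d$ open and $h\in L^1_{\mathrm{loc}}(U)$, $D_Ih$ is the distribution $\langle D_Ih,\zeta\rangle=(-1)^{|I|}\int_Uh\,\partial_I\zeta\,dx$, $\zeta\in C_c^\infty(U)$. $\mathcal M(U)$: finite signed Radon measures on $U$; if $D_Ih\in\mathcal M(U)$, $|D_Ih|(U)$ is its total variation. For $f\in L^1(S)$, $$V_I^{\mathrm{ext}}(f;S)=\inf\{|D_I\bar f|(\mathbb R^d):\ \bar f\in L^1(\mathbb R^d),\ \bar f=f\text{ a.e. on }S,\ D_I\bar f\in\mathcal M(\mathbb R^d)\},$$ with value $+\infty$ if no such $\bar f$ exists. *)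

(* Defs.v *)
From HB Require Import structures.
From mathcomp Require Import all_boot all_order all_algebra.
From mathcomp Require Import all_classical all_reals all_analysis ess_sup_inf.

Set Implicit Arguments.
Unset Strict Implicit.
Unset Printing Implicit Defensive.

Import Order.TTheory GRing.Theory Num.Theory.
Import numFieldNormedType.Exports.

Local Open Scope classical_set_scope.
Local Open Scope ring_scope.

Definition measure_rV_display : measure_display -> measure_display.
Proof. exact. Qed.

Section measurable_rV.
Context {d} {T : measurableType d} (n : nat).

Let coors : 'I_n -> 'rV[T]_n -> T := fun i x => x ord0 i.

Let rV_set0 : g_sigma_preimage coors set0.
Proof. exact: sigma_algebra0. Qed.

Let rV_setC A : g_sigma_preimage coors A -> g_sigma_preimage coors (~` A).
Proof. exact: sigma_algebraC. Qed.

Let rV_bigcup (F : (set _)^nat) : (forall i, g_sigma_preimage coors (F i)) ->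
  g_sigma_preimage coors (\bigcup_i (F i)).
Proof. exact: sigma_algebra_bigcup. Qed.

HB.instance Definition _ := @isMeasurable.Build (measure_rV_display d)
  'rV[T]_n (g_sigma_preimage coors) rV_set0 rV_setC rV_bigcup.

Lemma measurable_coord_rV (i : 'I_n) :
  measurable_fun [set: 'rV[T]_n] (fun x : 'rV[T]_n => x ord0 i).
Proof.
move=> _ Y mY; rewrite setTI; apply: sub_sigma_algebra => /=.
rewrite -bigcup_seq/=; exists i => /=; first by rewrite mem_index_enum.
by exists Y => //; rewrite setTI.
Qed.

Lemma measurable_fun_rV d' (T' : measurableType d') (f : T' -> 'rV[T]_n) :
  (forall i, measurable_fun setT (fun t => f t ord0 i)) -> measurable_fun setT f.
Proof.
move=> mf _ Y mY; rewrite setTI.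
have : g_sigma_preimage (fun i t => f t ord0 i) (f @^-1` Y).
  rewrite (_ : (fun i t => f t ord0 i) = (fun i => coors i \o f))//.
  by rewrite g_sigma_preimage_comp; exists Y => //; rewrite setTI.
apply: smallest_sub; first exact: sigma_algebra_measurable.
rewrite -bigcup_seq/=; apply: bigcup_sub => i _ A [B mB <-].
exact: mf.
Qed.

End measurable_rV.

Section lebesgue_rV.
Context {R : realType}.
Local Open Scope ereal_scope.

Section step.
Variables (n : nat) (m : {sigma_finite_measure set 'rV[R]_n -> \bar R}).

Definition rV_cons (z : R * 'rV[R]_n) : 'rV[R]_n.+1 := row_mx z.1%:M z.2.

Definition rV_uncons (v : 'rV[R]_n.+1) : R * 'rV[R]_n :=
  (v ord0 ord0, \row_j v ord0 (lift ord0 j)).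

Lemma rV_consK : cancel rV_cons rV_uncons.
Proof.
move=> [t w]; rewrite /rV_uncons /rV_cons/=; congr pair.
  have -> : ord0 = lshift n (ord0 : 'I_1) by exact: val_inj.
  by apply: (etrans (row_mxEl _ _ _ _)); rewrite mxE eqxx mulr1n.
apply/rowP => j; rewrite mxE.
have -> : lift ord0 j = rshift 1 j by exact: val_inj.
exact: row_mxEr.
Qed.

Lemma measurable_rV_cons : measurable_fun setT rV_cons.
Proof.
apply: measurable_fun_rV => i; rewrite /rV_cons.
have [[j ->]|[j ->]] : (exists j, i = lshift n (j : 'I_1)) \/ (exists j, i = rshift 1 j).
    by case: (@splitP 1 n i) => j ij; [left|right]; exists j; exact: val_inj.
  rewrite (_ : (fun _ => _) = fst)//; apply/funext => z.
  by apply: (etrans (row_mxEl _ _ _ _)); rewrite mxE (ord1 j) eqxx mulr1n.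
rewrite (_ : (fun _ => _) = (fun w : 'rV[R]_n => w ord0 j) \o snd).
  exact: (measurableT_comp (measurable_coord_rV j)).
by apply/funext => z; exact: row_mxEr.
Qed.

Lemma measurable_rV_uncons : measurable_fun setT rV_uncons.
Proof.
apply: measurable_fun_pair; first exact: measurable_coord_rV.
apply: measurable_fun_rV => i; under eq_fun do rewrite mxE.
exact: measurable_coord_rV.
Qed.

Definition lebesgue_rV_step : set 'rV[R]_n.+1 -> \bar R :=
  pushforward (@lebesgue_measure R \x m) rV_cons.

Let mp : {measure set 'rV[R]_n.+1 -> \bar R} :=
  measure_function_pushforward__canonical__measure_function_Measure
    (@lebesgue_measure R \x m) measurable_rV_cons.

Let step0 : lebesgue_rV_step set0 = 0.
Proof. exact: (measure0 mp). Qed.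

Let step_ge0 A : 0 <= lebesgue_rV_step A.
Proof. exact: (measure_ge0 mp). Qed.

Let step_sigma_additive : semi_sigma_additive lebesgue_rV_step.
Proof. exact: (@measure_semi_sigma_additive _ _ _ mp). Qed.

HB.instance Definition _ := isMeasure.Build _ _ _
  lebesgue_rV_step step0 step_ge0 step_sigma_additive.

Let step_sigma_finite : sigma_finite setT lebesgue_rV_step.
Proof.
have /sigma_finiteP[F [TF ndF Foo]] := sigma_finiteT (@lebesgue_measure R).
have /sigma_finiteP[G [TG ndG Goo]] := sigma_finiteT m.
exists (fun k => rV_uncons @^-1` (F k `*` G k)).
  rewrite -preimage_bigcup; apply/esym/seteqP; split=> // v _ /=.
  have [k _ Fk] : (\bigcup_k F k) (rV_uncons v).1 by rewrite -TF.
  have [l _ Gl] : (\bigcup_k G k) (rV_uncons v).2 by rewrite -TG.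
  exists (maxn k l) => //; split.
  - by move: Fk; exact/subsetPset/ndF/leq_maxl.
  - by move: Gl; exact/subsetPset/ndG/leq_maxr.
move=> k; have [mF Fk] := Foo k; have [mG Gk] := Goo k; split.
  rewrite -[X in measurable X]setTI; apply: measurable_rV_uncons => //.
  exact: measurableX.
rewrite /lebesgue_rV_step /pushforward -comp_preimage
  (_ : _ \o _ = id) ?preimage_id; last by apply/funext => z /=; rewrite rV_consK.
by rewrite product_measure1E// lte_mul_pinfty// ge0_fin_numE.
Qed.

HB.instance Definition _ := Measure_isSigmaFinite.Build _ _ _
  lebesgue_rV_step step_sigma_finite.

End step.

(* Lebesgue measure on R^n, as the n-fold product of the Lebesgue measure on R;
   on R^0 it is the Dirac mass at the unique point. *)
Fixpoint lebesgue_rV (n : nat) : {sigma_finite_measure set 'rV[R]_n -> \bar R} :=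
  match n with
  | 0 => @dirac _ 'rV[R]_0 0%R R
  | n'.+1 => lebesgue_rV_step (lebesgue_rV n')
  end.

End lebesgue_rV.

Section boxes.
Context {R : realType}.

Definition box n (a b : 'rV[R]_n) : set 'rV[R]_n :=
  [set x | forall i, a ord0 i <= x ord0 i <= b ord0 i].

Lemma measurable_box n (a b : 'rV[R]_n) : measurable (box a b).
Proof.
rewrite (_ : box a b =
  \bigcap_(i in [set: 'I_n]) ((fun x : 'rV[R]_n => x ord0 i) @^-1`
     `[a ord0 i, b ord0 i])); last first.
  apply/seteqP; split=> x /= xab i; first by move=> _; rewrite /= in_itv/=.
  by have := xab i I; rewrite /= in_itv.
apply: fin_bigcap_measurable => // i _; rewrite -[X in measurable X]setTI.
by apply: measurable_coord_rV => //; exact: measurable_itv.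
Qed.

Variable d : nat.
Implicit Types (I J : {set 'I_d}) (i : 'I_d).

(* R^J is represented by 'rV_#|J|, its k-th coordinate being the coordinate of
   index enum_val k in J. *)
Definition rV_proj J (x : 'rV[R]_d) : 'rV[R]_#|J| :=
  \row_k x ord0 (enum_val k).

Definition rV_embed J (w : 'rV[R]_#|J|) : 'rV[R]_d :=
  \sum_(k < #|J|) w ord0 k *: delta_mx ord0 (enum_val k).

(* (w_{-I}, t_I) *)
Definition rV_glue I (w : 'rV[R]_#|~: I|) (t : 'rV[R]_#|I|) : 'rV[R]_d :=
  rV_embed w + rV_embed t.

(* (w_{-i}, t) *)
Definition rV_insert i (w : 'rV[R]_#|~: [set i]|) (t : R) : 'rV[R]_d :=
  rV_embed w + t *: delta_mx ord0 i.

End boxes.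

Section averaging.
Context {R : realType} {d : nat}.
Variables (a b : 'rV[R]_d).
Implicit Types (I : {set 'I_d}) (i : 'I_d) (phi : 'rV[R]_d -> R).

Local Notation S_ J := (box (rV_proj J a) (rV_proj J b)).
Local Notation mS_ J := (measurable_box (rV_proj J a) (rV_proj J b)).

(* The operators below act on functions on S = box a b: at a point of S, their
   value only depends on the restriction of phi to S. *)
Definition avg i phi : 'rV[R]_d -> R := fun w =>
  (b ord0 i - a ord0 i)^-1 *
  \int[lebesgue_measure]_(t in `[a ord0 i, b ord0 i])
    phi (rV_insert (rV_proj (~: [set i]) w) t).

Definition calP I phi : 'rV[R]_d -> R :=
  foldr (fun i psi w => psi w - avg i psi w) phi (enum I).

Definition calR I phi : 'rV[R]_d -> R := fun w => phi w - calP I phi w.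

Local Open Scope ereal_scope.

(* The base value -oo only matters for empty I. *)
Definition Lambda_sl I phi : \bar R :=
  \big[maxe/-oo]_(i in I)
    ess_sup (mrestr (@lebesgue_rV R #|~: [set i]|) (mS_ (~: [set i])))
      (fun w => \int[lebesgue_measure]_(t in `[a ord0 i, b ord0 i])
                  `|phi (rV_insert w t)|%:E).

Definition Lambda_mix I phi : \bar R :=
  ess_sup (mrestr (@lebesgue_rV R #|~: I|) (mS_ (~: I)))
    (fun w => \int[@lebesgue_rV R #|I|]_(t in S_ I) `|phi (rV_glue w t)|%:E).

Definition Linfty_norm phi : \bar R :=
  'N[mrestr (@lebesgue_rV R d) (measurable_box a b)]_+oo [EFin \o phi].

End averaging.

Section charges.
Context d {T : measurableType d} {R : realType}.
Variable nu : {charge set T -> \bar R}.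
Local Open Scope ereal_scope.

Lemma ex_hahn : exists PN : set T * set T, hahn_decomposition nu PN.1 PN.2.
Proof. by have [P [N PN]] := Hahn_decomposition nu; exists (P, N). Qed.

(* The choice of the Hahn decomposition does not matter: the Jordan
   decomposition of nu does not depend on it. *)
Let hahnP := svalP (cid ex_hahn).

Definition charge_total_variation : set T -> \bar R := charge_variation hahnP.

(* \int_U f dnu *)
Definition charge_integral (U : set T) (f : T -> R) : \bar R :=
  \int[jordan_pos hahnP]_(x in U) (f x)%:E -
  \int[jordan_neg hahnP]_(x in U) (f x)%:E.

End charges.

Section distributions.
Context {R : realType} {d : nat}.
Implicit Types (I : {set 'I_d}) (U S : set 'rV[R]_d) (f h : 'rV[R]_d -> R).
Local Notation leb := (@lebesgue_rV R d).

(* For f given on a closed box S, partials I f is only meaningful in the interior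
   S°: the values on the boundary of S, a null set, depend on f outside S. *)
Definition partials I f : 'rV[R]_d -> R :=
  foldr (fun i g => 'D_(delta_mx ord0 i) g) f (enum I).

(* C^k up to the boundary of S: f is C^k in the interior of S, and all its
   partial derivatives of order at most k extend continuously to S. *)
Fixpoint C_upto (k : nat) S f : Prop :=
  {within S, continuous f} /\
  match k with
  | 0 => True
  | k'.+1 => forall i : 'I_d, exists2 g : 'rV[R]_d -> R,
      (forall x, S° x -> is_derive x (delta_mx ord0 i) f (g x)) & C_upto k' S g
  end.

Definition smooth f : Prop := forall k, C_upto k setT f.

Definition test_function U f : Prop :=
  [/\ smooth f, compact (closure [set x | f x != 0]) &
      closure [set x | f x != 0] `<=` U].

Local Open Scope ereal_scope.

(* D_I h, as a distribution on the open set U, is the measure nu. Elements of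
   M(U) are given by finite signed Borel measures on R^d, of which only the
   restriction to U matters; they are automatically Radon. *)
Definition distr_deriv_is U I h
    (nu : {charge set 'rV[R]_d -> \bar R}) : Prop :=
  forall zeta, test_function U zeta ->
    charge_integral nu U zeta =
    ((-1) ^+ #|I|)%:E * \int[leb]_(x in U) (h x * partials I zeta x)%:E.

Definition distr_deriv_measure U I h : Prop :=
  exists nu : {charge set 'rV[R]_d -> \bar R}, distr_deriv_is U I h nu.

(* |D_I h|(U); as D_I h determines nu on U, the set below has at most one
   element, and none if D_I h is not a measure. *)
Definition distr_deriv_mass U I h : \bar R :=
  ereal_inf [set charge_total_variation nu U |
    nu in [set nu : {charge set 'rV[R]_d -> \bar R} | distr_deriv_is U I h nu]].

Definition BV S f : Prop :=
  leb.-integrable S (EFin \o f) /\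
  forall i, distr_deriv_measure S° [set i] f.

Definition TV S I f : \bar R := \sum_(i in I) distr_deriv_mass S° [set i] f.

Definition Vext S I f : \bar R :=
  ereal_inf [set distr_deriv_mass setT I g | g in [set g : 'rV[R]_d -> R |
    [/\ leb.-integrable setT (EFin \o g),
        {ae leb, forall x, S x -> g x = f x} &
        distr_deriv_measure setT I g]]].

Definition prob_density (p : 'rV[R]_d -> R) : Prop :=
  [/\ forall x, (0 <= p x)%R, leb.-integrable setT (EFin \o p) &
      \int[leb]_x (p x)%:E = 1].

End distributions.

(* Main.v *)
Require Import Defs.
From mathcomp Require Import all_boot all_order all_algebra.
From mathcomp Require Import all_classical all_reals all_analysis ess_sup_inf.
From mathcomp Require Import measurable_realfun ring lra.

Set Implicit Arguments.
Unset Strict Implicit.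
Unset Printing Implicit Defensive.

Import Order.TTheory GRing.Theory Num.Theory.
Import numFieldNormedType.Exports.

Local Open Scope classical_set_scope.
Local Open Scope ring_scope.

(** Why the bounds hold. On the box write [phi = calP phi + calR phi]. The second
    part costs at most its sup norm times the mass of [p] on the box, and the
    complement of the box contributes the last term, so everything rests on the
    integral of [psi p] with [psi = calP phi] ([expectation_bound]).

    Each factor [Id - Pi_i] of [calP] removes the mean along the [i]-th coordinate,
    so [psi] has mean zero along every direction of [I]. Fix a nonempty set [J] of
    such directions and let [Psi] be the iterated antiderivative of [psi] in the
    directions of [J], starting from the faces. Because of the zero means, [Psi]
    also vanishes at the opposite faces, hence is admissible as a test function,
    and in each direction it equals half the difference of the integrals to the
    left and to the right, so that [|Psi| <= 2^-|J| M] when [M] bounds the integrals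
    of [|psi|] over the slices parallel to [R^J]. Therefore the integral of
    [psi p = (d_J Psi) p] is at most [2^-|J| M] times the variation [|D_J p|].
    Taking [J = I] gives the bounds with [Lambda_mix]; taking [J = {i}] and
    averaging over [i] in [I] gives the one with [Lambda_sl].

    As [psi] is merely bounded, [Psi] is not smooth. Two approximations fix this.
    First, [psi] is replaced by its averages over the cells of a dyadic grid. They
    inherit a discrete form of the zero means and of the bound [M]
    ([cavg_zero_sum], [cavg_sum_le]) and converge weakly to [psi]
    ([averages_weak_cvg]). Second, the indicator function of each cell is replaced
    by a product of smooth bumps, whose antiderivatives are smooth steps; the
    discrete zero means make the resulting [Psi] a test function and yield the
    factor [2^-|J|] ([grid_approx]). Passing to both limits gives
    [mean_zero_pairing_bound].

    Besides its integrability, [p] enters only through [test_bound]: a number [V] such that the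
    pairing of [p] with [d_J zeta] is at most [V] times the sup norm of [zeta]. If
    [D_J h] is a measure on an open set containing the interior of the box, and
    [h = p] there, its total variation is such a number ([test_bound_distr]), and
    one passes to the infimum; if [p] is [C^|J|] up to the boundary, integration by
    parts provides the integral of [|d_J p|] ([test_bound_deriv]).

    The averaging operators and the envelopes are insensitive to changes of [phi] on
    null sets of the box, so that [phi] can be assumed bounded everywhere. *)

(** * The product structure of Lebesgue measure *)

Section split.
Local Open Scope ereal_scope.
Context d d1 d2 (T : measurableType d) (X : measurableType d1)
  (Y : measurableType d2) (R : realType).
Variables (mu : {measure set T -> \bar R})
  (m1 : {sigma_finite_measure set X -> \bar R})
  (m2 : {sigma_finite_measure set Y -> \bar R}) (g : X * Y -> T).
Hypothesis mg : measurable_fun setT g.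
Hypothesis pg : forall A, measurable A -> mu A = (m1 \x m2) (g @^-1` A).

Let mp : {measure set T -> \bar R} :=
  measure_function_pushforward__canonical__measure_function_Measure
    (m1 \x m2) mg.

Let mpE A : measurable A -> A `<=` setT -> mu A = mp A.
Proof. by move=> mA _; rewrite pg. Qed.

(** The chart [g] is abstract so that the same proofs serve the splitting off of a
    single coordinate, with second factor [R], and of a set [J] of coordinates, with
    second factor [R^J]. *)
Lemma split_tonelli (f : T -> \bar R) : measurable_fun setT f ->
  (forall x, 0 <= f x) ->
  \int[mu]_x f x = \int[m1]_x \int[m2]_y f (g (x, y)).
Proof.
move=> mf f0; rewrite (eq_measure_integral mp mpE) /=.
rewrite ge0_integral_pushforward// -(fubini_tonelli1 (f \o g))//.
  exact: measurableT_comp.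
by move=> x; exact: f0.
Qed.

Lemma split_integrable (f : T -> \bar R) : mu.-integrable setT f ->
  (m1 \x m2).-integrable setT (f \o g).
Proof.
move=> /integrableP[mf foo]; apply/integrableP; split.
  exact: measurableT_comp.
move: foo; rewrite (eq_measure_integral mp mpE) /=.
by rewrite ge0_integral_pushforward//; exact: measurableT_comp.
Qed.

Lemma split_fubini (f : T -> \bar R) : mu.-integrable setT f ->
  \int[mu]_x f x = \int[m1]_x \int[m2]_y f (g (x, y)).
Proof.
move=> fi; have fgi := split_integrable fi.
rewrite (eq_measure_integral mp mpE) /=.
rewrite integral_pushforward//; last by case/integrableP : fi.
by rewrite -(integral12_prod_meas1 fgi).
Qed.

Lemma split_ae (P : T -> Prop) : {ae mu, forall x, P x} ->
  {ae m1, forall x, {ae m2, forall y, P (g (x, y))}}.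
Proof.
move=> [N [mN N0 PN]].
have : \int[mu]_x (\1_N x)%:E = 0 by rewrite integral_indic// setIT.
have mi : measurable_fun setT (EFin \o \1_N : T -> \bar R).
  exact/measurable_EFinP.
rewrite split_tonelli//.
have mh : measurable_fun setT (fun x => \int[m2]_y (\1_N (g (x, y)))%:E).
  apply: (@measurable_fun_fubini_tonelli_F _ _ _ _ _ m2 (fun z => (\1_N (g z))%:E)) => //.
  exact: (measurableT_comp mi).
move=> h0; have /(ae_eq_integral_abs m1 measurableT mh).1 :
    \int[m1]_x `|\int[m2]_y (\1_N (g (x, y)))%:E| = 0.
  rewrite -[RHS]h0; apply: eq_integral => x _; rewrite gee0_abs//.
  by apply: integral_ge0.
apply: filterS => x /(_ I); rewrite integral_indic//=; last first.
  rewrite -[X in measurable X]setTI; exact: (measurableT_comp mg (pair1_measurable x)).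
rewrite setIT => Nx0; exists ((fun y => g (x, y)) @^-1` N); split => //.
  rewrite -[X in measurable X]setTI; exact: (measurableT_comp mg (pair1_measurable x)).
by move=> y/= nP; apply: PN.
Qed.

End split.

Section cylinders.
Local Open Scope ereal_scope.
Context {R : realType}.

Definition cyl n (A : 'I_n -> set R) : set 'rV[R]_n :=
  [set x | forall j, A j (x ord0 j)].

Lemma measurable_cyl n (A : 'I_n -> set R) :
  (forall j, measurable (A j)) -> measurable (cyl A).
Proof.
move=> mA; rewrite (_ : cyl A =
  \bigcap_(i in [set: 'I_n]) ((fun x : 'rV[R]_n => x ord0 i) @^-1` A i)); last first.
  apply/seteqP; split=> x /= xab i; first by move=> _; exact: xab.
  exact: xab.
apply: fin_bigcap_measurable => // i _; rewrite -[X in measurable X]setTI.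
exact: measurable_coord_rV.
Qed.

Lemma lebesgue_rV_cyl n (A : 'I_n -> set R) : (forall j, measurable (A j)) ->
  lebesgue_rV n (cyl A) = \prod_j lebesgue_measure (A j).
Proof.
elim: n A => [|n IH] A mA.
  rewrite big_ord0 /= diracE mem_set//=; by case.
rewrite big_ord_recl /= /lebesgue_rV_step /pushforward.
rewrite (_ : _ @^-1` _ = A ord0 `*` cyl (fun j => A (lift ord0 j))); last first.
  apply/seteqP; split => [[t w] /= h|[t w] /= [h1 h2]].
    have := @rV_consK R n (t, w); rewrite /rV_uncons => -[e1 e2].
    by split=> [|j] /=; [rewrite -e1|rewrite -[w]e2 mxE]; exact: h.
  have := @rV_consK R n (t, w); rewrite /rV_uncons => -[e1 e2] j.
  case: (unliftP ord0 j) => [k ->|->]; last by rewrite e1.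
  by have := h2 k; rewrite -[in X in X -> _]e2 mxE.
rewrite product_measure1E//; [|exact: mA|exact: measurable_cyl].
by rewrite IH.
Qed.

Definition cyls (n : nat) : set (set 'rV[R]_n) :=
  [set cyl A | A in [set A : 'I_n -> set R | forall j, measurable (A j)]].

Lemma measurable_rVE n : @measurable _ 'rV[R]_n = <<s @cyls n >>.
Proof.
apply/seteqP; split.
  apply: smallest_sub; first exact: smallest_sigma_algebra.
  rewrite -bigcup_seq/=; apply: bigcup_sub => i _ _ [B mB <-].
  apply: sub_sigma_algebra.
  exists (fun j => if j == i then B else setT) => [j|].
    by case: ifP => // _; exact: measurableT.
  rewrite setTI; apply/seteqP; split => x /=.
    by move/(_ i); rewrite eqxx.
  by move=> Bx j; case: eqP => // ->.
apply: smallest_sub; first exact: sigma_algebra_measurable.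
by move=> _ [A mA <-]; exact: measurable_cyl.
Qed.

Lemma setI_closed_cyls n : setI_closed (@cyls n).
Proof.
move=> _ _ [A mA <-] [B mB <-]; exists (fun j => A j `&` B j).
  by move=> j; exact: measurableI.
apply/seteqP; split => x /=; first by move=> h; split => j; case: (h j).
by move=> [h1 h2] j; split.
Qed.

(** Products of measurable sets form a generating pi-system, which contains an
    exhausting sequence of cubes of finite measure. *)
Lemma lebesgue_rV_unique n (m : {measure set 'rV[R]_n -> \bar R}) :
  (forall A : 'I_n -> set R, (forall j, measurable (A j)) ->
    m (cyl A) = \prod_j lebesgue_measure (A j)) ->
  forall B, measurable B -> lebesgue_rV n B = m B.
Proof.
move=> mE B mB.
have mitv (k : nat) : forall j : 'I_n, measurable ((fun=> `[- k%:R, k%:R]%classic%R : set R) j).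
  by move=> j; exact: measurable_itv.
apply: (measure_unique (@cyls n) (fun k => cyl (fun=> `[- k%:R, k%:R]%classic%R))) => //.
- exact: measurable_rVE.
- exact: setI_closed_cyls.
- by move=> k; exists (fun=> `[- k%:R, k%:R]%classic%R).
- rewrite -subTset => x _.
  exists (Num.Def.truncn (\sum_j `|x ord0 j|)%R).+1 => //= j.
  rewrite /= in_itv/= -ler_norml; apply/ltW.
  have := truncnS_gt (\sum_j `|x ord0 j|)%R; apply: le_lt_trans.
  by rewrite (bigD1 j)//= lerDl sumr_ge0.
- by move=> _ [A mA <-]; rewrite mE//; exact: lebesgue_rV_cyl.
- move=> k; apply: (@le_lt_trans _ _ (\prod_(j < n) (k%:R - - k%:R)%R%:E)); last first.
    by rewrite prodEFin ltry.
  rewrite [leLHS]lebesgue_rV_cyl//.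
  rewrite (eq_bigr (fun=> (k%:R - - k%:R)%R%:E)) => // j _.
  by rewrite lebesgue_measure_itv/= lte_fin; case: ltP => //= h;
    congr (_%:E); have : (0 <= k%:R :> R)%R by []; lra.
Qed.

End cylinders.

Section splitting_coordinates.
Context {R : realType} {d : nat}.
Implicit Types (J : {set 'I_d}) (i j : 'I_d).

Lemma rV_embedE J (w : 'rV[R]_#|J|) (k : 'I_#|J|) :
  rV_embed w ord0 (enum_val k) = w ord0 k.
Proof.
rewrite /rV_embed summxE (bigD1 k)//= !mxE !eqxx mulr1 big1 ?addr0// => l lk.
rewrite !mxE eqxx/=; case: eqP => [/enum_val_inj kl|]; last by rewrite mulr0.
by rewrite kl eqxx in lk.
Qed.

Lemma rV_embed_notin J (w : 'rV[R]_#|J|) j : j \notin J ->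
  rV_embed w ord0 j = 0.
Proof.
move=> jJ; rewrite /rV_embed summxE big1// => k _; rewrite !mxE eqxx/=.
case: eqP => [jk|]; last by rewrite mulr0.
by move: jJ; rewrite jk enum_valP.
Qed.

Lemma in_enum_val J j : j \in J -> exists k : 'I_#|J|, j = enum_val k.
Proof. by move=> jJ; exists (enum_rank_in jJ j); rewrite enum_rankK_in. Qed.

Lemma rV_glue_in J (w : 'rV[R]_#|~: J|) (t : 'rV[R]_#|J|) (k : 'I_#|J|) :
  rV_glue w t ord0 (enum_val k) = t ord0 k.
Proof. by rewrite mxE rV_embedE rV_embed_notin ?add0r// !inE enum_valP. Qed.

Lemma rV_glue_notin J (w : 'rV[R]_#|~: J|) (t : 'rV[R]_#|J|) (k : 'I_#|~: J|) :
  rV_glue w t ord0 (enum_val k) = w ord0 k.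
Proof.
rewrite mxE rV_embedE rV_embed_notin ?addr0//.
by have := enum_valP k; rewrite inE.
Qed.

Lemma rV_insert_in i (w : 'rV[R]_#|~: [set i]|) (t : R) :
  rV_insert w t ord0 i = t.
Proof. by rewrite /rV_insert mxE rV_embed_notin ?inE ?eqxx// add0r !mxE !eqxx mulr1. Qed.

Lemma rV_insert_notin i (w : 'rV[R]_#|~: [set i]|) (t : R)
    (k : 'I_#|~: [set i]|) :
  rV_insert w t ord0 (enum_val k) = w ord0 k.
Proof.
rewrite /rV_insert mxE rV_embedE !mxE eqxx/=.
case: eqP => [ki|_]; last by rewrite mulr0 addr0.
by have := enum_valP k; rewrite !inE ki eqxx.
Qed.

Lemma rV_insert_proj i (w : 'rV[R]_#|~: [set i]|) (t : R) :
  rV_proj (~: [set i]) (rV_insert w t) = w.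
Proof. by apply/rowP => k; rewrite mxE rV_insert_notin. Qed.

Lemma cyl_glue J (A : 'I_d -> set R) (w : 'rV[R]_#|~: J|) (t : 'rV[R]_#|J|) :
  cyl A (rV_glue w t) <->
  cyl (fun k => A (enum_val k)) w /\ cyl (fun k => A (enum_val k)) t.
Proof.
split=> [h|[hw ht] j].
  split=> k; first by rewrite -(rV_glue_notin w t); exact: h.
  by rewrite -(rV_glue_in w t); exact: h.
have [jJ|jJ] := boolP (j \in J).
  by have [k ->] := in_enum_val jJ; rewrite rV_glue_in.
have {}jJ : j \in ~: J by rewrite inE.
by have [k ->] := in_enum_val jJ; rewrite rV_glue_notin.
Qed.

Lemma cyl_insert i (A : 'I_d -> set R) (w : 'rV[R]_#|~: [set i]|) (t : R) :
  cyl A (rV_insert w t) <->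
  cyl (fun k => A (enum_val k)) w /\ A i t.
Proof.
split=> [h|[hw ht] j].
  split=> [k|]; first by rewrite -(rV_insert_notin w t); exact: h.
  by rewrite -[t](rV_insert_in w t); exact: h.
have [->|ji] := eqVneq j i; first by rewrite rV_insert_in.
have {}ji : j \in ~: [set i] by rewrite !inE.
by have [k ->] := in_enum_val ji; rewrite rV_insert_notin.
Qed.

Lemma measurable_rV_glue J :
  measurable_fun setT (fun z : 'rV[R]_#|~: J| * 'rV[R]_#|J| => rV_glue z.1 z.2).
Proof.
apply: measurable_fun_rV => j.
have [jJ|jJ] := boolP (j \in J).
  have [k ->] := in_enum_val jJ; under eq_fun do rewrite rV_glue_in.
  exact: (measurableT_comp (measurable_coord_rV k)).
have {}jJ : j \in ~: J by rewrite inE.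
have [k ->] := in_enum_val jJ; under eq_fun do rewrite rV_glue_notin.
exact: (measurableT_comp (measurable_coord_rV k)).
Qed.

Lemma measurable_rV_insert i :
  measurable_fun setT (fun z : 'rV[R]_#|~: [set i]| * R => rV_insert z.1 z.2).
Proof.
apply: measurable_fun_rV => j.
have [->|ji] := eqVneq j i.
  by under eq_fun do rewrite rV_insert_in; exact: measurable_snd.
have {}ji : j \in ~: [set i] by rewrite !inE.
have [k ->] := in_enum_val ji; under eq_fun do rewrite rV_insert_notin.
exact: (measurableT_comp (measurable_coord_rV k)).
Qed.

Local Open Scope ereal_scope.

Let mglue J : {measure set 'rV[R]_d -> \bar R} :=
  measure_function_pushforward__canonical__measure_function_Measure
    (@lebesgue_rV R #|~: J| \x @lebesgue_rV R #|J|) (@measurable_rV_glue J).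

(** On a product of sets both sides are the same product of lengths, up to the order
    of the factors. *)
Lemma lebesgue_rV_glue J (A : set 'rV[R]_d) : measurable A ->
  lebesgue_rV d A = (lebesgue_rV #|~: J| \x lebesgue_rV #|J|)
    ((fun z : 'rV[R]_#|~: J| * 'rV[R]_#|J| => rV_glue z.1 z.2) @^-1` A).
Proof.
move=> mA; apply: (@lebesgue_rV_unique _ _ (mglue J)) => // {A mA} A mA.
rewrite /= /pushforward (_ : _ @^-1` _ = cyl (fun k => A (enum_val k)) `*`
  cyl (fun k => A (enum_val k))); last first.
  by apply/seteqP; split => -[w t] /=; rewrite cyl_glue.
rewrite product_measure1E//; try exact: measurable_cyl.
transitivity ((\prod_(k < #|~: J|) lebesgue_measure (A (enum_val k))) *
    (\prod_(k < #|J|) lebesgue_measure (A (enum_val k)))).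
  by congr (_ * _); apply: lebesgue_rV_cyl.
rewrite -(big_enum_val (fun j => lebesgue_measure (A j))).
rewrite -(big_enum_val (fun j => lebesgue_measure (A j))).
rewrite [RHS](bigID (mem J))/= muleC; congr (_ * _).
by apply: eq_bigl => j; rewrite !inE.
Qed.

Let minsert i : {measure set 'rV[R]_d -> \bar R} :=
  measure_function_pushforward__canonical__measure_function_Measure
    (@lebesgue_rV R #|~: [set i]| \x @lebesgue_measure R) (@measurable_rV_insert i).

Lemma lebesgue_rV_insert i (A : set 'rV[R]_d) : measurable A ->
  lebesgue_rV d A = (lebesgue_rV #|~: [set i]| \x @lebesgue_measure R)
    ((fun z : 'rV[R]_#|~: [set i]| * R => rV_insert z.1 z.2) @^-1` A).
Proof.
move=> mA; apply: (@lebesgue_rV_unique _ _ (minsert i)) => // {A mA} A mA.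
rewrite /= /pushforward (_ : _ @^-1` _ = cyl (fun k => A (enum_val k)) `*` A i);
  last by apply/seteqP; split => -[w t] /=; rewrite cyl_insert.
rewrite product_measure1E//; [|exact: measurable_cyl|exact: mA].
transitivity ((\prod_(k < #|~: [set i]|) lebesgue_measure (A (enum_val k))) *
    lebesgue_measure (A i)).
  by congr (_ * _); apply: lebesgue_rV_cyl.
rewrite -(big_enum_val (fun j => lebesgue_measure (A j))).
rewrite [RHS](bigD1 i)//= muleC; congr (_ * _).
by apply: eq_bigl => j; rewrite !inE.
Qed.

End splitting_coordinates.

Section topology_rV.
Context {R : realType} {n : nat}.
Local Open Scope ring_scope.

(** The open boxes with rational centre and radius form a countable basis. *)
Lemma open_measurable_rV (U : set 'rV[R]_n) : open U -> measurable U.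
Proof.
move=> oU.
pose ratbox (q : 'rV[rat]_n) (e : rat) : set 'rV[R]_n :=
  cyl (fun j => `]ratr (q ord0 j) - ratr e, ratr (q ord0 j) + ratr e[%classic).
pose D : set ('rV[rat]_n * rat) := [set z | ratbox z.1 z.2 `<=` U].
have -> : U = \bigcup_(z in D) ratbox z.1 z.2.
  apply/seteqP; split => [x Ux|x [z Dz]]; last exact: Dz.
  have /nbhs_ballP[e /= e0 eU] : nbhs x U by exact: open_nbhs_nbhs.
  have [q /andP[q0 qe]] : exists q : rat, (0 < ratr q :> R) && (ratr q < e / 2).
    have [q] := @rat_in_itvoo R 0 (e / 2) ltac:(by rewrite divr_gt0).
    by rewrite in_itv/= => ?; exists q.
  have /choice[r xr] : forall j, exists r : rat, x ord0 j - ratr q < ratr r < x ord0 j + ratr q.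
    move=> j; have [r] := @rat_in_itvoo R (x ord0 j - ratr q) (x ord0 j + ratr q) ltac:(lra).
    by rewrite in_itv/= => ?; exists r.
  exists (\row_j r j, q); last first.
    by move=> j /=; rewrite in_itv/= mxE; move: (xr j); lra.
  move=> y ry; apply: eU; split => // i j; rewrite (ord1 i).
  have := ry j; rewrite /= in_itv/= mxE => yr.
  by rewrite /ball/= ltr_norml; move: (xr j) yr => /andP[? ?] /andP[? ?]; lra.
rewrite bigcup_mkcond; apply: countable_bigcupT_measurable => [|z].
  exact: countableP.
case: ifP => // _; apply: measurable_cyl => j; exact: measurable_itv.
Qed.

Lemma continuous_measurable_rV (U : set 'rV[R]_n) (f : 'rV[R]_n -> R) :
  open U -> (forall x, U x -> {for x, continuous f}) -> measurable_fun U f.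
Proof.
move=> oU cf; apply: (measurability (@RGenOInfty.G R)) => [|_ [_ [x ->] <-]].
  exact: RGenOInfty.measurableE.
apply: open_measurable_rV; rewrite openE => y [Uy fy].
apply: filterI; first exact: open_nbhs_nbhs.
by apply: (cf y Uy); apply: open_nbhs_nbhs; split => //; exact: interval_open.
Qed.

Lemma open_cyl (A : 'I_n -> set R) : (forall j, open (A j)) -> open (cyl A).
Proof.
move=> oA; rewrite openE => x Ax; rewrite /interior/cyl/=.
have := @filter_forall 'rV[R]_n 'I_n (fun j y => A j (y ord0 j)) (nbhs x).
apply => j.
have := @coord_continuous R 1 n ord0 j x; apply.
by apply: open_nbhs_nbhs; split.
Qed.

(** An interior point can be moved a little in each coordinate direction, so none of
    its coordinates is at an end of its range. *)
Lemma interior_box (a b : 'rV[R]_n) :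
  (box a b)° = cyl (fun j => `]a ord0 j, b ord0 j[%classic).
Proof.
apply/seteqP; split=> [x /nbhs_ballP[e /= e0 eS] j|]; last first.
  rewrite -open_subsetE; last first.
    by apply: open_cyl => j; exact: interval_open.
  by move=> x h j; have := h j; rewrite /= in_itv/= => /andP[/ltW-> /ltW->].
have bx (s : R) : `|s| < e -> box a b (x + s *: delta_mx ord0 j).
  move=> se; apply: eS; split => // k l; rewrite (ord1 k) !mxE eqxx/= /ball/=.
  rewrite opprD addrA subrr add0r normrN normrM.
  case: (l == j); rewrite ?normr1 ?mulr1// normr0 mulr0//.
have /(_ j) := bx (e / 2) ltac:(by rewrite gtr0_norm; lra).
have /(_ j) := bx (- (e / 2)) ltac:(by rewrite normrN gtr0_norm; lra).
rewrite !mxE !eqxx !mulr1 /= in_itv/=; lra.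
Qed.

Lemma boxE (a b : 'rV[R]_n) :
  box a b = cyl (fun j => `[a ord0 j, b ord0 j]%classic).
Proof. by apply/seteqP; split=> x h j; have := h j; rewrite /= in_itv. Qed.

Lemma lebesgue_rV_hyperplane (i : 'I_n) (c : R) :
  lebesgue_rV n [set x : 'rV[R]_n | x ord0 i = c] = 0%E.
Proof.
rewrite (_ : [set _ | _] = cyl (fun j => if j == i then [set c] else setT)).
  rewrite lebesgue_rV_cyl.
    by rewrite (bigD1 i)//= eqxx lebesgue_measure_set1 mul0e.
  by move=> j; case: ifP.
apply/seteqP; split => x /=; first by move=> xc j; case: eqP => [->|].
by move/(_ i); rewrite eqxx.
Qed.

Lemma measurable_hyperplane (i : 'I_n) (c : R) :
  measurable [set x : 'rV[R]_n | x ord0 i = c].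
Proof.
rewrite -[X in measurable X]setTI.
exact: (measurable_coord_rV i measurableT (measurable_set1 c)).
Qed.

Lemma compact_box (a b : 'rV[R]_n) : compact (box a b).
Proof. by rewrite boxE; apply: rV_compact => j; exact: segment_compact. Qed.

End topology_rV.

Section fubini_rV.
Context {R : realType} {d : nat}.
Implicit Types (J : {set 'I_d}) (i : 'I_d).
Local Open Scope ereal_scope.
Local Notation leb := (@lebesgue_rV R d).

Lemma insert_fubini i (f : 'rV[R]_d -> \bar R) : leb.-integrable setT f ->
  \int[leb]_x f x = \int[@lebesgue_rV R #|~: [set i]|]_w
    \int[lebesgue_measure]_t f (rV_insert w t).
Proof.
move=> fi; exact: (@split_fubini _ _ _ _ _ _ R leb
  (lebesgue_rV #|~: [set i]|) lebesgue_measure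
  (fun z => rV_insert z.1 z.2) (@measurable_rV_insert R d i)
  (@lebesgue_rV_insert R d i) f fi).
Qed.

Lemma insert_ae i (P : 'rV[R]_d -> Prop) : {ae leb, forall x, P x} ->
  {ae @lebesgue_rV R #|~: [set i]|, forall w,
    {ae (@lebesgue_measure R), forall t, P (rV_insert w t)}}.
Proof.
move=> fi; exact: (@split_ae _ _ _ _ _ _ R leb
  (lebesgue_rV #|~: [set i]|) lebesgue_measure
  (fun z => rV_insert z.1 z.2) (@measurable_rV_insert R d i)
  (@lebesgue_rV_insert R d i) P fi).
Qed.

Lemma insert_integrable i (f : 'rV[R]_d -> \bar R) : leb.-integrable setT f ->
  (@lebesgue_rV R #|~: [set i]|).-integrable setT
    (fun w => \int[lebesgue_measure]_t f (rV_insert w t)).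
Proof.
move=> fi; have fi' := @split_integrable _ _ _ _ _ _ R leb
  (lebesgue_rV #|~: [set i]|) lebesgue_measure
  (fun z => rV_insert z.1 z.2) (@measurable_rV_insert R d i)
  (@lebesgue_rV_insert R d i) f fi.
exact: (integrable_fubini_F fi').
Qed.

End fubini_rV.

Section measurable_inner_integrals.
Context {R : realType} {d : nat}.
Implicit Types (J : {set 'I_d}) (i : 'I_d).
Local Open Scope ereal_scope.

Lemma measurable_insert_integral_ge0 i (f : 'rV[R]_d -> \bar R) :
  measurable_fun setT f -> (forall x, 0 <= f x) ->
  measurable_fun setT (fun w : 'rV[R]_#|~: [set i]| =>
    \int[@lebesgue_measure R]_t f (rV_insert w t)).
Proof.
move=> mf f0; apply: (@measurable_fun_fubini_tonelli_F _ _ _ _ _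
  (@lebesgue_measure R) (fun z => f (rV_insert z.1 z.2))) => //.
exact: (measurableT_comp mf (@measurable_rV_insert R d i)).
Qed.

Lemma measurable_insert_integral i (f : 'rV[R]_d -> \bar R) :
  measurable_fun setT f ->
  measurable_fun setT (fun w : 'rV[R]_#|~: [set i]| =>
    \int[@lebesgue_measure R]_t f (rV_insert w t)).
Proof.
move=> mf.
rewrite (_ : (fun w => _) = (fun w : 'rV[R]_#|~: [set i]| =>
    (\int[@lebesgue_measure R]_t f^\+ (rV_insert w t)) -
    (\int[@lebesgue_measure R]_t f^\- (rV_insert w t)))); last first.
  apply/funext => w; rewrite [LHS]integralE.
  by congr (_ - _); apply: eq_integral => t _;
    rewrite ?funeposE ?funenegE.
apply: emeasurable_funB; apply: measurable_insert_integral_ge0 => //.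
- exact: measurable_funepos.
- exact: measurable_funeneg.
Qed.

Lemma measurable_rV_proj J : measurable_fun setT (@rV_proj R d J).
Proof.
apply: measurable_fun_rV => k; rewrite /rV_proj.
under eq_fun do rewrite mxE; exact: measurable_coord_rV.
Qed.

Lemma ae_proj i (P : 'rV[R]_#|~: [set i]| -> Prop) :
  {ae @lebesgue_rV R #|~: [set i]|, forall w, P w} ->
  {ae @lebesgue_rV R d, forall x, P (rV_proj (~: [set i]) x)}.
Proof.
move=> [N [mN N0 PN]]; exists (@rV_proj R d (~: [set i]) @^-1` N); split.
- by rewrite -[X in measurable X]setTI; exact: measurable_rV_proj.
- rewrite (@lebesgue_rV_insert R d i); last first.
    by rewrite -[X in measurable X]setTI; exact: measurable_rV_proj.
  rewrite (_ : _ @^-1` _ = N `*` setT); last first.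
    apply/seteqP; split => -[w t] /=; first by rewrite rV_insert_proj.
    by move=> [? _]; rewrite rV_insert_proj.
  apply: etrans (product_measure1E _ _ mN measurableT) _.
  by rewrite [X in X * _]N0 mul0e.
- by move=> x /= nP; apply: PN.
Qed.

End measurable_inner_integrals.

(** * Smooth steps on the real line *)

Section derive_tools.
Context {R : realType}.

Lemma is_derive_cvgP (V : normedModType R) (f : V -> R) (x v : V) (l : R) :
  h^-1 *: (f (h *: v + x) - f x) @[h --> 0^'] --> l <-> is_derive x v f l.
Proof.
split=> [fl|[/[swap] <- //]]; apply: DeriveDef; first by apply/cvg_ex; exists l.
by rewrite /derive; apply/cvg_lim.
Qed.

(** Reduces partial derivatives in [R^d] to derivatives in one variable. *)
Lemma is_derive_line (V : normedModType R) (f : V -> R) (x v : V) (l : R) :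
  is_derive x v f l <-> is_derive (0 : R) 1 (fun h : R => f (h *: v + x)) l.
Proof.
rewrite -!is_derive_cvgP; set g1 := fun h => _; set g2 := fun h => _.
suff -> : g1 = g2 by [].
by rewrite funeqE /g1 /g2 => h /=; rewrite addr0 scale0r add0r [_%:A]mulr1.
Qed.

Lemma is_derive1_continuous (f : R -> R) (x l : R) :
  is_derive x 1 f l -> {for x, continuous f}.
Proof. by move=> [df _]; exact/differentiable_continuous/derivable1_diffP. Qed.

(** [n] times differentiable; smoothness is [forall n, Cn n f]. *)
Fixpoint Cn (n : nat) (f : R -> R) : Prop :=
  match n with
  | 0 => True
  | n'.+1 => exists2 g : R -> R, (forall x : R, is_derive x 1 f (g x)) & Cn n' g
  end.

Lemma Cn_ext n f g : f =1 g -> Cn n f -> Cn n g.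
Proof. by move=> /funext ->. Qed.

Lemma CnS n f : Cn n.+1 f -> Cn n f.
Proof. by elim: n f => [//|n IH] f [g dg cg]; exists g => //; exact: IH. Qed.

Lemma CnD n f g : Cn n f -> Cn n g -> Cn n (fun x => f x + g x).
Proof.
elim: n f g => [//|n IH] f g [f' df cf] [g' dg cg].
exists (fun x => f' x + g' x); last exact: IH.
by move=> x; have := df x; have := dg x => ? ?; exact: is_deriveD.
Qed.

Lemma CnM n f g : Cn n f -> Cn n g -> Cn n (fun x => f x * g x).
Proof.
elim: n f g => [//|n IH] f g cnf cng.
case: (cnf) => f' df cf; case: (cng) => g' dg cg.
exists (fun x => f x * g' x + g x * f' x).
  by move=> x; have := df x; have := dg x => ? ?; exact: is_deriveM.
by apply: CnD; apply: IH => //; exact: CnS.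
Qed.

Lemma Cn_cst n c : Cn n (cst c).
Proof.
by elim: n c => [//|n IH] c; exists (cst 0) => // x; exact: is_derive_cst.
Qed.

Lemma Cn_affine n f c e : Cn n f -> Cn n (fun x => f (c * x + e)).
Proof.
elim: n f => [//|n IH] f [f' df cf].
exists (fun x => c * f' (c * x + e)); last first.
  by apply: CnM; [exact: Cn_cst|exact: IH].
move=> x; rewrite mulrC.
have d1 : is_derive x 1 (fun x : R => c * x + e) c.
  have := @is_deriveD _ _ _ (c \*: id) (cst e) x 1 _ _
    (is_deriveZ c (is_derive_id x 1)) (is_derive_cst e x 1).
  by rewrite addr0 [_ *: _]mulr1.
exact: (@is_derive1_comp R f (fun x => c * x + e) x _ _ (df _) d1).
Qed.

Definition derivatives (f : R -> R) (u : nat -> R -> R) :=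
  u 0%N = f /\ forall k (x : R), is_derive x 1 (u k) (u k.+1 x).

Lemma Cn_derivatives f : (forall n, Cn n f) -> exists u, derivatives f u.
Proof.
move=> cf; exists (fun k => iter k (@derive1 R R) f); split => // k.
have : forall n, Cn n (iter k (@derive1 R R) f).
  elim: k => [//|k IH] n; have /= [g dg cg] := IH n.+1.
  suff -> : @derive1 R R (iter k (@derive1 R R) f) = g by [].
  by apply/funext => x; rewrite derive1E; have [_ ->] := dg x.
move=> /(_ 1%N)/= [g dg _] x.
by rewrite derive1E; have [? ->] := dg x.
Qed.

End derive_tools.

Section flat.
Context {R : realType}.
Variable lam : R.
Hypothesis lam0 : 0 < lam.

(** The classical [exp (- lam / x)] multiplied by [x^-k]. With these factors the
    family is closed under differentiation up to linear combinations, and smoothness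
    follows by induction on the order. *)
Definition flat (k : nat) (x : R) : R :=
  if 0 < x then x^-1 ^+ k * expR (- (lam / x)) else 0.

(** A quadratic bound makes the difference quotient at the origin tend to 0. It comes
    from [(s / n)^n <= exp s] with [n = k + 2]: the factor [x^-k] uses up [k] of the
    [k + 2] powers gained. *)
Lemma flat_le2 k : exists C, forall h, `|flat k h| <= C * h ^+ 2.
Proof.
exists ((k.+2%:R / lam) ^+ k.+2) => h; rewrite /flat.
have [h0|_] := ltP 0 h; last first.
  by rewrite normr0 mulr_ge0 ?sqr_ge0// exprn_ge0// divr_ge0// ltW.
rewrite ger0_norm; last by rewrite mulr_ge0// ?expR_ge0// exprn_ge0// invr_ge0 ltW.
have hn0 : h != 0 by rewrite gt_eqF.
have ln0 : lam != 0 by rewrite gt_eqF.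
have k0 : (0 : R) < k.+2%:R by [].
have e1 : (lam / (k.+2%:R * h)) ^+ k.+2 <= expR (lam / h).
  have -> : lam / h = k.+2%:R * (lam / (k.+2%:R * h)).
    by field; rewrite hn0 gt_eqF.
  rewrite expRM_natl lerXn2r ?nnegrE ?expR_ge0//.
    by rewrite divr_ge0 ?mulr_ge0// ltW.
  by apply: le_trans (expR_ge1Dx _); rewrite lerDr.
have e2 : expR (- (lam / h)) <= (k.+2%:R * h / lam) ^+ k.+2.
  rewrite expRN -[leRHS]invrK lef_pV2 ?posrE ?expR_gt0 ?invr_gt0 ?exprn_gt0 ?divr_gt0 ?mulr_gt0//.
  by rewrite -exprVn invf_div.
apply: (@le_trans _ _ (h^-1 ^+ k * (k.+2%:R * h / lam) ^+ k.+2)).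
  by rewrite ler_wpM2l// exprn_ge0// invr_ge0 ltW.
rewrite le_eqVlt; apply/orP; left; apply/eqP.
rewrite (_ : k.+2%:R * h / lam = (k.+2%:R / lam) * h); last by field.
rewrite exprMn mulrCA; congr (_ * _).
by rewrite -addn2 exprD mulrA -exprMn mulVf// expr1n mul1r.
Qed.

Lemma is_derive_flat k (x : R) :
  is_derive x 1 (flat k) (- k%:R * flat k.+1 x + lam * flat k.+2 x).
Proof.
have [x0|x0|->] := ltrgt0P x.
- rewrite /flat x0.
  have xn0 : x != 0 by rewrite gt_eqF.
  apply: (@near_eq_is_derive R R R (fun y : R => y^-1 ^+ k * expR (- (lam * y^-1)))).
    near=> y; rewrite ifT//; near: y; exact: lt_nbhsr.
  have d1 : is_derive x 1 (fun y : R => y^-1) (- x ^- 2).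
    by have := @is_deriveV R id x 1 1 xn0 (is_derive_id _ _); rewrite [_ *: _]mulr1.
  have d2 := is_deriveX k d1.
  have d3 := is_deriveN (is_deriveZ lam d1).
  have d4 := @is_derive1_comp R expR _ x _ _ (is_derive_expR _) d3.
  rewrite (_ : (fun y : R => _) =
    (@GRing.inv R) ^+ k * (expR \o - (lam \*: @GRing.inv R))); last first.
    by apply/funext => y; rewrite fctE exprfctE.
  apply: is_derive_eq (is_deriveM d2 d4) _.
  rewrite /= /GRing.scale/= -exprVn.
  rewrite exprfctE (_ : (- (lam \*: @GRing.inv R)) x = - (lam / x))//.
  set e := expR _.
  set y := x^-1; case: k {d2} => [|k] /=; first by rewrite !expr0; ring.
  by rewrite !exprS; ring.
- apply: (@near_eq_is_derive R R R (cst 0)).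
    near=> y; rewrite /flat ltNge ltW//; near: y; exact: lt_nbhsl.
  by rewrite /flat !ltNge !ltW// !mulr0 addr0; exact: is_derive_cst.
rewrite /flat ltxx !mulr0 addr0 -/(flat k).
apply/is_derive_cvgP; have [C HC] := flat_le2 k.
have C0 : 0 <= C by have := le_trans (normr_ge0 _) (HC 1); rewrite expr1n mulr1.
apply/cvgr0Pnorm_le => e e0; near=> h.
rewrite [X in flat k X - _](_ : _ = h); last by rewrite addr0 [_ *: _]mulr1.
rewrite {2}/flat ltxx subr0 normrM normfV.
have h0 : h != 0 by near: h; exact: nbhs_dnbhs_neq.
rewrite ler_pdivrMl ?normr_gt0//; apply: le_trans (HC h) _.
rewrite -[h ^+ 2]real_normK ?num_real// expr2 mulrCA ler_wpM2l//.
have : `|h| <= e / (C + 1).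
  near: h; apply: dnbhs0_le; rewrite divr_gt0//; lra.
move=> he; apply: (@le_trans _ _ (C * (e / (C + 1)))); first by rewrite ler_wpM2l.
by rewrite mulrA ler_pdivrMr; [nra|lra].
Unshelve. all: by end_near. Qed.

Lemma Cn_flat n k : Cn n (flat k).
Proof.
elim: n k => [//|n IH] k.
exists (fun x => - k%:R * flat k.+1 x + lam * flat k.+2 x).
  exact: is_derive_flat.
by apply: CnD; apply: CnM; rewrite //; exact: Cn_cst.
Qed.

Lemma flat_ge0 x : 0 <= flat 0 x.
Proof. by rewrite /flat; case: ifP => // _; rewrite expr0 mul1r expR_ge0. Qed.

Lemma flat_le1 x : flat 0 x <= 1.
Proof.
rewrite /flat; case: ifP => // x0; rewrite expr0 mul1r expR_le1 oppr_le0.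
by rewrite divr_ge0// ltW.
Qed.

Lemma flat_eq0 k x : x <= 0 -> flat k x = 0.
Proof. by move=> x0; rewrite /flat ltNge x0. Qed.

End flat.

Section antiderivative.
Context {R : realType}.

Lemma ex_antiderivative (f : R -> R) (l : R) : continuous f ->
  (forall x, x <= l -> f x = 0) ->
  exists F : R -> R, (forall x : R, is_derive x 1 F (f x)) /\
    forall x, x <= l -> F x = 0.
Proof.
move=> cf f0.
pose F x := (\int[lebesgue_measure]_(t in `[l - 1, x]) f t)%R.
have F0 x : x <= l -> F x = 0.
  move=> xl; rewrite /F; under eq_Rintegral.
    move=> t; rewrite inE/= in_itv/= => /andP[_ tx].
    rewrite f0; last exact: le_trans xl. over.
  by rewrite Rintegral_cst ?mul0r.
exists F; split => // x; have [xl|lx] := ltP x l.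
  rewrite f0 ?ltW//; apply: (@near_eq_is_derive R R R (cst 0)).
  near=> y; rewrite F0// ltW//; near: y; exact: lt_nbhsl.
have [dF Ff] := @continuous_FTC1_closed R f (l - 1) x (x + 1) ltac:(lra)
  (continuous_compact_integrable (@segment_compact _ _ _) (continuous_subspaceT cf)) ltac:(lra) (cf x).
exact: (DeriveDef dF (etrans (esym (derive1E _ _)) Ff)).
Unshelve. all: by end_near. Qed.

Lemma antiderivative_monotone (f F : R -> R) :
  (forall x : R, is_derive x 1 F (f x)) -> (forall x, 0 <= f x <= 1) ->
  forall x y, x <= y -> 0 <= F y - F x <= y - x.
Proof.
move=> dF f01 x y xy.
have [|c _ ->] := @MVT_segment R F f x y xy (fun z _ => dF z).
  apply: continuous_subspaceT => z; exact: is_derive1_continuous (dF z).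
by have /andP[? ?] := f01 c; rewrite mulr_ge0 ?ler_piMl ?subr_ge0.
Qed.

End antiderivative.

Section bump_fun.
Context {R : realType}.
Variable h : R.
Hypothesis h0 : 0 < h.

(** Smooth approximations of the indicator function of [0, h] from inside: the
    margin [h / (m + 3)] keeps the support away from the end points, and margin and
    exponent [1 / (m + 1)] both tend to 0, so that the limit is 1 inside. *)
Definition bump_fun (m : nat) (x : R) : R :=
  flat m.+1%:R^-1 0 (x - h / m.+3%:R) * flat m.+1%:R^-1 0 (h - h / m.+3%:R - x).

Lemma bump_ge0 m x : 0 <= bump_fun m x.
Proof. by rewrite mulr_ge0// flat_ge0. Qed.

Lemma bump_le1 m x : bump_fun m x <= 1.
Proof. by rewrite mulr_ile1// ?flat_ge0// flat_le1// invr_gt0. Qed.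

Lemma bump_eq0 m x : x <= h / m.+3%:R \/ h - h / m.+3%:R <= x -> bump_fun m x = 0.
Proof.
by rewrite /bump_fun; case=> hx; [rewrite flat_eq0 ?mul0r|rewrite [X in _ * X]flat_eq0 ?mulr0];
  rewrite // subr_le0.
Qed.

Lemma bump_cvg x : 0 < x < h -> bump_fun ^~ x @ \oo --> (1 : R).
Proof.
move=> /andP[x0 xh].
have cv0 : (fun m => m.+3%:R^-1 : R) @ \oo --> (0 : R).
  have := @cvg_harmonic R; rewrite /harmonic -(cvg_shiftn 2).
  by under eq_fun do rewrite addn2.
have cvf (e : R) : 0 < e -> flat m.+1%:R^-1 0 (e - h / m.+3%:R) @[m --> \oo] --> (1 : R).
  move=> e0; have cve : e - h / m.+3%:R @[m --> \oo] --> e.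
    rewrite -[X in _ --> X]subr0; apply: cvgB; first exact: cvg_cst.
    by rewrite -(mulr0 h); apply: cvgM => //; exact: cvg_cst.
  have : expR (- (m.+1%:R^-1 / (e - h / m.+3%:R))) @[m --> \oo] --> (1 : R).
    rewrite -[X in _ --> X]expR0; apply: continuous_cvg; first exact: continuous_expR.
    rewrite -[X in _ --> X]oppr0; apply: cvgN; rewrite -[X in _ --> X](mul0r e^-1).
    apply: cvgM; first exact: cvg_harmonic.
    by apply: cvgV => //; rewrite gt_eqF.
  apply: cvg_trans; apply: near_eq_cvg; near=> m.
  rewrite /flat ifT ?expr0 ?mul1r//; near: m.
  by move/cvgr_gt : cve; apply.
rewrite -(mulr1 1); apply: cvgM; first exact: cvf.
under eq_fun do rewrite addrAC; apply: cvf; lra.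
Unshelve. all: by end_near. Qed.

Lemma Cn_bump n m : Cn n (bump_fun m).
Proof.
have m0 : (0 : R) < m.+1%:R^-1 by rewrite invr_gt0.
apply: CnM.
  apply: (@Cn_ext _ _ (fun x => flat m.+1%:R^-1 0 (1 * x + - (h / m.+3%:R)))).
    by move=> x; rewrite mul1r.
  by apply: Cn_affine; exact: Cn_flat.
apply: (@Cn_ext _ _ (fun x => flat m.+1%:R^-1 0 (-1 * x + (h - h / m.+3%:R)))).
  by move=> x; rewrite mulN1r addrC.
by apply: Cn_affine; exact: Cn_flat.
Qed.

(** The antiderivative [u 0] of the bump climbs from 0 to a constant [c]. It is the
    smooth counterpart of the antiderivative of the indicator function of [0, h], and
    [u 1, u 2, ...] are its derivatives. *)
Lemma ex_step m : exists (u : nat -> R -> R) (c : R),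
  [/\ forall k (x : R), is_derive x 1 (u k) (u k.+1 x),
      u 1%N = bump_fun m, 0 <= c <= h,
      forall x, 0 <= u 0%N x <= c &
      (forall x, x <= h / m.+3%:R -> u 0%N x = 0) /\
      (forall x, h - h / m.+3%:R <= x -> u 0%N x = c)].
Proof.
have cb : continuous (bump_fun m).
  have [g dg _] := Cn_bump 1 m; move=> x; exact: is_derive1_continuous (dg x).
have [F [dF F0]] := ex_antiderivative cb (fun x xl => bump_eq0 (or_introl xl)).
have [v [v0 dv]] := Cn_derivatives (fun n => Cn_bump n m).
have F1 := antiderivative_monotone dF (fun x => introT andP (conj (bump_ge0 m x) (bump_le1 m x))).
have h3 : 0 < h / m.+3%:R by rewrite divr_gt0.
have h3' : h / m.+3%:R <= h by rewrite ler_pdivrMr// ler_peMr ?ltW// ltr1n.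
set r := h - h / m.+3%:R.
have Fr x : r <= x -> F x = F r.
  move=> rx; apply/eqP; rewrite -subr_eq0.
  have [|c cx ->] := @MVT_segment R F (bump_fun m) r x rx (fun z _ => dF z).
    apply: continuous_subspaceT => z; exact: is_derive1_continuous (dF z).
  rewrite bump_eq0 ?mul0r//; right; move: cx; rewrite in_itv/= => /andP[]//.
exists (fun k => if k is k'.+1 then v k' else F), (F r); split => //.
- by case=> [|k] x; [rewrite v0; exact: dF|exact: dv].
- have r0 : 0 <= r by rewrite subr_ge0.
  have := F1 0 r r0; rewrite (F0 0 (ltW h3)) !subr0 => /andP[-> Frr]/=.
  by apply: le_trans Frr _; rewrite gerBl ltW.
- move=> x; apply/andP; split.
    have [xl|lx] := leP x (h / m.+3%:R); first by rewrite F0.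
    by have := F1 _ _ (ltW lx); rewrite (F0 (_ / _))// subr0 => /andP[].
  have [rx|xr] := leP r x; first by rewrite Fr.
  by have := F1 _ _ (ltW xr); rewrite subr_ge0 => /andP[].
Qed.

End bump_fun.

(** * Test functions given with all their derivatives *)

Section continuous_bigops.
Context {R : realType} {T : topologicalType} {I : finType}.
Variables (P : pred I) (f : I -> T -> R).
Hypothesis cf : forall i, continuous (f i).

Lemma continuous_sum_fin : continuous (fun x => \sum_(i | P i) f i x).
Proof.
rewrite -fct_sumE; elim/big_ind : _ => [|g h cg ch x|//]; first exact: cst_continuous.
exact: (continuousD (cg x) (ch x)).
Qed.

Lemma continuous_prod_fin : continuous (fun x => \prod_(i | P i) f i x).
Proof.
rewrite -fct_prodE; elim/big_ind : _ => [|g h cg ch x|//]; first exact: cst_continuous.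
exact: (continuousM (cg x) (ch x)).
Qed.

End continuous_bigops.

Section derivative_families.
Context {R : realType} {d : nat}.
Implicit Types (i j : 'I_d) (al : 'I_d -> nat) (Z : ('I_d -> nat) -> 'rV[R]_d -> R).

Definition incr i al : 'I_d -> nat := fun j => ((j == i) + al j)%N.

(** A smooth function [Z 0] packaged with all its partial derivatives, [Z al] being the
    one of multi-index [al]: smoothness is then preserved by differentiation at no
    cost. *)
Definition dfamily Z : Prop :=
  (forall al, continuous (Z al)) /\
  (forall al i x, is_derive x (delta_mx ord0 i : 'rV[R]_d) (Z al) (Z (incr i al) x)).

Lemma dfamily_C_upto Z al k : dfamily Z -> C_upto k setT (Z al).
Proof.
move=> [cZ dZ]; elim: k al => [|k IH] al /=.
  by split => //; exact: continuous_subspaceT.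
split; first exact: continuous_subspaceT.
by move=> i; exists (Z (incr i al)).
Qed.

Lemma dfamily_partials Z al s : dfamily Z ->
  foldr (fun i g => 'D_(delta_mx ord0 i) g) (Z al) s = Z (foldr incr al s).
Proof.
move=> [cZ dZ]; elim: s => [//|i s /= ->].
by apply/funext => x; have [_ ->] := dZ (foldr incr al s) i x.
Qed.

Lemma dfamily_shift Z i : dfamily Z -> dfamily (fun al => Z (incr i al)).
Proof.
move=> [cZ dZ]; split=> [al|al j x]; first exact: cZ.
rewrite (_ : incr i (incr j al) = incr j (incr i al)); first exact: dZ.
by apply/funext => k; rewrite /incr addnCA.
Qed.

Lemma dfamily_test Z al (a b a' b' : 'rV[R]_d) : dfamily Z ->
  (forall i, a ord0 i < a' ord0 i /\ b' ord0 i < b ord0 i) ->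
  (forall x, ~ box a' b' x -> Z al x = 0) ->
  test_function (box a b)° (Z al).
Proof.
move=> dZ ab Z0.
have cK : closed (box a' b') by apply: compact_closed; [exact: norm_hausdorff|exact: compact_box].
have sK : closure [set x | Z al x != 0] `<=` box a' b'.
  rewrite [X in _ `<=` X](closure_id _).1//; apply: closure_subset => x /= Zx.
  by apply: contrapT => /Z0 Z0x; rewrite Z0x eqxx in Zx.
split.
- by move=> k; exact: dfamily_C_upto.
- by apply: (subclosed_compact _ (@compact_box _ _ a' b') sK); exact: closed_closure.
- apply: subset_trans sK _ => x; rewrite interior_box => h j.
  have /andP[h1 h2] := h j; have [h3 h4] := ab j.
  by rewrite /= in_itv/= (lt_le_trans h3 h1) (le_lt_trans h2 h4).
Qed.

(** The complement of the box is open, so [Z al] vanishes near each of its points. *)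
Lemma dfamily_support Z al (a' b' : 'rV[R]_d) i : dfamily Z ->
  (forall x, ~ box a' b' x -> Z al x = 0) ->
  (forall x, ~ box a' b' x -> Z (incr i al) x = 0).
Proof.
move=> [cZ dZ] Z0 x xK.
have oK : open (~` box a' b').
  by apply: closed_openC; apply: compact_closed; [exact: norm_hausdorff|exact: compact_box].
have [_ <-] := dZ al i x.
rewrite (near_eq_derive (g := cst 0)) ?derive_cst//.
have := open_nbhs_nbhs (conj oK xK); apply: filterS => y; exact: Z0.
Qed.

End derivative_families.

Section tensor.
Context {R : realType} {d N : nat}.
Implicit Types (i j : 'I_d) (al : 'I_d -> nat).
Variable U : 'I_d -> 'I_N -> nat -> R -> R.
Variable c : {ffun 'I_d -> 'I_N} -> R.

(** Linear combinations of products of functions of one variable. [U j l 0, U j l 1, ...]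
    are meant to be successive derivatives, among which [al] selects. *)
Definition tensor al (x : 'rV[R]_d) : R :=
  \sum_k c k * \prod_j U j (k j) (al j) (x ord0 j).

Hypothesis dU : forall j k n (x : R), is_derive x 1 (U j k n) (U j k n.+1 x).

Lemma dfamily_tensor : dfamily tensor.
Proof.
have cU j k n : continuous (U j k n).
  by move=> x; exact: is_derive1_continuous (dU j k n x).
split=> [al|al i x].
  refine (@continuous_sum_fin R _ _ xpredT
    (fun k (x : 'rV[R]_d) => c k * \prod_j U j (k j) (al j) (x ord0 j)) _) => k x.
  have cc : continuous (fun _ : 'rV[R]_d => c k) by exact: cst_continuous.
  refine (@continuousM R _ (fun=> c k) _ x (cc x) _).
  refine (@continuous_prod_fin R _ _ xpredT
    (fun j (x : 'rV[R]_d) => U j (k j) (al j) (x ord0 j)) _ x) => j y.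
  apply: (@continuous_comp _ _ _ (fun x : 'rV[R]_d => x ord0 j)); last exact: cU.
  exact: coord_continuous.
apply/is_derive_line.
pose G k (h : R) : R := (c k * \prod_(j < d | j != i) U j (k j) (al j) (x ord0 j)) *
  U i (k i) (al i) (h + x ord0 i).
rewrite (_ : (fun h : R => _) = (fun h => \sum_k G k h)); last first.
  apply/funext => h; apply: eq_bigr => k _; rewrite /G -mulrA; congr (_ * _).
  rewrite (bigD1 i)//= mulrC; congr (_ * _); last by rewrite !mxE !eqxx mulr1.
  apply: eq_bigr => j ji; congr (U _ _ _ _); rewrite !mxE eqxx (negbTE ji).
  by rewrite mulr0 add0r.
pose dG k : R := (c k * \prod_(j < d | j != i) U j (k j) (al j) (x ord0 j)) *
  U i (k i) (al i).+1 (x ord0 i).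
rewrite (_ : tensor _ _ = \sum_k dG k); last first.
  apply: eq_bigr => k _; rewrite /dG -mulrA; congr (_ * _).
  rewrite (bigD1 i)//= mulrC; congr (_ * _); last by rewrite /incr eqxx.
  by apply: eq_bigr => j ji; rewrite /incr (negbTE ji).
have dGk k : is_derive (0:R) 1 (G k) (dG k).
  have h1 := dU i (k i) (al i) (x ord0 i).
  have h2 : is_derive (0 : R) 1 (fun h : R => U i (k i) (al i) (h + x ord0 i))
      (U i (k i) (al i).+1 (x ord0 i)).
    move/is_derive_line : h1; under eq_fun do rewrite [_ *: _]mulr1. by [].
  exact: (is_deriveZ (c k * \prod_(j < d | j != i) U j (k j) (al j) (x ord0 j)) h2).
rewrite -fct_sumE.
elim/big_ind2 : _ => // [|f f' g g' df dg].
- exact: is_derive_cst.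
- exact: is_deriveD.
Qed.

End tensor.

(** * Integration by parts on a box *)

Section box_functions.
Context {R : realType} {d : nat}.
Variables (a b : 'rV[R]_d).
Local Notation S := (box a b).
Local Notation leb := (@lebesgue_rV R d).
Local Open Scope ereal_scope.

Lemma lebesgue_box_lty : leb S < +oo.
Proof.
rewrite boxE lebesgue_rV_cyl//.
rewrite (eq_bigr (fun j => (fine (lebesgue_measure `[a ord0 j, b ord0 j]))%:E)).
  by rewrite prodEFin ltry.
by move=> j _; rewrite fineK// lebesgue_measure_itv/=; case: ifP.
Qed.

Lemma measurable_interior (A : set 'rV[R]_d) : measurable A°.
Proof. by apply: open_measurable_rV; exact: open_interior. Qed.

Lemma within_box_interior (f : 'rV[R]_d -> R) x :
  {within S, continuous f} -> S° x -> {for x, continuous f}.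
Proof.
move=> cf Sx; have : {within S°, continuous f}.
  by apply: continuous_subspaceW cf; exact: interior_subset.
rewrite continuous_open_subspace; last exact: open_interior.
by apply; rewrite inE.
Qed.

Lemma within_box_bounded (f : 'rV[R]_d -> R) : {within S, continuous f} ->
  exists2 C, (0 <= C)%R & forall x, S x -> (`|f x| <= C)%R.
Proof.
move=> cf; have [M [_ MA]] := compact_bounded (continuous_compact cf (@compact_box _ _ a b)).
exists (`|M| + 1)%R => [|x Sx]; first by rewrite addr_ge0.
by apply: (MA (`|M| + 1)%R); [rewrite (le_lt_trans (ler_norm _))// ltrDl|exists x].
Qed.

Lemma within_box_measurable (f : 'rV[R]_d -> R) : {within S, continuous f} ->
  measurable_fun S° f.
Proof.
move=> cf; apply: continuous_measurable_rV; first exact: open_interior.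
by move=> x; exact: within_box_interior.
Qed.

Lemma within_box_integrable (f : 'rV[R]_d -> R) : {within S, continuous f} ->
  leb.-integrable S° (EFin \o f).
Proof.
move=> cf; apply: measurable_bounded_integrable.
- exact: measurable_interior.
- apply: le_lt_trans lebesgue_box_lty; apply: le_measure; rewrite ?inE.
  + exact: measurable_interior.
  + exact: measurable_box.
  + exact: interior_subset.
- exact: within_box_measurable.
- have [C C0 fC] := within_box_bounded cf.
  exists C; split; first exact: num_real.
  move=> M CM x Sx; apply: le_trans (ltW CM); apply: fC; exact: interior_subset.
Qed.

Lemma within_boxM (f g : 'rV[R]_d -> R) : {within S, continuous f} ->
  {within S, continuous g} -> {within S, continuous (fun x => f x * g x)%R}.
Proof. by move=> cf cg x; exact: (continuousM (cf x) (cg x)). Qed.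

End box_functions.

Section ibp.
Context {R : realType} {d : nat}.
Variables (a b a' b' : 'rV[R]_d).
Hypothesis ab : forall i, (a ord0 i < a' ord0 i) /\ (b' ord0 i < b ord0 i).
Local Notation S := (box a b).
Local Notation leb := (@lebesgue_rV R d).

Lemma is_derive_insert (f : 'rV[R]_d -> R) i (w : 'rV[R]_#|~: [set i]|) (t l : R) :
  is_derive (rV_insert w t) (delta_mx ord0 i : 'rV[R]_d) f l ->
  is_derive t 1 (fun t => f (rV_insert w t)) l.
Proof.
move=> /is_derive_line fl; apply/is_derive_line; move: fl.
congr (is_derive _ _ _ _); apply/funext => h; congr (f _).
by rewrite /rV_insert scalerDl [h *: 1]mulr1 addrCA.
Qed.

Lemma continuous_insert (i : 'I_d) (w : 'rV[R]_#|~: [set i]|) : continuous (fun t : R => rV_insert w t).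
Proof.
move=> t; apply: cvgD; first exact: cvg_cst.
by apply: cvgZl; exact: cvg_id.
Qed.

(** On each line of direction [i], integrate the derivative of [f z] over a
    segment [A, B] whose end points lie strictly between the support of [z] and the
    boundary of the box: the boundary terms vanish, and [f] is differentiable on the
    whole segment. *)
Lemma ibp_step (f g z z' : 'rV[R]_d -> R) i :
  {within S, continuous f} -> {within S, continuous g} ->
  (forall x, S° x -> is_derive x (delta_mx ord0 i : 'rV[R]_d) f (g x)) ->
  continuous z -> continuous z' ->
  (forall x, is_derive x (delta_mx ord0 i : 'rV[R]_d) z (z' x)) ->
  (forall x, ~ box a' b' x -> z x = 0) ->
  (forall x, ~ box a' b' x -> z' x = 0) ->
  (\int[leb]_(x in S°) (f x * z' x)%:E = - \int[leb]_(x in S°) (g x * z x)%:E)%E.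
Proof.
move=> cf cg df cz cz' dz z0 z'0.
have wz : {within S, continuous z} by exact: continuous_subspaceT.
have wz' : {within S, continuous z'} by exact: continuous_subspaceT.
have i1 := within_box_integrable (within_boxM cf wz').
have i2 := within_box_integrable (within_boxM cg wz).
have mS : measurable S° by exact: measurable_interior.
have i3 := integrableD mS i1 i2.
pose F x := f x * z' x + g x * z x.
have F0 x : ~ box a' b' x -> F x = 0.
  by move=> xK; rewrite /F z0// z'0// !mulr0 addr0.
suff : (\int[leb]_(x in S°) (F x)%:E = 0)%E.
  rewrite /F; under eq_integral do rewrite EFinD.
  have f1 := integrable_fin_num mS i1; have f2 := integrable_fin_num mS i2.
  rewrite integralD//= => h; move: h f1 f2.
  set X := integral _ _ _; set Y := integral _ _ _.
  move: X Y => [X| |] [Y| |]// + _ _; rewrite -EFinD -EFinN => -[/eqP].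
  by rewrite addr_eq0 => /eqP ->.
rewrite integral_mkcond (insert_fubini i); last first.
  by move: i3; rewrite (integrable_mkcond _ mS).
apply: integral0_eq => w _.
pose A := (a ord0 i + a' ord0 i) / 2; pose B := (b ord0 i + b' ord0 i) / 2.
have [abi1 abi2] := ab i.
(* [B <= A] forces the box that carries [z] to be empty in direction [i] *)
have [BA|AB] := leP B A.
  apply: integral0_eq => t _; rewrite patchE; case: ifP => // _; rewrite F0//.
  by move=> /(_ i); move: BA; rewrite /A /B; lra.
have [wS|wS] := pselect (cyl (fun k => `]a ord0 (enum_val k), b ord0 (enum_val k)[%classic) w); last first.
  apply: integral0_eq => t _; rewrite patchE; case: ifP => //.
  by rewrite inE interior_box cyl_insert => -[].
have insS t : t \in `[A, B] -> S° (rV_insert w t).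
  rewrite in_itv/= => tAB; rewrite interior_box cyl_insert; split => //.
  by rewrite /= in_itv/=; move: tAB; rewrite /A /B; lra.
have insK t : t < a' ord0 i \/ b' ord0 i < t -> ~ box a' b' (rV_insert w t).
  by move=> tab /(_ i); rewrite rV_insert_in; case: tab; lra.
transitivity (\int[lebesgue_measure]_(t in `[A, B]) (F (rV_insert w t))%:E)%E.
  rewrite [RHS]integral_mkcond; apply: eq_integral => t _; rewrite !patchE.
  have [tAB|tAB] := boolP (t \in `[A, B]%classic).
    by rewrite ifT// inE; apply: insS; rewrite inE in tAB.
  case: ifP => // _; rewrite F0//; apply: insK; move: tAB.
  rewrite notin_setE/= in_itv/= => /negP; rewrite negb_and -!ltNge /A /B.
  by case/orP => ?; [left|right]; lra.
have dG t : t \in `[A, B] ->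
    is_derive t 1 (fun t => f (rV_insert w t) * z (rV_insert w t)) (F (rV_insert w t)).
  move=> /insS tS.
  have h1 := is_derive_insert (df _ tS); have h2 := is_derive_insert (dz (rV_insert w t)).
  apply: is_derive_eq (is_deriveM h1 h2) _.
  by rewrite /F /GRing.scale/= [X in _ + X]mulrC.
rewrite (@continuous_FTC2 R _ (fun t => f (rV_insert w t) * z (rV_insert w t)))//.
- rewrite (z0 (rV_insert w A)) ?(z0 (rV_insert w B)) ?mulr0 ?subee//.
    by apply: insK; rewrite /B; right; lra.
  by apply: insK; rewrite /A; left; lra.
- apply: continuous_in_subspaceT => t; rewrite inE => /insS tS.
  apply: (@continuous_comp _ _ _ (rV_insert w) F); first exact: continuous_insert.
  apply: continuousD; apply: continuousM => //.
  + exact: within_box_interior.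
  + exact: cz'.
  + exact: within_box_interior.
  + exact: cz.
- have cG t : t \in `[A, B] -> {for t, continuous (fun t => f (rV_insert w t) * z (rV_insert w t))}.
    by move=> /dG; exact: is_derive1_continuous.
  split=> [t tAB||].
  + by have [] := dG t (subset_itv_oo_cc tAB).
  + by apply: cvg_at_right_filter; apply: cG; rewrite bound_itvE ltW.
  + by apply: cvg_at_left_filter; apply: cG; rewrite bound_itvE ltW.
- move=> t tAB; rewrite derive1E; have [_ ->//] := dG t (subset_itv_oo_cc tAB).
Qed.

(** [C_upto] provides continuous extensions to the closed box of functions that, in the
    interior, are locally equal to the iterated derivatives. *)
Lemma partials_C_upto k (s : seq 'I_d) p : C_upto (k + size s) S p ->
  exists2 g, C_upto k S g & forall x, S° x ->
    foldr (fun i g => 'D_(delta_mx ord0 i) g) p s x = g x.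
Proof.
elim: s k => [|i s IH] k; first by rewrite addn0 => cp; exists p.
rewrite /= -addSnnS => /IH[g [_ cg] pg].
have [g' dg' cg'] := cg i; exists g' => // x Sx.
have [_ <-] := dg' x Sx; apply: near_eq_derive.
have := open_nbhs_nbhs (conj (@open_interior _ S) Sx).
by apply: filterS => y; exact: pg.
Qed.

Lemma C_upto_within k f : C_upto k S f -> {within S, continuous f}.
Proof. by case: k => [|k] []. Qed.

Lemma C_uptoS k f : C_upto k.+1 S f -> C_upto k S f.
Proof.
elim: k f => [|k IH] f [cf df]; first by split.
by split => // i; have [g dg cg] := df i; exists g => //; exact: IH.
Qed.

(** Induction on the list of directions: the induction hypothesis for the family
    [Z (incr i _)] moves the derivatives along [s], and [ibp_step] moves the one along
    [i]. The absolute values absorb the signs. *)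
Lemma ibp (p : 'rV[R]_d -> R) (s : seq 'I_d) (Z : ('I_d -> nat) -> 'rV[R]_d -> R) :
  C_upto (size s) S p -> dfamily Z ->
  (forall x, ~ box a' b' x -> Z (fun=> 0%N) x = 0) ->
  (`|\int[leb]_(x in S°) (p x * Z (foldr incr (fun=> 0%N) s) x)%:E| =
   `|\int[leb]_(x in S°) (foldr (fun i g => 'D_(delta_mx ord0 i) g) p s x * Z (fun=> 0%N) x)%:E|)%E.
Proof.
elim: s Z => [//|i s IH] Z cp dZ Z0.
have cps : C_upto (1 + size s) S p by rewrite add1n.
have [g cg pg] := partials_C_upto cps.
have [_ /(_ i)[g' dg' cg']] := cg.
have := IH (fun al => Z (incr i al)).
rewrite (_ : incr i (foldr _ _ _) = foldr incr (fun=> 0%N) (i :: s))// => ->; last 3 first.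
- exact: C_uptoS.
- exact: dfamily_shift.
- exact: dfamily_support.
have mS : measurable S° by exact: measurable_interior.
rewrite (eq_integral (fun x => (g x * Z (incr i (fun=> 0%N)) x)%:E)); last first.
  by move=> x; rewrite inE => Sx; rewrite pg.
rewrite [in RHS](eq_integral (fun x => (g' x * Z (fun=> 0%N) x)%:E)); last first.
  move=> x; rewrite inE => Sx /=; congr (_ * _)%:E.
  have [_ <-] := dg' x Sx; apply: near_eq_derive.
  have := open_nbhs_nbhs (conj (@open_interior _ S) Sx).
  by apply: filterS => y; exact: pg.
have [cZ ddZ] := dZ.
rewrite (@ibp_step g g' (Z (fun=> 0%N)) _ i) ?abseN//.
- exact: C_upto_within cg.
- exact: cg'.1.
- exact: dfamily_support.
Qed.

Lemma ibp_le (p : 'rV[R]_d -> R) (s : seq 'I_d) (Z : ('I_d -> nat) -> 'rV[R]_d -> R) C :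
  C_upto (size s) S p -> dfamily Z ->
  (forall x, ~ box a' b' x -> Z (fun=> 0%N) x = 0) ->
  (forall x, `|Z (fun=> 0%N) x| <= C) ->
  (`|\int[leb]_(x in S°) (p x * Z (foldr incr (fun=> 0%N) s) x)%:E| <=
   C%:E * \int[leb]_(x in S°) `|foldr (fun i g => 'D_(delta_mx ord0 i) g) p s x|%:E)%E.
Proof.
move=> cp dZ Z0 ZC; rewrite ibp//.
have [|g cg pg] := @partials_C_upto 0 s p; first by rewrite add0n.
rewrite (eq_integral (fun x => (g x * Z (fun=> 0%N) x)%:E)); last first.
  by move=> x; rewrite inE => Sx; rewrite pg.
rewrite [in leRHS](eq_integral (fun x => (`|g x|)%:E)); last first.
  by move=> x; rewrite inE => Sx; rewrite pg.
have mS : measurable S° by exact: measurable_interior.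
have mg := within_box_measurable (C_upto_within cg).
have mZ : measurable_fun S° (Z (fun=> 0%N)).
  by apply: within_box_measurable; apply: continuous_subspaceT; exact: dZ.1.
apply: le_trans.
  by apply: le_abse_integral => //; apply/measurable_EFinP; exact: measurable_funM.
have C0 : 0 <= C by exact: le_trans (ZC 0).
rewrite -ge0_integralZl//; last by apply/measurable_EFinP; exact: measurableT_comp.
apply: ge0_le_integral => //.
- by apply/measurable_EFinP; apply: measurableT_comp => //; exact: measurable_funM.
- by apply/measurable_EFinP; apply: measurable_funM => //; exact: measurableT_comp.
- by move=> x _; rewrite -EFinM lee_fin normrM mulrC ler_wpM2r.
Qed.

End ibp.

(** * Grid functions as derivatives of test functions *)

Section cvg_bigops.
Context {R : realType} {I : finType}.
Variables (f : I -> nat -> R) (l : I -> R).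
Hypothesis fl : forall i, f i @ \oo --> l i.

Lemma cvg_sum_fin : (fun n => \sum_i f i n) @ \oo --> \sum_i l i.
Proof.
rewrite -fct_sumE; elim/big_ind2 : _ => [|g lg h lh cg ch|i _]; last exact: fl.
  exact: cvg_cst.
exact: cvgD.
Qed.

Lemma cvg_prod_fin : (fun n => \prod_i f i n) @ \oo --> \prod_i l i.
Proof.
rewrite -fct_prodE; elim/big_ind2 : _ => [|g lg h lh cg ch|i _]; last exact: fl.
  exact: cvg_cst.
exact: cvgM.
Qed.

End cvg_bigops.

Section grid_sums.
Context {R : realType} {d N : nat}.
Implicit Types (k : {ffun 'I_d -> 'I_N}) (i j : 'I_d) (J : {set 'I_d}).

Definition upd k i (l : 'I_N) : {ffun 'I_d -> 'I_N} :=
  [ffun j => if j == i then l else k j].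

Definition zero_sum i (c : {ffun 'I_d -> 'I_N} -> R) :=
  forall k, \sum_l c (upd k i l) = 0.

(** Sum over [k] and over an additional free value [l] of the [i]-th index. Exchanging
    [l] with [k i] shows that the result is [N] times the sum in question, while the
    sum over [l] alone already vanishes. *)
Lemma sum_zero_sum i (c G : {ffun 'I_d -> 'I_N} -> R) : zero_sum i c ->
  (forall k l, G (upd k i l) = G k) -> \sum_k c k * G k = 0.
Proof.
move=> c0 G0; case: (posnP N) => [N0|Npos].
  rewrite big1// => k _; have := k i; rewrite N0 => -[] //.
have : \sum_k \sum_l c (upd k i l) * G (upd k i l) = 0.
  rewrite big1// => k _; under eq_bigr do rewrite G0.
  by rewrite -mulr_suml c0 mul0r.
rewrite pair_big/=.
pose tau (z : {ffun 'I_d -> 'I_N} * 'I_N) := (upd z.1 i z.2, z.1 i).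
have tauK : involutive tau.
  move=> [k l]; rewrite /tau/= ffunE eqxx; congr pair.
  by apply/ffunP => j; rewrite !ffunE; case: eqP => [->|].
rewrite (reindex_inj (inv_inj tauK))/=.
under eq_bigr => z _.
  have -> : upd (upd z.1 i z.2) i (z.1 i) = z.1.
    by apply/ffunP => j; rewrite !ffunE; case: eqP => [->|].
  over.
rewrite -(pair_big xpredT xpredT (fun k (l : 'I_N) => c k * G k))/=.
under eq_bigr do rewrite sumr_const card_ord.
rewrite sumrMnl => /eqP; rewrite mulrn_eq0 => /orP[/eqP N0|/eqP//].
by rewrite N0 in Npos.
Qed.

(** Subtracting [B i] from the factor of one direction [i] of zero sum changes each
    product by a term that does not depend on the [i]-th index, and these terms cancel
    by [sum_zero_sum]. It is the discrete form of centring an antiderivative. *)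
Lemma sum_prod_center J (c : {ffun 'I_d -> 'I_N} -> R) (A : 'I_d -> 'I_N -> R)
    (B : 'I_d -> R) : (forall i, i \in J -> zero_sum i c) ->
  \sum_k c k * \prod_j A j (k j) =
  \sum_k c k * \prod_j (A j (k j) - B j *+ (j \in J)).
Proof.
move=> c0.
suff H (s : seq 'I_d) : uniq s -> {subset s <= J} ->
    \sum_k c k * \prod_j A j (k j) =
    \sum_k c k * \prod_j (A j (k j) - B j *+ (j \in s)).
  rewrite (H (enum J)) ?enum_uniq//; last by move=> j; rewrite mem_enum.
  apply: eq_bigr => k _; congr (_ * _); apply: eq_bigr => j _.
  by rewrite mem_enum.
elim: s => [_ _|i s IH /= /andP[ins us] sJ].
  by apply: eq_bigr => k _; congr (_ * _); apply: eq_bigr => j _; rewrite subr0.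
rewrite IH//; last by move=> j js; apply: sJ; rewrite inE js orbT.
apply/eqP; rewrite -subr_eq0 -sumrB; apply/eqP.
pose G k := B i * \prod_(j < d | j != i) (A j (k j) - B j *+ (j \in s)).
rewrite -[RHS](@sum_zero_sum i c G).
- apply: eq_bigr => k _; rewrite -mulrBr; congr (_ * _).
  rewrite (bigD1 i)//= [X in _ - X](bigD1 i)//= (negbTE ins) subr0 inE eqxx/=.
  rewrite [X in _ - _ * X](eq_bigr (fun j => A j (k j) - B j *+ (j \in s))).
    by rewrite /G; ring.
  by move=> j ji; rewrite inE (negbTE ji).
- by apply: c0; apply: sJ; rewrite inE eqxx.
- move=> k l; congr (_ * _); apply: eq_bigr => j ji.
  by rewrite ffunE (negbTE ji).
Qed.

(** The factors outside [J] restrict the sum to the indices that agree with [k0] there;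
    those in [J], being at most half a step each, produce the [2^-|J|]. *)
Lemma sum_prod_le J (c : {ffun 'I_d -> 'I_N} -> R) (F : 'I_d -> 'I_N -> R)
    (h : 'I_d -> R) (k0 : {ffun 'I_d -> 'I_N}) (M : R) :
  (forall j l, j \in J -> `|F j l| <= h j / 2) ->
  (forall j l, j \notin J -> `|F j l| <= (l == k0 j)%:R) ->
  (\prod_(j in J) h j) * (\sum_(k : {ffun 'I_d -> 'I_N} |
    [forall (j | j \notin J), k j == k0 j]) `|c k|) <= M ->
  `|\sum_k c k * \prod_j F j (k j)| <= 2^-1 ^+ #|J| * M.
Proof.
move=> FJ FnJ cM.
apply: le_trans (ler_norm_sum _ _ _) _.
apply: (@le_trans _ _ (\sum_k `|c k| * ((\prod_(j in J) (h j / 2)) *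
    ([forall (j | j \notin J), k j == k0 j])%:R))).
  apply: ler_sum => k _; rewrite normrM ler_wpM2l// normr_prod.
  rewrite (bigID (mem J))/= ler_pM ?prodr_ge0//.
    by apply: ler_prod => j jJ; rewrite normr_ge0 FJ.
  have [_|] := boolP [forall (j | j \notin J), k j == k0 j].
    apply: prodr_ile1 => j jJ; rewrite normr_ge0 (le_trans (FnJ _ _ jJ))//.
    by case: eqP.
  rewrite negb_forall => /existsP[j]; rewrite negb_imply => /andP[jJ kj].
  rewrite (bigD1 j)//= (_ : F j (k j) = 0) ?normr0 ?mul0r//.
  by apply/eqP; rewrite -normr_le0 (le_trans (FnJ _ _ jJ))// (negbTE kj).
rewrite (eq_bigr (fun k : {ffun 'I_d -> 'I_N} => \prod_(j in J) (h j / 2) *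
  (`|c k| * ([forall (j | j \notin J), k j == k0 j])%:R))); last first.
  by move=> k _; rewrite mulrCA.
rewrite -mulr_sumr big_split/= prodr_const -mulrA mulrCA ler_wpM2l ?exprn_ge0 ?invr_ge0//.
apply: le_trans cM; rewrite [X in _ <= _ * X]big_mkcond/= le_eqVlt; apply/orP; left.
apply/eqP; congr (_ * _); apply: eq_bigr => k _.
by case: ifP => _; rewrite ?mulr1 ?mulr0.
Qed.

End grid_sums.

Section grid.
Context {R : realType} {d N : nat}.
Variables (a b : 'rV[R]_d).
Hypothesis N0 : (0 < N)%N.
Hypothesis hab : forall i, a ord0 i < b ord0 i.
Variable J : {set 'I_d}.
Variable c : {ffun 'I_d -> 'I_N} -> R.
Variable M : R.

Definition step j : R := (b ord0 j - a ord0 j) / N%:R.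
Definition knot j (l : nat) : R := a ord0 j + l%:R * step j.
Definition cell j (l : nat) : set R := `[knot j l, knot j l.+1[%classic.

Hypothesis c0 : forall i, i \in J -> zero_sum i c.
Hypothesis cM : forall k0 : {ffun 'I_d -> 'I_N}, (\prod_(j in J) step j) *
  (\sum_(k : {ffun 'I_d -> 'I_N} | [forall (j | j \notin J), k j == k0 j]) `|c k|) <= M.

Definition grid_fun (x : 'rV[R]_d) : R :=
  \sum_k c k * \prod_j \1_(cell j (k j)) (x ord0 j).

Lemma step_gt0 j : 0 < step j.
Proof. by rewrite divr_gt0 ?subr_gt0 ?ltr0n. Qed.

Lemma knot0 j : knot j 0 = a ord0 j.
Proof. by rewrite /knot mul0r addr0. Qed.

Lemma knotN j : knot j N = b ord0 j.
Proof. by rewrite /knot /step mulrC divfK ?pnatr_eq0 -?lt0n// subrKC. Qed.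

Lemma knotS j l : knot j l.+1 = knot j l + step j.
Proof. by rewrite /knot -[l.+1]addn1 natrD mulrDl mul1r addrA. Qed.

Lemma knot_le j l l' : (l <= l')%N -> knot j l <= knot j l'.
Proof. by move=> ll; rewrite lerD2l ler_pM2r ?step_gt0// ler_nat. Qed.

Lemma cell_inj j l l' x : knot j l <= x < knot j l.+1 ->
  knot j l' <= x < knot j l'.+1 -> l = l'.
Proof.
move=> /andP[h1 h2] /andP[h3 h4]; case: (ltngtP l l') => // ll.
  by have := le_trans (knot_le j ll) h3; rewrite leNgt h2.
by have := le_trans (knot_le j ll) h1; rewrite leNgt h4.
Qed.

Lemma cell_cover j x : a ord0 j <= x < b ord0 j ->
  exists l : 'I_N, knot j l <= x < knot j l.+1.
Proof.
move=> /andP[ax xb].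
have s0 := step_gt0 j.
have y0 : 0 <= (x - a ord0 j) / step j by rewrite divr_ge0 ?subr_ge0// ltW.
have /andP[h1 h2] := truncn_itv y0.
set l := Num.truncn _ in h1 h2.
have lN : (l < N)%N.
  rewrite -(ltr_nat R); apply: le_lt_trans h1 _.
  rewrite ltr_pdivrMr// /step mulrC divfK ?pnatr_eq0 -?lt0n//; lra.
exists (Ordinal lN) => /=; move: h1 h2; rewrite ler_pdivlMr// ltr_pdivrMr//.
by rewrite /knot => ? ?; apply/andP; split; lra.
Qed.

(** The function [Z m z] approximates [grid_fun] from inside the cells and is the
    derivative, once in each direction of [J], of the test function [Z m 0]. In the
    directions outside [J] the latter has a bump in each cell; in those of [J] the bump
    is replaced by its antiderivative, a step from 0 to a height that is the same for
    all cells. Bumps vanish near the faces of the box. So do steps before the first knot;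
    near the last one all are at full height, and there the zero sums of [c] make the
    total vanish: hence the support.
    For the sup norm, [sum_prod_center] lowers each step by half its height, so that
    its values lie between minus and plus half a step of the grid. *)
Lemma grid_approx : exists (Z : nat -> ('I_d -> nat) -> 'rV[R]_d -> R)
    (a' b' : nat -> 'rV[R]_d),
  [/\ forall m, dfamily (Z m),
    forall m i, (a ord0 i < a' m ord0 i) /\ (b' m ord0 i < b ord0 i),
    forall m (x : 'rV[R]_d), ~ box (a' m) (b' m) x -> Z m (fun=> 0%N) x = 0,
    forall m (x : 'rV[R]_d), `|Z m (fun=> 0%N) x| <= 2^-1 ^+ #|J| * M &
    let z := foldr incr (fun=> 0%N) (enum J) in
    (forall m (x : 'rV[R]_d), `|Z m z x| <= \sum_k `|c k|) /\
    (forall x : 'rV[R]_d, (forall j (l : nat), x ord0 j != knot j l) ->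
       (fun m => Z m z x) @ \oo --> grid_fun x)].
Proof.
have : forall mj : nat * 'I_d, exists um : (nat -> R -> R) * R,
  [/\ forall k (x : R), is_derive x 1 (um.1 k) (um.1 k.+1 x),
      um.1 1%N = bump_fun (step mj.2) mj.1, 0 <= um.2 <= step mj.2,
      forall x, 0 <= um.1 0%N x <= um.2 &
      (forall x, x <= step mj.2 / mj.1.+3%:R -> um.1 0%N x = 0) /\
      (forall x, step mj.2 - step mj.2 / mj.1.+3%:R <= x -> um.1 0%N x = um.2)].
  by move=> [m j]/=; have [u [e h]] := ex_step (step_gt0 j) m; exists (u, e).
move=> /choice[um Hum].
pose U m j (l : 'I_N) n x := (um (m, j)).1 n (x - knot j l).
have dU m j l n (x : R) : is_derive x 1 (U m j l n) (U m j l n.+1 x).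
  have [h _ _ _ _] := Hum (m, j).
  have h1 := h n (x - knot j l).
  rewrite -[U m j l n.+1 x]mulr1.
  apply: (@is_derive1_comp R ((um (m, j)).1 n) (fun x => x - knot j l)).
  have := @is_deriveB _ _ _ id (cst (knot j l)) x 1 _ _ (is_derive_id x 1) (is_derive_cst _ x 1).
  by rewrite subr0.
(* [Z m 0] uses the antiderivative (index 0) in the directions of [J] and the bump
   (index 1) in the others *)
pose Z m al := tensor (U m) c (fun j => al j + (j \notin J))%N.
pose a' m : 'rV[R]_d := \row_j (a ord0 j + step j / m.+3%:R).
pose b' m : 'rV[R]_d := \row_j (b ord0 j - step j / m.+3%:R).
have sm m j : 0 < step j / m.+3%:R by rewrite divr_gt0 ?step_gt0.
have U0 m j (l : 'I_N) (n : nat) (x : R) : (n <= 1)%N -> x <= knot j l + step j / m.+3%:R -> U m j l n x = 0.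
  have [_ h1 _ _ [h0 _]] := Hum (m, j).
  rewrite /= in h1 h0; case: n => [|[|//]] _ xl; rewrite /U ?h1.
    by rewrite h0// lerBlDl.
  by rewrite bump_eq0//; left; rewrite lerBlDl.
have U1 m j (l : 'I_N) (x : R) : knot j l.+1 - step j / m.+3%:R <= x -> U m j l 1 x = 0.
  have [_ h1 _ _ _] := Hum (m, j).
  by rewrite /= in h1; rewrite knotS => xl; rewrite /U h1 bump_eq0//; right; rewrite lerBrDl addrA.
have U2 m j (l : 'I_N) (x : R) : knot j l.+1 - step j / m.+3%:R <= x -> U m j l 0 x = (um (m, j)).2.
  have [_ _ _ _ [_ h0]] := Hum (m, j).
  by rewrite /= in h0; rewrite knotS => xl; rewrite /U h0// lerBrDl addrA.
have U1n m j (l : 'I_N) (x : R) : `|U m j l 1 x| <= 1.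
  have [_ h1 _ _ _] := Hum (m, j).
  by rewrite /U h1 ger0_norm ?bump_ge0 ?bump_le1.
(* one derivative in each direction of [J] leaves bumps everywhere *)
have z1 : (fun j => (foldr incr (fun=> 0%N) (enum J) j + (j \notin J))%N) = (fun=> 1%N).
  apply/funext => j; rewrite -mem_enum; have := enum_uniq J.
  elim: (enum J) => [//|i s IH] /= /andP[ins us]; rewrite /incr inE.
  have := IH us; case: eqVneq => [->|_]//=; rewrite ?add0n ?addn0//.
  by rewrite ins addn1 => -[->].
exists Z, a', b'; split.
- move=> m; have [cT dT] := dfamily_tensor c (dU m); split => [al|al i x]; first exact: cT.
  rewrite (_ : Z m (incr i al) = tensor (U m) c (incr i (fun j => (al j + (j \notin J))%N))).
    exact: dT.
  by rewrite /Z; congr tensor; apply/funext => j; rewrite /incr addnA.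
- by move=> m i; rewrite !mxE ltrDl gtrBl sm.
- move=> m x /existsNP[j xj]; rewrite /Z /tensor.
  have {xj} : x ord0 j < a ord0 j + step j / m.+3%:R \/ b ord0 j - step j / m.+3%:R < x ord0 j.
    move: xj; rewrite !mxE => /negP; rewrite negb_and -!ltNge => /orP[] ?; [by left|by right].
  move=> [xj|xj].
    rewrite big1// => k _; rewrite (bigD1 j)//= U0 ?mul0r ?mulr0//; first by case: (_ \notin _).
    by apply: le_trans (ltW xj) _; rewrite lerD2r -knot0; exact: knot_le.
  have kb l : knot j (l : 'I_N).+1 - step j / m.+3%:R <= x ord0 j.
    by apply: le_trans (ltW xj); rewrite lerB// -knotN; apply: knot_le.
  have [jJ|jJ] := boolP (j \in J); last first.
    by rewrite big1// => k _; rewrite (bigD1 j)//= jJ U1 ?mul0r ?mulr0.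
  apply: (@sum_zero_sum R d N j) => [|k l]; first exact: c0.
  rewrite (bigD1 j)//= [RHS](bigD1 j)//= jJ !U2//; congr (_ * _).
  by apply: eq_bigr => i ij; rewrite ffunE (negbTE ij).
- move=> m x; rewrite /Z /tensor.
  rewrite (sum_prod_center (fun j l => U m j l (0 + (j \notin J))%N (x ord0 j))
    (fun j => (um (m, j)).2 / 2) c0).
  (* in each direction, at most one cell has a bump that does not vanish at [x] *)
  have [k0 Hk0] : exists k0 : {ffun 'I_d -> 'I_N}, forall j l, U m j l 1 (x ord0 j) != 0 -> l = k0 j.
    have /choice[k0 Hk0] : forall j, exists l0 : 'I_N, forall l, U m j l 1 (x ord0 j) != 0 -> l = l0.
      move=> j; have [[l Hl]|Hn] := pselect (exists l : 'I_N, U m j l 1 (x ord0 j) != 0); last first.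
        by exists (Ordinal N0) => l Hl; exfalso; apply: Hn; exists l.
      exists l => l' Hl'; apply/val_inj/(@cell_inj j _ _ (x ord0 j)); apply/andP; split.
      + rewrite leNgt; apply: contra Hl' => h; apply/eqP/U0 => //.
        by rewrite (le_trans (ltW h))// lerDl ltW.
      + rewrite ltNge; apply: contra Hl' => h; apply/eqP/U1.
        by rewrite (le_trans _ h)// gerBl ltW.
      + rewrite leNgt; apply: contra Hl => h; apply/eqP/U0 => //.
        by rewrite (le_trans (ltW h))// lerDl ltW.
      + rewrite ltNge; apply: contra Hl => h; apply/eqP/U1.
        by rewrite (le_trans _ h)// gerBl ltW.
    by exists [ffun j => k0 j] => j l; rewrite ffunE; exact: Hk0.
  apply: (@sum_prod_le R d N J c
    (fun j l => U m j l (0 + (j \notin J))%N (x ord0 j) - (um (m, j)).2 / 2 *+ (j \in J))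
    step k0 M) => //.
  + move=> j l jJ /=; rewrite jJ /=.
    have [_ _ /andP[? ?] /(_ (x ord0 j - knot j l))/andP[? ?] _] := Hum (m, j).
    by rewrite /U /= ler_norml; apply/andP; split; lra.
  + move=> j l jJ; rewrite jJ (negbTE jJ) /= subr0.
    have [_|lk] := eqVneq l (k0 j); first exact: U1n.
    rewrite [leLHS](_ : _ = 0)// ; apply/eqP; rewrite normr_eq0.
    by apply: contraT => /Hk0 lk'; rewrite lk' eqxx in lk.
- rewrite /= /Z z1; split=> [m x|x xk].
    apply: le_trans (ler_norm_sum _ _ _) _; apply: ler_sum => k _.
    rewrite normrM ler_piMr// normr_prod prodr_ile1// => j _.
    by rewrite normr_ge0 U1n.
  rewrite /tensor /grid_fun; apply: cvg_sum_fin => k.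
  apply: cvgM; first exact: cvg_cst.
  apply: cvg_prod_fin => j.
  have e1 m : U m j (k j) 1 (x ord0 j) = bump_fun (step j) m (x ord0 j - knot j (k j)).
    by have [_ h1 _ _ _] := Hum (m, j); rewrite /U h1.
  under eq_fun do rewrite e1.
  rewrite indicE; have [xc|xc] := boolP (x ord0 j \in cell j (k j)).
    apply: (@bump_cvg R (step j)).
    move: xc; rewrite inE /cell/= in_itv/= knotS => /andP[h1 h2].
    rewrite subr_gt0 lt_neqAle eq_sym xk h1/=; lra.
  rewrite [X in X @ _](_ : _ = cst 0); first exact: cvg_cst.
  apply/funext => m /=; apply: bump_eq0.
  move: xc; rewrite notin_setE /cell/= in_itv/= knotS => /negP.
  rewrite negb_and -ltNge -leNgt; have sj := sm m j.
  by case/orP; move: (step j / _) sj => s s0 ?; [left|right]; lra.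
Qed.

End grid.

(** * Pairing with grid functions *)

Section test_bounds.
Context {R : realType} {d : nat}.
Local Notation leb := (@lebesgue_rV R d).

(** The number [V] bounds the variation of [p] in the directions of [J] in the weak
    sense: the pairing of [p] with the [J]-th derivative of a test function supported
    in the interior of the box is at most [V] times its sup norm. All three notions of
    variation of the theorem satisfy this. *)
Definition test_bound (a b : 'rV[R]_d) (J : {set 'I_d}) (p : 'rV[R]_d -> R)
    (V : \bar R) : Prop :=
  forall (Z : ('I_d -> nat) -> 'rV[R]_d -> R) (a' b' : 'rV[R]_d) (C : R),
    dfamily Z -> (forall i, (a ord0 i < a' ord0 i) /\ (b' ord0 i < b ord0 i)) ->
    (forall x, ~ box a' b' x -> Z (fun=> 0%N) x = 0) ->
    (forall x, `|Z (fun=> 0%N) x| <= C) ->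
    (`|\int[leb]_(x in (box a b)°)
        (p x * Z (foldr incr (fun=> 0%N) (enum J)) x)%:E| <= C%:E * V)%E.

Lemma measurable_grid_fun N (a b : 'rV[R]_d) (c : {ffun 'I_d -> 'I_N} -> R) :
  measurable_fun setT (grid_fun a b c).
Proof.
apply: measurable_sum => k; apply: measurable_funM => //.
apply: measurable_prod => j _.
apply: measurableT_comp; last exact: measurable_coord_rV.
by apply: measurable_indic; exact: measurable_itv.
Qed.

(** Dominated convergence along [grid_approx]; convergence may fail only on the
    hyperplanes through the knots, which are null sets. *)
Lemma grid_test_bound N (a b : 'rV[R]_d) J p V (c : {ffun 'I_d -> 'I_N} -> R) M :
  (0 < N)%N -> (forall i, a ord0 i < b ord0 i) ->
  leb.-integrable (box a b)° (EFin \o p) ->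
  test_bound a b J p V ->
  (forall i, i \in J -> zero_sum i c) ->
  (forall k0 : {ffun 'I_d -> 'I_N}, (\prod_(j in J) step (N := N) a b j) *
    (\sum_(k : {ffun 'I_d -> 'I_N} | [forall (j | j \notin J), k j == k0 j]) `|c k|) <= M) ->
  (`|\int[leb]_(x in (box a b)°) (p x * grid_fun a b c x)%:E| <=
    (2^-1 ^+ #|J| * M)%:E * V)%E.
Proof.
move=> N0 hab ip tb c0 cM.
have [Z [a' [b' [dZ ab Z0 ZC]]]] := grid_approx N0 hab c0 cM.
set z := foldr incr (fun=> 0%N) (enum J); move=> [ZK Zc].
have mS : measurable (box a b)° by exact: measurable_interior.
have mp : measurable_fun (box a b)° p.
  by case/integrableP : ip => /measurable_EFinP.
have ipK : leb.-integrable (box a b)° (EFin \o (fun x => (\sum_k `|c k|) * `|p x|)).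
  have /(integrableZl mS (\sum_k `|c k|)) := integrable_norm ip.
  by under [in X in X -> _]eq_fun do rewrite /= -EFinM.
have aek : {ae leb, forall x : 'rV[R]_d, forall j (l : nat), x ord0 j != knot (N := N) a b j l}.
  suff H j : {ae leb, forall x : 'rV[R]_d, forall (l : nat), x ord0 j != knot (N := N) a b j l}.
    refine (@filter_forall _ _ (fun (j : 'I_d) (x : 'rV[R]_d) =>
      forall l, x ord0 j != knot (N := N) a b j l) (almost_everywhere leb) _ H).
  apply: ae_foralln => l; exists [set x : 'rV[R]_d | x ord0 j = knot (N := N) a b j l]; split.
  - exact: measurable_hyperplane.
  - exact: lebesgue_rV_hyperplane.
  - by move=> x /= /negP; rewrite negbK => /eqP.
have [] := @dominated_convergence _ _ _ leb _ mS
  (fun m x => (p x * Z m z x)%:E) (fun x => (p x * grid_fun a b c x)%:E)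
  (fun x => ((\sum_k `|c k|) * `|p x|)%:E).
- move=> m; apply/measurable_EFinP; apply: measurable_funM => //.
  apply: within_box_measurable; apply: continuous_subspaceT.
  by have [cZ _] := dZ m.
- apply/measurable_EFinP; apply: measurable_funM => //.
  exact: measurable_funTS (measurable_grid_fun _ _ _).
- apply: filterS aek => x xk _; apply: cvg_EFin; first exact: nearW.
  by apply: cvgM; [exact: cvg_cst|exact: Zc].
- exact: ipK.
- apply: aeW => x m _; rewrite /= lee_fin normrM mulrC ler_wpM2r//.
move=> _ _ /cvg_abse lim.
rewrite -(cvg_lim _ lim)//.
apply: lime_le; first by apply/cvgP; exact: lim.
by apply: nearW => m /=; exact: (tb _ (a' m) (b' m) _ (dZ m) (ab m) (Z0 m) (ZC m)).
Qed.

End test_bounds.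

Section faces.
Context {R : realType} {d : nat}.
Variables (a b : 'rV[R]_d).
Local Notation leb := (@lebesgue_rV R d).
Local Open Scope ereal_scope.

(** Half-open boxes, so that the cells of a grid partition the box. *)
Definition hbox (u v : 'rV[R]_d) : set 'rV[R]_d :=
  cyl (fun j => `[u ord0 j, v ord0 j[%classic).

Lemma measurable_hbox u v : measurable (hbox u v).
Proof. by apply: measurable_cyl => j; exact: measurable_itv. Qed.

Lemma lebesgue_hbox (u v : 'rV[R]_d) : (forall j, (u ord0 j <= v ord0 j)%R) ->
  leb (hbox u v) = (\prod_j (v ord0 j - u ord0 j))%:E.
Proof.
move=> uv; rewrite lebesgue_rV_cyl; last by move=> j; exact: measurable_itv.
rewrite -prodEFin; apply: eq_bigr => j _; rewrite lebesgue_measure_itv/=.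
case: ifP => [_|]; first by rewrite EFinB.
rewrite lte_fin => /negbT; rewrite -leNgt => vu.
by rewrite (@le_anti _ _ (u ord0 j) (v ord0 j)) ?uv ?vu// subrr.
Qed.

Let face j : set 'rV[R]_d :=
  [set x | x ord0 j = a ord0 j] `|` [set x | x ord0 j = b ord0 j].

Let faces := \big[setU/set0]_(j < d) face j.

Let faces_null : measurable faces /\ leb faces = 0.
Proof.
have null2 (A B : set 'rV[R]_d) : measurable A /\ leb A = 0 ->
    measurable B /\ leb B = 0 -> measurable (A `|` B) /\ leb (A `|` B) = 0.
  move=> [mA A0] [mB B0]; split; first exact: measurableU.
  apply/eqP; rewrite eq_le measure_ge0 andbT.
  by apply: le_trans (measureU2 _ _ _) _ => //; rewrite [X in X + _]A0 [X in _ + X]B0 adde0.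
rewrite /faces; elim/big_ind : _ => [|//|j _].
  by split; rewrite ?measure0.
by apply: null2; split; [exact: measurable_hyperplane|exact: lebesgue_rV_hyperplane|
  exact: measurable_hyperplane|exact: lebesgue_rV_hyperplane].
Qed.

Let facesP x : faces x <-> exists j, x ord0 j = a ord0 j \/ x ord0 j = b ord0 j.
Proof.
rewrite /faces -bigcup_seq; split=> [[j _ xj]|[j xj]]; exists j => //.
by rewrite /= mem_index_enum.
Qed.

Let interiorE : (box a b)° = box a b `\` faces.
Proof.
rewrite interior_box; apply/seteqP; split=> x.
  move=> h; split.
    by move=> j; have /= := h j; rewrite in_itv/= => /andP[/ltW-> /ltW->].
  by move=> /facesP[j]; have /= := h j; rewrite in_itv/= => /andP[? ?]; case; lra.
move=> [h /facesP nf] j /=; have /andP[h1 h2] := h j; rewrite in_itv/= !lt_neqAle h1 h2 !andbT.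
by apply/andP; split; apply/eqP => e; apply: nf; exists j; [left|right]; rewrite e.
Qed.

Let interiorE' : (box a b)° = hbox a b `\` faces.
Proof.
rewrite interiorE; apply/seteqP; split=> x [h nf]; split => // j.
  have /andP[h1 h2] := h j; rewrite /= in_itv/= h1 lt_neqAle h2 andbT.
  by apply/eqP => e; apply: nf; apply/facesP; exists j; right.
by have := h j; rewrite /= in_itv/= => /andP[-> /ltW->].
Qed.

Lemma integral_box_interior (f : 'rV[R]_d -> \bar R) : leb.-integrable (box a b) f ->
  \int[leb]_(x in box a b) f x = \int[leb]_(x in (box a b)°) f x.
Proof.
move=> fi; rewrite interiorE; apply: negligible_integral => //.
- exact: faces_null.1.
- exact: measurable_box.
- exact: faces_null.2.
Qed.

Lemma integral_hbox_interior (f : 'rV[R]_d -> \bar R) : leb.-integrable (box a b) f ->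
  \int[leb]_(x in hbox a b) f x = \int[leb]_(x in (box a b)°) f x.
Proof.
move=> fi; rewrite interiorE'; apply: negligible_integral => //.
- exact: faces_null.1.
- exact: measurable_hbox.
- apply: integrableS fi; [exact: measurable_box|exact: measurable_hbox|].
  by move=> x h j; have := h j; rewrite /= in_itv/= => /andP[-> /ltW->].
- exact: faces_null.2.
Qed.

End faces.

(** * Averages over the cells of a grid *)

Section slabs.
Context {R : realType} {d : nat}.
Variables (a b : 'rV[R]_d).
Local Notation leb := (@lebesgue_rV R d).

(** Mean zero along the [i]-th coordinate, in weak form: the boxes over which one
    integrates are full in direction [i]. No slices are involved, so the property only
    depends on the class of [psi] modulo null sets. *)
Definition slab_mean0 (i : 'I_d) (psi : 'rV[R]_d -> R) : Prop :=
  forall u v : 'rV[R]_d,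
  (forall j, a ord0 j <= u ord0 j <= v ord0 j) ->
  (forall j, v ord0 j <= b ord0 j) ->
  u ord0 i = a ord0 i -> v ord0 i = b ord0 i ->
  (\int[leb]_(x in hbox u v) (psi x)%:E = 0)%E.

(** The weak form of the statement that [M] bounds the integral of [|psi|] over almost
    every slice of the box parallel to [R^J]. *)
Definition slab_bound (J : {set 'I_d}) (psi : 'rV[R]_d -> R) (M : R) : Prop :=
  forall (u v : 'rV[R]_d),
  (forall j, a ord0 j <= u ord0 j <= v ord0 j) ->
  (forall j, v ord0 j <= b ord0 j) ->
  (forall i, i \in J -> u ord0 i = a ord0 i /\ v ord0 i = b ord0 i) ->
  (\int[leb]_(x in hbox u v) `|psi x|%:E <=
     (M * \prod_(j in ~: J) (v ord0 j - u ord0 j))%:E)%E.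

End slabs.

Section cell_averages.
Context {R : realType} {d N : nat}.
Variables (a b : 'rV[R]_d).
Hypothesis N0 : (0 < N)%N.
Hypothesis hab : forall i, a ord0 i < b ord0 i.
Local Notation leb := (@lebesgue_rV R d).
Local Notation knot := (knot (N := N) a b).
Local Notation step := (step (N := N) a b).
Implicit Types k : {ffun 'I_d -> 'I_N}.

Definition gcell k : set 'rV[R]_d := cyl (fun j => cell (N := N) a b j (k j)).

Lemma gcellE k : gcell k = hbox (\row_j knot j (k j)) (\row_j knot j (k j).+1).
Proof. by apply/seteqP; split=> x h j; have := h j; rewrite !mxE. Qed.

Lemma measurable_gcell k : measurable (gcell k).
Proof. by apply: measurable_cyl => j; exact: measurable_itv. Qed.

Lemma lebesgue_gcell k : leb (gcell k) = (\prod_j step j)%:E.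
Proof.
rewrite gcellE lebesgue_hbox; last by move=> j; rewrite !mxE; exact: knot_le.
congr (_%:E); apply: eq_bigr => j _; rewrite !mxE knotS//; ring.
Qed.

Lemma gcell_inj k k' x : gcell k x -> gcell k' x -> k = k'.
Proof.
move=> h h'; apply/ffunP => j; apply/val_inj.
have := h j; have := h' j; rewrite /cell /= !in_itv/= => h1 h2.
exact: (cell_inj N0 hab h2 h1).
Qed.

Lemma gcell_cover x : hbox a b x <-> exists k, gcell k x.
Proof.
split=> [h|[k h] j].
  have /choice[k Hk] : forall j, exists l : 'I_N, knot j l <= x ord0 j < knot j l.+1.
    by move=> j; apply: cell_cover => //; have := h j; rewrite /= in_itv.
  by exists [ffun j => k j] => j; rewrite /cell /= in_itv/= ffunE.
have := h j; rewrite /cell /= !in_itv/= => /andP[h1 h2].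
rewrite (le_trans _ h1) ?(lt_le_trans h2)//.
  by rewrite -(knotN a b N0 j); exact: knot_le.
by rewrite -(knot0 (N := N) a b j); exact: knot_le.
Qed.

Lemma grid_fun_cell c k x : gcell k x -> grid_fun a b c x = c k.
Proof.
move=> kx; rewrite /grid_fun (bigD1 k)//= [X in _ * X]big1 => [|j _]; last first.
  by rewrite indicE mem_set//; exact: kx.
rewrite mulr1 big1 ?addr0// => k' k'k.
have [j kj] : exists j, ~ cell (N := N) a b j (k' j) (x ord0 j).
  apply/existsNP => h; move/eqP: k'k; apply; exact: gcell_inj h kx.
by rewrite (bigD1 j)//= indicE memNset// mul0r mulr0.
Qed.

Lemma integral_gcells (s : seq {ffun 'I_d -> 'I_N}) (f : 'rV[R]_d -> R) : uniq s ->
  measurable_fun setT f ->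
  (\int[leb]_(x in \big[setU/set0]_(k <- s) gcell k) (f x)%:E =
   \sum_(k <- s) \int[leb]_(x in gcell k) (f x)%:E)%E.
Proof.
move=> us mf; apply: integral_bigsetU_EFin => //.
- exact: measurable_gcell.
- by move=> k k' _ _ [x []]; exact: gcell_inj.
- by apply/measurable_EFinP; exact: measurable_funTS.
Qed.

Lemma hbox_gcells : hbox a b = \big[setU/set0]_(k <- enum {ffun 'I_d -> 'I_N}) gcell k.
Proof.
rewrite -bigcup_seq; apply/seteqP; split=> x.
  by move=> /gcell_cover[k kx]; exists k => //=; rewrite mem_enum.
by move=> [k _ kx]; apply/gcell_cover; exists k.
Qed.

Variable psi : 'rV[R]_d -> R.
Hypothesis mpsi : measurable_fun setT psi.
Variable B : R.
Hypothesis psiB : forall x, `|psi x| <= B.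

Definition cavg k : R := (\prod_j step j)^-1 * \int[leb]_(x in gcell k) psi x.

Lemma prod_step_gt0 : 0 < \prod_j step j.
Proof. by apply: prodr_gt0 => j _; exact: step_gt0. Qed.

Lemma bounded_integrable (A : set 'rV[R]_d) (f : 'rV[R]_d -> R) (C : R) :
  measurable A -> (leb A < +oo)%E ->
  measurable_fun A f -> (forall x, A x -> `|f x| <= C) -> leb.-integrable A (EFin \o f).
Proof.
move=> mA Afin mf fC; apply: measurable_bounded_integrable => //.
exists C; split; first exact: num_real.
by move=> M CM x Ax; apply: le_trans (fC x Ax) (ltW CM).
Qed.

Lemma psi_integrable (A : set 'rV[R]_d) : measurable A -> (leb A < +oo)%E ->
  leb.-integrable A (EFin \o psi).
Proof.
move=> mA Afin; apply: (@bounded_integrable _ _ B) => //; exact: measurable_funTS.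
Qed.

Lemma lebesgue_gcell_lty k : (leb (gcell k) < +oo)%E.
Proof. by rewrite lebesgue_gcell ltry. Qed.

Lemma cavgE k : (\int[leb]_(x in gcell k) (psi x)%:E = ((\prod_j step j) * cavg k)%:E)%E.
Proof.
rewrite /cavg mulVKf ?gt_eqF ?prod_step_gt0// /Rintegral fineK//.
apply: integrable_fin_num; first exact: measurable_gcell.
by apply: psi_integrable; [exact: measurable_gcell|exact: lebesgue_gcell_lty].
Qed.

Lemma cavg_le k : `|cavg k| <= B.
Proof.
rewrite -lee_fin -(@lee_pmul2l _ (\prod_j step j)%:E)//; last first.
  by rewrite lte_fin prod_step_gt0.
rewrite -EFinM -[X in (X%:E <= _)%E]ger0_norm; last first.
  by rewrite mulr_ge0// ltW// prod_step_gt0.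
rewrite normrM normr_id -normrM -abse_EFin -cavgE.
apply: le_trans (le_abse_integral _ _ _) _; first exact: measurable_gcell.
  by apply/measurable_EFinP; exact: measurable_funTS.
rewrite muleC -(lebesgue_gcell k) -integral_cst; last exact: measurable_gcell.
apply: ge0_le_integral => //; first exact: measurable_gcell.
- by apply/measurable_EFinP; apply: measurableT_comp => //; exact: measurable_funTS.
- by move=> x _; rewrite lee_fin; exact: psiB.
Qed.

Lemma grid_fun_le x : `|grid_fun a b cavg x| <= B.
Proof.
have B0 : 0 <= B by exact: le_trans (psiB x).
have [[k kx]|nk] := pselect (exists k, gcell k x).
  by rewrite (grid_fun_cell _ kx) cavg_le.
rewrite /grid_fun big1 ?normr0// => k _.
have [j kj] : exists j, ~ cell (N := N) a b j (k j) (x ord0 j).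
  by apply/existsNP => h; apply: nk; exists k.
by rewrite (bigD1 j)//= indicE memNset// mul0r mulr0.
Qed.

Lemma integral_grid_fun k :
  (\int[leb]_(x in gcell k) (grid_fun a b cavg x - psi x)%:E = 0)%E.
Proof.
have mk := measurable_gcell k; have fk := lebesgue_gcell_lty k.
under eq_integral do rewrite EFinB.
rewrite integralB//; last 2 first.
- apply: (@bounded_integrable _ _ B) => //; last by move=> x _; exact: grid_fun_le.
  exact: measurable_funTS (measurable_grid_fun _ _ _).
- exact: psi_integrable.
rewrite cavgE (eq_integral (cst (cavg k)%:E)); last first.
  by move=> x; rewrite inE => kx /=; rewrite (grid_fun_cell _ kx).
have -> : (\int[leb]_(x in gcell k) (cst (cavg k)%:E) x =
    (cavg k)%:E * (\prod_j step j)%:E)%E.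
  by rewrite -(lebesgue_gcell k); exact: integral_cst.
by rewrite -EFinM mulrC subee.
Qed.

Variable J : {set 'I_d}.
Variable M : R.
Hypothesis psi0 : forall i, i \in J -> slab_mean0 a b i psi.
Hypothesis psiM : slab_bound a b J psi M.

Let knot_bounds j (l : 'I_N) : a ord0 j <= knot j l /\ knot j l <= knot j l.+1 /\
  knot j l.+1 <= b ord0 j.
Proof.
rewrite -(knot0 (N := N) a b j) -(knotN a b N0 j).
by split; [|split]; exact: knot_le.
Qed.

(** The cells along a grid line of direction [i] make up a box that is full in that
    direction. *)
Lemma cavg_zero_sum i : i \in J -> zero_sum i cavg.
Proof.
move=> iJ k; have p0 := prod_step_gt0.
apply: (mulfI (lt0r_neq0 p0)); rewrite mulr0 mulr_sumr; apply: EFin_inj.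
rewrite -sumEFin.
pose u : 'rV[R]_d := \row_j if j == i then a ord0 i else knot j (k j).
pose v : 'rV[R]_d := \row_j if j == i then b ord0 i else knot j (k j).+1.
rewrite (eq_bigr (fun l => \int[leb]_(x in gcell (upd k i l)) (psi x)%:E)%E); last first.
  by move=> l _; rewrite cavgE.
rewrite -(@big_map _ _ _ _ _ (fun l => upd k i l) (index_enum 'I_N) xpredT
  (fun k => \int[leb]_(x in gcell k) (psi x)%:E)%E).
rewrite -integral_gcells//; last first.
  rewrite map_inj_uniq ?index_enum_uniq// => l l' /ffunP/(_ i).
  by rewrite !ffunE eqxx.
rewrite (_ : \big[setU/set0]_(_ <- _) _ = hbox u v).
  apply: (psi0 iJ) => [j|j||]; rewrite !mxE ?eqxx//; case: eqVneq => [->|_] //.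
  - by rewrite lexx ltW.
  - by have [-> [-> _]] := knot_bounds j (k j).
  - by have [_ [_ ->]] := knot_bounds j (k j).
rewrite -bigcup_seq; apply/seteqP; split=> x.
  move=> [_ /mapP[l _ ->]] h j; have := h j; rewrite /cell /= !in_itv/= !ffunE !mxE.
  case: eqVneq => [->|//]; have [h1 [_ h2]] := knot_bounds i l.
  by move=> /andP[h3 h4]; rewrite (le_trans h1 h3) (lt_le_trans h4 h2).
move=> h; have [l Hl] : exists l : 'I_N, knot i l <= x ord0 i < knot i l.+1.
  by apply: cell_cover => //; have := h i; rewrite /= in_itv/= !mxE eqxx.
exists (upd k i l); first by apply/mapP; exists l => //; rewrite mem_index_enum.
move=> j; have := h j; rewrite /cell /= !in_itv/= ffunE !mxE.
by case: eqVneq => [->|].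
Qed.

(** The cells with prescribed indices outside [J] make up a box that is full in the
    directions of [J]. *)
Lemma cavg_sum_le k0 : (\prod_(j in J) step j) *
  (\sum_(k : {ffun 'I_d -> 'I_N} | [forall (j | j \notin J), k j == k0 j]) `|cavg k|) <= M.
Proof.
pose u : 'rV[R]_d := \row_j if j \in J then a ord0 j else knot j (k0 j).
pose v : 'rV[R]_d := \row_j if j \in J then b ord0 j else knot j (k0 j).+1.
have c0 : 0 < \prod_(j in ~: J) step j by apply: prodr_gt0 => j _; exact: step_gt0.
rewrite -(ler_pM2r c0) mulrAC.
have -> : (\prod_(j in J) step j) * \prod_(j in ~: J) step j = \prod_j step j.
  rewrite [RHS](bigID (mem J))/=; congr (_ * _); by apply: eq_bigl => j; rewrite inE.
have -> : M * \prod_(j in ~: J) step j = M * \prod_(j in ~: J) (v ord0 j - u ord0 j).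
  congr (_ * _); apply: eq_bigr => j; rewrite inE => jJ.
  by rewrite !mxE (negbTE jJ) knotS//; ring.
rewrite -lee_fin; apply: (le_trans _ (psiM _ _ _)).
- rewrite mulr_sumr -[X in (X%:E <= _)%E]big_filter -sumEFin; set s := [seq _ <- _ | _].
  apply: (@le_trans _ _ (\int[leb]_(x in \big[setU/set0]_(k <- s) gcell k) `|psi x|%:E)%E).
    rewrite integral_gcells//; last 2 first.
    + by rewrite filter_uniq// index_enum_uniq.
    + exact: measurableT_comp.
    apply: lee_sum => k _.
    rewrite -[X in (X%:E <= _)%E]ger0_norm; last first.
      by rewrite mulr_ge0// ltW// prod_step_gt0.
    rewrite normrM normr_id -normrM -abse_EFin -cavgE.
    apply: le_trans (le_abse_integral _ _ _) _ => //; first exact: measurable_gcell.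
    by apply/measurable_EFinP; exact: measurable_funTS.
  apply: ge0_subset_integral => //.
  + by apply: bigsetU_measurable => k _; exact: measurable_gcell.
  + exact: measurable_hbox.
  + by apply/measurable_EFinP; apply: measurable_funTS; exact: measurableT_comp.
  + rewrite -bigcup_seq => x [k /=]; rewrite mem_filter => /andP[/forallP kk _] kx j.
    have := kx j; rewrite /cell /= !in_itv/= !mxE; have := kk j.
    case: ifP => [_ _|_ /= /eqP ->//].
    have [h1 [_ h2]] := knot_bounds j (k j).
    by move=> /andP[h3 h4]; rewrite (le_trans h1 h3) (lt_le_trans h4 h2).
- move=> j; rewrite !mxE; case: ifP => _; first by rewrite lexx ltW.
  by have [-> [-> _]] := knot_bounds j (k0 j).
- move=> j; rewrite !mxE; case: ifP => _ //.
  by have [_ [_ ->]] := knot_bounds j (k0 j).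
- by move=> i iJ; rewrite !mxE iJ.
Qed.

End cell_averages.

(** * Weak convergence of dyadic averages *)

Section dyadic.
Context {R : realType} {d : nat}.
Variables (a b : 'rV[R]_d).
Hypothesis hab : forall i, a ord0 i < b ord0 i.
Local Notation leb := (@lebesgue_rV R d).

Definition dpoint (m : nat) (q : int) j : R :=
  a ord0 j + q%:~R * ((b ord0 j - a ord0 j) / (2 ^ m)%:R).

Definition orthant (m : nat) (q : 'I_d -> int) : set 'rV[R]_d :=
  cyl (fun j => `]-oo, dpoint m (q j) j[%classic).

Lemma dpoint_refine m n q j : (m <= n)%N ->
  dpoint m q j = dpoint n (q * (2 ^ (n - m))%:Z) j.
Proof.
move=> mn; rewrite /dpoint intrM -[((2 ^ (n - m))%:Z)%:~R]/((2 ^ (n - m))%:R : R).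
have -> : (2 ^ n)%:R = (2 ^ (n - m))%:R * (2 ^ m)%:R :> R.
  by rewrite -natrM -expnD subnK.
have h2 k : (2 ^ k)%:R != 0 :> R by rewrite pnatr_eq0 -lt0n expn_gt0.
by congr (_ + _); field; rewrite !h2.
Qed.

Lemma dpoint_mono m j : {mono (fun q => dpoint m q j) : p q / p <= q}.
Proof.
by move=> p q; rewrite lerD2l ler_pM2r ?ler_int// divr_gt0 ?subr_gt0// ltr0n expn_gt0.
Qed.

Lemma dpoint_knot n j (l : nat) : knot (N := 2 ^ n) a b j l = dpoint n l j.
Proof. by []. Qed.

Lemma measurable_orthant m q : measurable (orthant m q).
Proof. by apply: measurable_cyl => j; exact: measurable_itv. Qed.

(** The faces of a dyadic orthant lie on the hyperplanes of every finer dyadic grid,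
    extended beyond the box, so the orthant does not cut through the cells. *)
Lemma orthant_cell m n q (k : {ffun 'I_d -> 'I_(2 ^ n)}) : (m <= n)%N ->
  exists t : bool, forall x, gcell a b k x -> x \in orthant m q = t.
Proof.
move=> mn; exists [forall j, ((k j : nat)%:Z < q j * (2 ^ (n - m))%:Z)%R] => x kx.
apply/idP/forallP => [|h].
  rewrite inE => xq j; have := xq j; have := kx j.
  rewrite /cell /= !in_itv/= (dpoint_refine _ _ mn) !dpoint_knot => /andP[h1 _] h2.
  by have := le_lt_trans h1 h2; rewrite (leW_mono (dpoint_mono n j)).
rewrite inE => j; have := kx j; have := h j.
rewrite /cell /= !in_itv/= (dpoint_refine _ _ mn) !dpoint_knot => h1 /andP[_ h2].
apply: lt_le_trans h2 _; rewrite dpoint_mono.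
by rewrite -addn1 PoszD lezD1.
Qed.

Definition orthants : set (set 'rV[R]_d) :=
  [set A | exists m q, A = orthant m q].

Lemma setI_closed_orthants : setI_closed orthants.
Proof.
move=> _ _ [m [q ->]] [m' [q' ->]].
exists (m + m')%N, (fun j => Num.min (q j * (2 ^ m')%:Z) (q' j * (2 ^ m)%:Z)).
have e j : dpoint (m + m') (Num.min (q j * (2 ^ m')%:Z) (q' j * (2 ^ m)%:Z)) j =
    Num.min (dpoint m (q j) j) (dpoint m' (q' j) j).
  rewrite (dpoint_refine _ _ (leq_addr m' m)) (dpoint_refine _ _ (leq_addl m m')).
  rewrite addKn addnK; have mono := dpoint_mono (m + m') j.
  set x := q j * _; set y := q' j * _.
  by rewrite /Order.min (leW_mono mono); case: ifP.
apply/seteqP; split=> x.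
  by move=> [h1 h2] j; have := h1 j; have := h2 j; rewrite /= !in_itv/= e lt_min => -> ->.
by move=> h; split=> j; have := h j; rewrite /= !in_itv/= e lt_min => /andP[].
Qed.

(** A half-space [x_i < c] is the countable union of the dyadic orthants that it
    contains. *)
Lemma measurable_orthantsE : @measurable _ 'rV[R]_d = <<s orthants >>.
Proof.
apply/seteqP; split; last first.
  apply: smallest_sub; first exact: sigma_algebra_measurable.
  by move=> _ [m [q ->]]; exact: measurable_orthant.
apply: smallest_sub; first exact: smallest_sigma_algebra.
rewrite -bigcup_seq/=; apply: bigcup_sub => i _ _ [B mB <-]; rewrite setTI.
suff : measurable_fun setT (fun x : g_sigma_algebraType orthants => (x : 'rV[R]_d) ord0 i).
  by move=> /(_ measurableT _ mB); rewrite setTI.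
apply: (measurability (@RGenInftyO.G R)) => [|_ [_ [c ->] <-]].
  exact: RGenInftyO.measurableE.
rewrite setTI.
pose F (z : nat * {ffun 'I_d -> int}) : set (g_sigma_algebraType orthants) :=
  if dpoint z.1 (z.2 i) i <= c then orthant z.1 z.2 else set0.
have -> : (fun x : g_sigma_algebraType orthants => (x : 'rV[R]_d) ord0 i) @^-1`
    `]-oo, c[%classic = \bigcup_z F z.
  apply/seteqP; split=> x /=; last first.
    move=> [z _]; rewrite /F; case: ifP => // zc /(_ i); rewrite /= !in_itv/= => h.
    exact: lt_le_trans zc.
  rewrite in_itv/= => xc.
  have s0 m j : 0 < (b ord0 j - a ord0 j) / (2 ^ m)%:R.
    by rewrite divr_gt0 ?subr_gt0// ltr0n expn_gt0.
  have [m hm] : exists m, (b ord0 i - a ord0 i) / (2 ^ m)%:R < c - x ord0 i.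
    pose m := Num.truncn ((b ord0 i - a ord0 i) / (c - x ord0 i)); exists m.
    rewrite ltr_pdivrMr ?ltr0n ?expn_gt0// mulrC -ltr_pdivrMr ?subr_gt0//.
    apply: lt_le_trans (truncnS_gt _) _; rewrite ler_nat; exact: ltn_expl.
  exists (m, [ffun j => Num.floor ((x ord0 j - a ord0 j) / ((b ord0 j - a ord0 j) / (2 ^ m)%:R)) + 1]) => //.
  rewrite /F /= ffunE ifT.
    move=> j; rewrite /= in_itv/= ffunE /dpoint -ltrBlDl -ltr_pdivrMr//.
    by have := floorD1_gt ((x ord0 j - a ord0 j) / ((b ord0 j - a ord0 j) / (2 ^ m)%:R)).
  rewrite /dpoint intrD mulrDl mul1r.
  have : (Num.floor ((x ord0 i - a ord0 i) / ((b ord0 i - a ord0 i) / (2 ^ m)%:R)))%:~R *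
      ((b ord0 i - a ord0 i) / (2 ^ m)%:R) <= x ord0 i - a ord0 i.
    by rewrite -ler_pdivlMr// ge_floor.
  move: hm; set s := _ / _; set t := _ * _; lra.
apply: countable_bigcupT_measurable => [|z]; first exact: countableP.
rewrite /F; case: ifP => // _; apply: sub_sigma_algebra.
by exists z.1, z.2.
Qed.

End dyadic.

Import HBSimple.

Section averages_cvg.
Context {R : realType} {d : nat}.
Variables (a b : 'rV[R]_d).
Hypothesis hab : forall i, a ord0 i < b ord0 i.
Local Notation leb := (@lebesgue_rV R d).
Local Notation S' := (hbox a b).
Variable psi : 'rV[R]_d -> R.
Hypothesis mpsi : measurable_fun setT psi.
Variable B : R.
Hypothesis psiB : forall x, `|psi x| <= B.

Let N0 n : (0 < 2 ^ n)%N. Proof. by rewrite expn_gt0. Qed.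
Let mS : measurable S'. Proof. exact: measurable_hbox. Qed.
Let finS : (leb S' < +oo)%E.
Proof. by rewrite lebesgue_hbox ?ltry// => j; exact: ltW. Qed.

Let D n x := grid_fun a b (cavg (N := 2 ^ n) a b psi) x - psi x.

Let mD n : measurable_fun setT (D n).
Proof. by apply: measurable_funB => //; exact: measurable_grid_fun. Qed.

Let D_le n x : `|D n x| <= B + B.
Proof. by apply: le_trans (ler_normB _ _) _; rewrite lerD// grid_fun_le. Qed.

Let B0 : 0 <= B + B.
Proof. exact: le_trans (D_le 0 0). Qed.

Let L1 (f : 'rV[R]_d -> R) := leb.-integrable S' (EFin \o f).

Let mL1 f : L1 f -> measurable_fun S' f.
Proof. by case/integrableP => /measurable_EFinP. Qed.

Let D_L1 n f : L1 f -> L1 (fun x => D n x * f x).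
Proof.
move=> fi; have /(integrableZl mS (B + B)) := integrable_norm fi.
apply: le_integrable => //.
  apply/measurable_EFinP; apply: measurable_funM; [exact: measurable_funTS|exact: mL1].
move=> x _; rewrite /comp -EFinM !abse_EFin lee_fin !normrM normr_id ler_wpM2r//.
by apply: le_trans (D_le n x) _; exact: ler_norm.
Qed.

Let T n f : R := \int[leb]_(x in S') (D n x * f x).

(** The functions against which the averages converge weakly form a linear space that
    is closed in [L^1], because the averages are bounded. *)
Let Q f := L1 f /\ T ^~ f @ \oo --> (0 : R).

Let QD f g : Q f -> Q g -> Q (fun x => f x + g x).
Proof.
move=> [fi f0] [gi g0]; split.
  by have := integrableD mS fi gi.
rewrite (_ : T ^~ _ = (fun n => T n f + T n g)).
  by rewrite -[X in _ --> X]addr0; exact: cvgD.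
apply/funext => n; rewrite /T -RintegralD//; try exact: D_L1.
by apply: eq_Rintegral => x _; rewrite mulrDr.
Qed.

Let QZ c f : Q f -> Q (fun x => c * f x).
Proof.
move=> [fi f0]; split.
  by have := integrableZl mS c fi.
rewrite (_ : T ^~ _ = (fun n => c * T n f)).
  by rewrite -(mulr0 c); apply: cvgM => //; exact: cvg_cst.
apply/funext => n; rewrite /T -RintegralZl//; last exact: D_L1.
by apply: eq_Rintegral => x _; rewrite mulrCA.
Qed.

Let Q_L1 f (g : nat -> 'rV[R]_d -> R) : L1 f -> (forall k, Q (g k)) ->
  (fun k => \int[leb]_(x in S') `|(f x)%:E - (g k x)%:E|)%E @ \oo --> (0 : \bar R) ->
  Q f.
Proof.
move=> fi Qg fg; split => //; apply/cvgr0Pnorm_le => e e0.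
have Bp : 0 < B + B + 1 by rewrite ltr_wpDl.
have e2 : 0 < e / 2 / (B + B + 1) by rewrite divr_gt0// divr_gt0.
have [k fgk] : exists k, (\int[leb]_(x in S') `|(f x)%:E - (g k x)%:E| <= (e / 2 / (B + B + 1))%:E)%E.
  move/fine_cvgP : fg => [fin /cvgr0Pnorm_le/(_ _ e2)/= fk].
  near \oo => k; exists k.
  have f1 : (\int[leb]_(x in S') `|(f x)%:E - (g k x)%:E|)%E \is a fin_num.
    by near: k; exact: fin.
  rewrite -(fineK f1) lee_fin; apply: le_trans (ler_norm _) _.
  by near: k; exact: fk.
have [gi /cvgr0Pnorm_le/(_ (e / 2)) Tg] := Qg k.
have e20 : 0 < e / 2 by rewrite divr_gt0.
have fgi : L1 (fun x => f x - g k x) by have := integrableB mS fi gi.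
near=> n.
have -> : T n f = T n (g k) + T n (fun x => f x - g k x).
  rewrite /T -RintegralD//; try exact: D_L1.
  by apply: eq_Rintegral => x _; ring.
apply: le_trans (ler_normD _ _) _; rewrite [e]splitr lerD//.
  by near: n; exact: Tg.
rewrite -lee_fin EFin_normr_Rintegral//; last exact: D_L1.
have mfg : measurable_fun S' (fun x => f x - g k x) by exact: mL1.
have mDfg : measurable_fun S' (fun x => D n x * (f x - g k x)).
  by apply: measurable_funM => //; exact: measurable_funTS.
apply: le_trans (le_abse_integral _ _ _) _ => //; first exact/measurable_EFinP.
apply: (@le_trans _ _ ((B + B)%:E * \int[leb]_(x in S') `|(f x)%:E - (g k x)%:E|)%E).
  rewrite -ge0_integralZl//; last first.
    by apply/measurable_EFinP; exact: measurableT_comp.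
  apply: ge0_le_integral => //.
  - by apply/measurable_EFinP; exact: measurableT_comp.
  - apply/measurable_EFinP; apply: measurable_funM => //; exact: measurableT_comp.
  - by move=> x _; rewrite -EFinB !abse_EFin -EFinM lee_fin normrM ler_wpM2r.
apply: (@le_trans _ _ ((B + B)%:E * (e / 2 / (B + B + 1))%:E)%E).
  by rewrite lee_wpmul2l// lee_fin.
rewrite -EFinM lee_fin mulrA ler_pdivrMr//; nra.
Unshelve. all: by end_near. Qed.

Let L1_indic A : measurable A -> L1 \1_A.
Proof.
move=> mA; apply: (@bounded_integrable _ _ S' \1_A 1) => //.
by move=> x _; rewrite indicE; case: (_ \in _); rewrite ?normr1 ?normr0.
Qed.

(** The difference [D n] has integral 0 over each cell, hence over the part of the
    orthant in the box as soon as the grid is fine enough for it to be a union of cells. *)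
Let Q_orthant m q : Q \1_(orthant a b m q).
Proof.
have mO := measurable_orthant a b m q.
split; first exact: L1_indic.
apply: cvg_near_cst; near=> n.
have mn : (m <= n)%N by near: n; exact: nbhs_infty_ge.
rewrite /T /Rintegral.
rewrite (hbox_gcells (N0 n) hab) integral_bigsetU_EFin ?enum_uniq//=; last 3 first.
- by move=> k; exact: measurable_gcell.
- by move=> k k' _ _ [x []]; exact: gcell_inj.
- apply/measurable_EFinP; apply: measurable_funTS; apply: measurable_funM => //.
rewrite big1 ?fine0// => k _.
have [t tE] := orthant_cell hab q k mn.
rewrite (eq_integral (fun x => t%:R%:E * (D n x)%:E)%E); last first.
  by move=> x; rewrite inE => kx; rewrite indicE tE// -EFinM mulrC.
have mk := measurable_gcell a b k.
rewrite integralZl//; last first.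
  apply: (@bounded_integrable _ _ (gcell a b k) (D n) (B + B)) => //.
  - by apply: lebesgue_gcell_lty.
  - exact: measurable_funTS.
by rewrite (integral_grid_fun _ _ mpsi psiB)// mule0.
Unshelve. all: by end_near. Qed.

(** Dynkin's argument, starting from the pi-system of dyadic orthants. *)
Let Q_indic A : measurable A -> Q \1_A.
Proof.
move=> mA; have := mA; rewrite (measurable_orthantsE hab).
have QT : Q \1_[set: 'rV[R]_d].
  have [i1 h1] := Q_orthant 0 (fun=> 1%N%:Z); split; first exact: L1_indic.
  rewrite (_ : T ^~ _ = T ^~ \1_(orthant a b 0 (fun=> 1%N%:Z)))//.
  apply/funext => n; apply: eq_Rintegral => x.
  rewrite inE => Sx; rewrite !indicE !mem_set// => j; have := Sx j.
  by rewrite /= !in_itv/= /dpoint mul1r expn0 divr1 addrC subrK => /andP[].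
apply: (@dynkin_induction _ _ (orthants a b) (fun A => Q \1_A)) => //.
- exact: measurable_orthantsE.
- exact: setI_closed_orthants.
- by move=> _ [m [q ->]]; exact: Q_orthant.
- move=> C mC QC; have := QD QT (QZ (-1) QC); congr Q; apply/funext => x.
  rewrite !indicE in_setT in_setC mulN1r.
  by case: (x \in C); rewrite /= ?subrr ?subr0.
- move=> F mF tF QF.
  pose g k (x : 'rV[R]_d) : R := \sum_(i < k) \1_(F i) x.
  have gE x : (exists i0, F i0 x /\ forall k, g k x = (i0 < k)%:R) \/
      (~ (\bigcup_k F k) x /\ forall k, g k x = 0).
    have [[i0 _ Fi0]|nF] := pselect ((\bigcup_k F k) x).
      left; exists i0; split => // k; rewrite /g.
      have Fi i : i != i0 -> \1_(F i) x = 0 :> R.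
        move=> ii0; rewrite indicE memNset// => Fi; move/eqP: ii0; apply.
        by apply: (tF i i0) => //; exists x.
      case: ltnP => ik.
        rewrite (bigD1 (Ordinal ik))//= indicE mem_set//= big1 ?addr0// => i ii0.
        by apply: Fi; apply: contra ii0 => /eqP ii0; apply/eqP/val_inj.
      by rewrite big1// => i _; apply: Fi; rewrite ltn_eqF// (leq_trans _ ik).
    right; split => // k; rewrite /g big1// => i _.
    by rewrite indicE memNset// => Fi; apply: nF; exists i.
  have mU : measurable (\bigcup_k F k) by exact: bigcupT_measurable.
  have Qg k : Q (g k).
    elim: k => [|k IH].
      have := QZ 0 QT; congr Q; apply/funext => x.
      by rewrite mul0r /g big_ord0.
    have := QD IH (QF k); congr Q; apply/funext => x.
    by rewrite /g big_ord_recr.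
  have mg k : measurable_fun setT (g k).
    by apply: measurable_sum => i; exact: measurable_indic.
  apply: (@Q_L1 _ g) => //; first exact: L1_indic.
  have [] := @dominated_convergence _ _ _ leb S' mS
    (fun k x => (g k x)%:E) (fun x => (\1_(\bigcup_k F k) x)%:E) (cst 1%E).
  + by move=> k; apply/measurable_EFinP; exact: measurable_funTS.
  + by apply/measurable_EFinP; exact: measurable_funTS.
  + apply: aeW => x _; apply: cvg_EFin; first exact: nearW.
    have [[i0 [Fi0 gi0]]|[nF g0]] := gE x.
      rewrite indicE mem_set; last by exists i0.
      apply: cvg_near_cst; near=> k; rewrite /= gi0.
      by rewrite (_ : (i0 < k)%N)//; near: k; exact: nbhs_infty_gt.
    by rewrite indicE memNset//; apply: cvg_near_cst; apply: nearW => k /=; exact: g0.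
  + by have := L1_indic measurableT; rewrite /L1 indicT.
  + apply: aeW => x k _; rewrite /= lee_fin.
    have [[i0 [_ ->]]|[_ ->]] := gE x; last by rewrite normr0.
    by case: (_ < _)%N; rewrite ?normr1 ?normr0.
  move=> _ + _; apply: cvg_trans; apply: near_eq_cvg; apply: nearW => k.
  by apply: eq_integral => x _; rewrite -!EFinB /= distrC.
Unshelve. all: by end_near. Qed.

(** Weak convergence comes from density alone: indicator functions of dyadic orthants,
    then of Borel sets, then simple functions, then integrable functions. *)
Lemma averages_weak_cvg f : leb.-integrable S' (EFin \o f) ->
  (fun n => \int[leb]_(x in S')
    ((grid_fun a b (cavg (N := 2 ^ n) a b psi) x - psi x) * f x)) @ \oo --> (0 : R).
Proof.
move=> fi; have [g [gi _ fg]] := approximation_sfun_integrable mS fi.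
suff Qg k : Q (g k) by have [] := Q_L1 fi Qg fg.
pose s := fset_set (range (g k)).
have e x : g k x = \sum_(y <- finmap.enum_fset s) (y * \1_(g k @^-1` [set y]) x).
  by rewrite fimfunE fsbig_finite.
rewrite (funext e : (g k : 'rV[R]_d -> R) = _).
have mg y : measurable (g k @^-1` [set y]).
  by rewrite -[X in measurable X]setTI; exact: measurable_funP.
elim: (finmap.enum_fset s) => [|y t IH].
  have := QZ 0 (Q_indic measurableT); congr Q; apply/funext => x.
  by rewrite mul0r big_nil.
have := QD (QZ y (Q_indic (mg y))) IH; congr Q; apply/funext => x.
by rewrite big_cons.
Qed.

End averages_cvg.

(** * The pairing bound for functions of mean zero *)

Section mean_zero_pairing.
Context {R : realType} {d : nat}.
Variables (a b : 'rV[R]_d).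
Hypothesis hab : forall i, a ord0 i < b ord0 i.
Local Notation leb := (@lebesgue_rV R d).
Local Notation S := (box a b).

(** The dyadic averages of [psi] satisfy the hypotheses of [grid_test_bound] with the
    same [M] for all grids, and the bound survives their weak limit [psi]. *)
Lemma mean_zero_pairing_bound J (p psi : 'rV[R]_d -> R) (V : \bar R) (B M : R) :
  leb.-integrable S (EFin \o p) -> test_bound a b J p V ->
  measurable_fun setT psi -> (forall x, `|psi x| <= B) ->
  (forall i, i \in J -> slab_mean0 a b i psi) -> slab_bound a b J psi M ->
  (`|\int[leb]_(x in S) (psi x * p x)%:E| <= (2^-1 ^+ #|J| * M)%:E * V)%E.
Proof.
move=> ip tb mpsi psiB psi0 psiM.
have mS : measurable S by exact: measurable_box.
have mS' : measurable (hbox a b) by exact: measurable_hbox.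
have S'S : hbox a b `<=` S.
  by move=> x h j; have := h j; rewrite /= in_itv/= => /andP[-> /ltW->].
have ip' : leb.-integrable (hbox a b) (EFin \o p) by exact: integrableS ip.
have mp : measurable_fun S p by case/integrableP : ip => /measurable_EFinP.
have imul (f : 'rV[R]_d -> R) : measurable_fun setT f -> (forall x, `|f x| <= B) ->
    leb.-integrable S (EFin \o (fun x => f x * p x)).
  move=> mf fB; have /(integrableZl mS B) := integrable_norm ip.
  apply: le_integrable => //.
    apply/measurable_EFinP; apply: measurable_funM => //; exact: measurable_funTS.
  move=> x _; rewrite /comp -EFinM !abse_EFin lee_fin !normrM normr_id ler_wpM2r//.
  by apply: le_trans (fB x) _; exact: ler_norm.
pose E n := grid_fun a b (cavg (N := 2 ^ n) a b psi).
have N0 n : (0 < 2 ^ n)%N by rewrite expn_gt0.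
have mE n : measurable_fun setT (E n) by exact: measurable_grid_fun.
have EB n x : `|E n x| <= B by exact: grid_fun_le.
have EV n : (`|\int[leb]_(x in hbox a b) (E n x * p x)%:E| <= (2^-1 ^+ #|J| * M)%:E * V)%E.
  rewrite integral_hbox_interior; last exact: imul.
  under eq_integral do rewrite mulrC.
  apply: (grid_test_bound (N0 n)) => //.
  - apply: integrableS ip => //; last exact: interior_subset.
    exact: measurable_interior.
  - by move=> i iJ; apply: (cavg_zero_sum (J := J) _ _ _ psiB).
  - by move=> k0; apply: (cavg_sum_le _ _ _ psiB).
rewrite integral_box_interior; last exact: imul.
rewrite -integral_hbox_interior; last exact: imul.
have iE n : leb.-integrable (hbox a b) (EFin \o (fun x => E n x * p x)).
  by apply: integrableS (imul _ (mE n) (EB n)).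
have ipsi : leb.-integrable (hbox a b) (EFin \o (fun x => psi x * p x)).
  by apply: integrableS (imul _ mpsi psiB).
rewrite -EFin_normr_Rintegral//.
have cvg : (fun n => `|\int[leb]_(x in hbox a b) (E n x * p x)|) @ \oo -->
    `|\int[leb]_(x in hbox a b) (psi x * p x)|.
  apply: cvg_norm; have := averages_weak_cvg hab mpsi psiB ip'.
  move=> /(@cvgD _ _ _ _ _ _ _ _ ^~ (cvg_cst (\int[leb]_(x in hbox a b) (psi x * p x)))).
  rewrite addr0; apply: cvg_trans; apply: near_eq_cvg; apply: nearW => n.
  rewrite fctE -RintegralD//.
    by apply: eq_Rintegral => x _; rewrite /E; ring.
  have := integrableB mS' (iE n) ipsi; congr (_.-integrable _ _).
  by apply/funext => x; rewrite /= -EFinB mulrBl.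
have {}cvg : (fun n => `|\int[leb]_(x in hbox a b) (E n x * p x)|%:E) @ \oo -->
    `|\int[leb]_(x in hbox a b) (psi x * p x)|%:E.
  by apply: cvg_EFin; [exact: nearW|exact: cvg].
rewrite -(cvg_lim _ cvg)//; apply: lime_le.
  by apply/cvgP; exact: cvg.
by apply: nearW => n; rewrite EFin_normr_Rintegral.
Qed.

End mean_zero_pairing.

(** * The averaging operators *)

Section averaging_facts.
Context {R : realType} {d : nat}.
Variables (a b : 'rV[R]_d).
Hypothesis hab : forall i, a ord0 i < b ord0 i.
Local Notation leb := (@lebesgue_rV R d).
Local Notation S := (box a b).
Implicit Types (i j : 'I_d) (f g phi : 'rV[R]_d -> R).

Let wid i : 0 < b ord0 i - a ord0 i. Proof. by rewrite subr_gt0. Qed.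

Lemma measurable_insert i (w : 'rV[R]_#|~: [set i]|) :
  measurable_fun setT (fun t : R => rV_insert w t).
Proof.
exact: (measurableT_comp (@measurable_rV_insert R d i) (pair1_measurable w)).
Qed.

Lemma insert_restrict i (A : set R) (f : 'rV[R]_d -> \bar R) (w : 'rV[R]_#|~: [set i]|) :
  (\int[lebesgue_measure]_(t in A) f (rV_insert w t) =
   \int[lebesgue_measure]_t (f \_ [set x : 'rV[R]_d | A (x ord0 i)]) (rV_insert w t))%E.
Proof.
rewrite integral_mkcond; apply: eq_integral => t _; rewrite !patchE.
by congr (if _ then _ else _); apply/idP/idP; rewrite !inE/= rV_insert_in.
Qed.

Lemma measurable_avg i f : measurable_fun setT f -> measurable_fun setT (avg a b i f).
Proof.
move=> mf; apply: measurable_funM => //.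
apply: (measurableT_comp (f := fun w : 'rV[R]_#|~: [set i]| =>
  \int[lebesgue_measure]_(t in `[a ord0 i, b ord0 i]) f (rV_insert w t))); last exact: measurable_rV_proj.
apply: measurableT_comp => //.
under eq_fun do rewrite (insert_restrict _ (EFin \o f)).
apply: measurable_insert_integral; apply/(measurable_restrictT _ _).1.
  by have := measurable_coord_rV i measurableT (measurable_itv `[a ord0 i, b ord0 i]); rewrite setTI.
by apply/measurable_EFinP; exact: measurable_funTS.
Qed.

Let finI i : (lebesgue_measure (`[a ord0 i, b ord0 i]%classic : set R) < +oo)%E.
Proof. by rewrite lebesgue_measure_itv/=; case: ifP => _; rewrite ?ltry. Qed.

Let integrable_slice i f (B : R) (w : 'rV[R]_#|~: [set i]|) :
  measurable_fun setT f -> (forall x, `|f x| <= B) ->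
  lebesgue_measure.-integrable (`[a ord0 i, b ord0 i]%classic : set R) (EFin \o (fun t => f (rV_insert w t))).
Proof.
move=> mf fB; apply: measurable_bounded_integrable => //.
- exact: finI.
- apply: measurable_funTS; exact: (measurableT_comp mf (measurable_insert w)).
- exists B; split; first exact: num_real.
  by move=> M BM t _; apply: le_trans (fB _) (ltW BM).
Qed.

Lemma avg_le i f (B : R) : measurable_fun setT f -> (forall x, `|f x| <= B) ->
  forall x, `|avg a b i f x| <= B.
Proof.
move=> mf fB x; have L0 : 0 <= (b ord0 i - a ord0 i)^-1 by rewrite invr_ge0 ltW.
rewrite /avg normrM ger0_norm// mulrC ler_pdivrMr//.
apply: le_trans (le_normr_Rintegral _ (integrable_slice _ mf fB)) _ => //.
apply: (@le_trans _ _ (\int[lebesgue_measure]_(t in `[a ord0 i, b ord0 i]) B)).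
  apply: le_Rintegral => //.
  - by have := integrable_norm (integrable_slice (rV_proj (~: [set i]) x) mf fB).
  - by apply: measurable_bounded_integrable; [|exact: finI| |exact: bounded_cst].
rewrite Rintegral_cst// [X in _ * fine X](lebesgue_measure_itv `[a ord0 i, b ord0 i])/=.
by rewrite lte_fin hab.
Qed.

Lemma box_insert i (w : 'rV[R]_#|~: [set i]|) t :
  S (rV_insert w t) <-> box (rV_proj (~: [set i]) a) (rV_proj (~: [set i]) b) w /\ a ord0 i <= t <= b ord0 i.
Proof.
rewrite !boxE cyl_insert /= in_itv/=; split=> -[h1 h2]; split => // k; have := h1 k;
  by rewrite /= !mxE.
Qed.

Lemma box_proj (J : {set 'I_d}) x : S x -> box (rV_proj J a) (rV_proj J b) (rV_proj J x).
Proof. by move=> Sx k; rewrite !mxE; exact: Sx. Qed.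

(** By Fubini, almost every line of direction [i] meets the exceptional set in a null
    set. *)
Lemma avg_ae i f g : measurable_fun setT f -> measurable_fun setT g ->
  {ae leb, forall x, S x -> f x = g x} ->
  {ae leb, forall x, S x -> avg a b i f x = avg a b i g x}.
Proof.
move=> mf mg /(insert_ae i) fg.
suff /ae_proj : {ae @lebesgue_rV R #|~: [set i]|, forall w,
  box (rV_proj (~: [set i]) a) (rV_proj (~: [set i]) b) w ->
  \int[lebesgue_measure]_(t in `[a ord0 i, b ord0 i]) f (rV_insert w t) =
  \int[lebesgue_measure]_(t in `[a ord0 i, b ord0 i]) g (rV_insert w t)}.
  by apply: filterS => x h Sx; rewrite /avg h//; exact: box_proj.
apply: filterS fg => w fgw wS; congr fine.
have ms (h : 'rV[R]_d -> R) : measurable_fun setT h ->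
    measurable_fun (`[a ord0 i, b ord0 i]%classic : set R) (EFin \o (fun t => h (rV_insert w t))).
  move=> mh; apply/measurable_EFinP; apply: measurable_funTS.
  exact: (measurableT_comp mh (measurable_insert w)).
apply: ae_eq_integral => //; [exact: ms|exact: ms|].
case: fgw => N [mN N0 fgN]; exists N; split => // t /= ft; apply: fgN => /= fgt; apply: ft.
by rewrite in_itv/= => tab; congr EFin; apply: fgt; apply/box_insert.
Qed.

Definition set_coord i (u : 'rV[R]_d) (s : R) : 'rV[R]_d :=
  \row_j if j == i then s else u ord0 j.

Lemma hbox_insert i (u v : 'rV[R]_d) (w : 'rV[R]_#|~: [set i]|) t :
  hbox u v (rV_insert w t) <->
  cyl (fun k => `[u ord0 (enum_val k), v ord0 (enum_val k)[%classic) w /\ u ord0 i <= t < v ord0 i.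
Proof. by rewrite /hbox cyl_insert /= in_itv. Qed.

Lemma integrable_hbox f (B : R) (u v : 'rV[R]_d) : measurable_fun setT f -> (forall x, `|f x| <= B) ->
  (forall j, u ord0 j <= v ord0 j) -> leb.-integrable (hbox u v) (EFin \o f).
Proof.
move=> mf fB uv; apply: (bounded_integrable (C := B)) => //.
- exact: measurable_hbox.
- by rewrite lebesgue_hbox// ltry.
- exact: measurable_funTS.
Qed.

(** Integrating an average in direction [i] over a box amounts, by Fubini, to integrating
    the function itself over the box stretched to full width in direction [i], up to the
    ratio of the two widths. *)
Lemma avg_integral i f (B : R) (u v : 'rV[R]_d) :
  measurable_fun setT f -> (forall x, `|f x| <= B) ->
  (forall j, u ord0 j <= v ord0 j) ->
  (\int[leb]_(x in hbox u v) (avg a b i f x)%:E =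
   ((v ord0 i - u ord0 i) / (b ord0 i - a ord0 i))%:E *
   \int[leb]_(x in hbox (set_coord i u (a ord0 i)) (set_coord i v (b ord0 i))) (f x)%:E)%E.
Proof.
move=> mf fB uv.
set u' := set_coord _ u _; set v' := set_coord _ v _.
have uv' j : u' ord0 j <= v' ord0 j by rewrite !mxE; case: ifP => // _; exact: ltW.
have i1 := integrable_hbox (measurable_avg i mf) (avg_le _ mf fB) uv.
have i2 := integrable_hbox mf fB uv'.
have m1 := measurable_hbox u v; have m2 := measurable_hbox u' v'.
have i1' := (integrable_mkcond _ m1).1 i1; have i2' := (integrable_mkcond _ m2).1 i2.
rewrite !(integral_mkcond (hbox _ _)) !(insert_fubini i)//.
rewrite -integralZl//; last exact: insert_integrable.
apply: eq_integral => w _.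
have CE : cyl (fun k => `[u' ord0 (enum_val k), v' ord0 (enum_val k)[%classic) w <->
    cyl (fun k => `[u ord0 (enum_val k), v ord0 (enum_val k)[%classic) w.
  have e (k : 'I_#|~: [set i]|) : (enum_val k == i) = false.
    by apply/negbTE; have := enum_valP k; rewrite !inE.
  by split=> h k; have := h k; rewrite /= !mxE e.
have [wC|wC] := pselect (cyl (fun k => `[u ord0 (enum_val k), v ord0 (enum_val k)[%classic) w); last first.
  rewrite !integral0_eq ?mule0// => t _; rewrite patchE memNset// hbox_insert => -[] //.
  by move/CE.
set K := (b ord0 i - a ord0 i)^-1 *
  (\int[lebesgue_measure]_(s in `[a ord0 i, b ord0 i]) f (rV_insert w s)).
transitivity (\int[lebesgue_measure]_(t in (`[u ord0 i, v ord0 i[%classic : set R)) K%:E)%E.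
  rewrite [RHS]integral_mkcond; apply: eq_integral => t _.
  rewrite !patchE; congr (if _ then _ else _).
    by apply/idP/idP; rewrite !inE hbox_insert /= in_itv/=; [case|].
  by rewrite /= /avg rV_insert_proj.
have -> : (\int[lebesgue_measure]_t (((fun x => (f x)%:E) \_ (hbox u' v')) (rV_insert w t)) =
    \int[lebesgue_measure]_(t in (`[a ord0 i, b ord0 i[%classic : set R)) (f (rV_insert w t))%:E)%E.
  rewrite [RHS]integral_mkcond; apply: eq_integral => t _.
  rewrite !patchE; congr (if _ then _ else _).
  apply/idP/idP; rewrite !inE hbox_insert /= in_itv/= !mxE eqxx; [by case|].
  by move=> ?; split => //; apply/CE.
have ib := integrable_slice w mf fB.
have -> : (\int[lebesgue_measure]_(t in `[a ord0 i, b ord0 i[) (f (rV_insert w t))%:E =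
    (\int[lebesgue_measure]_(t in `[a ord0 i, b ord0 i]) f (rV_insert w t))%:E)%E.
  rewrite /Rintegral fineK; last exact: integrable_fin_num.
  apply: integral_itv_bndo_bndc.
  apply/measurable_EFinP; apply: measurable_funTS.
  exact: (measurableT_comp mf (measurable_insert w)).
rewrite integral_cst//= lebesgue_measure_itv/= lte_fin -!EFinB /K.
set G := Rintegral _ _ _.
case: ltP => vu; rewrite -?EFinM ?mule0; congr (_%:E); first by ring.
have -> : v ord0 i = u ord0 i by apply/eqP; rewrite eq_le vu uv.
by rewrite subrr !mul0r mulr0.
Qed.

(** For [i = j] the box is already full in direction [j], and [avg_integral] says that
    [f] and its average have the same integral over it. For [i <> j] the stretched box
    remains full in direction [i], and both integrals vanish. *)
Lemma slab_mean0_avg i j f (B : R) : measurable_fun setT f -> (forall x, `|f x| <= B) ->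
  (i != j -> slab_mean0 a b i f) -> slab_mean0 a b i (fun x => f x - avg a b j f x).
Proof.
move=> mf fB f0 u v auv vb ui vi.
have uv k : u ord0 k <= v ord0 k by have /andP[] := auv k.
under eq_integral do rewrite EFinB.
rewrite integralB//; last 3 first.
- exact: measurable_hbox.
- exact: integrable_hbox mf fB uv.
- exact: integrable_hbox (measurable_avg j mf) (avg_le _ mf fB) uv.
rewrite (avg_integral _ mf fB)//.
have [ij|ij] := eqVneq i j.
  rewrite -ij ui vi divff ?gt_eqF// mul1e.
  have -> : set_coord i u (a ord0 i) = u.
    by apply/rowP => k; rewrite mxE; case: eqP => [->|].
  have -> : set_coord i v (b ord0 i) = v.
    by apply/rowP => k; rewrite mxE; case: eqP => [->|].
  rewrite subee//; apply: integrable_fin_num; first exact: measurable_hbox.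
  exact: integrable_hbox mf fB uv.
rewrite (f0 ij u v)// (f0 ij _ (set_coord j v (b ord0 j))) ?mule0 ?sube0//.
- move=> k; rewrite !mxE; case: eqP => [->|_//]; by rewrite lexx ltW.
- by move=> k; rewrite !mxE; case: eqP => [->|_//].
- by rewrite mxE (negbTE ij).
- by rewrite mxE (negbTE ij).
Qed.

(** [calP] for an arbitrary list of directions, as needed for induction. *)
Definition centering (s : seq 'I_d) phi : 'rV[R]_d -> R :=
  foldr (fun i psi w => psi w - avg a b i psi w) phi s.

Lemma centering_bounded_mean0 s f (B : R) : measurable_fun setT f -> (forall x, `|f x| <= B) ->
  measurable_fun setT (centering s f) /\ exists C : R, (forall x, `|centering s f x| <= C) /\
  forall i, i \in s -> slab_mean0 a b i (centering s f).
Proof.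
move=> mf fB; elim: s => [|j s [mP [C [PC P0]]]]; first by split => //; exists B.
split; first by apply: measurable_funB => //; exact: measurable_avg.
exists (C + C); split.
  by move=> x; apply: le_trans (ler_normB _ _) _; apply: lerD; [exact: PC|exact: (avg_le j mP PC)].
move=> i; rewrite inE => /orP ijs; apply: (slab_mean0_avg mP PC) => ij.
by apply: P0; case: ijs => // /eqP ij'; rewrite ij' eqxx in ij.
Qed.

Lemma measurable_centering s f : measurable_fun setT f -> measurable_fun setT (centering s f).
Proof.
move=> mf; elim: s => [//|j s mP].
by apply: measurable_funB => //; exact: measurable_avg.
Qed.

Lemma centering_ae s f g : measurable_fun setT f -> measurable_fun setT g ->
  {ae leb, forall x, S x -> f x = g x} -> {ae leb, forall x, S x -> centering s f x = centering s g x}.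
Proof.
move=> mf mg fg; elim: s => [//|j s IH].
have := avg_ae j (measurable_centering s mf) (measurable_centering s mg) IH.
by apply: filterS2 IH => x h1 h2 Sx; rewrite /centering/= -!/(centering s _) h1// h2.
Qed.

End averaging_facts.

(** * Envelopes as bounds over slabs *)

Lemma ae_mrestr d (T : measurableType d) (R : realType)
    (mu : {measure set T -> \bar R}) (D : set T) (mD : measurable D) (P : T -> Prop) :
  {ae mrestr mu mD, forall x, P x} <-> {ae mu, forall x, D x -> P x}.
Proof.
split=> -[N [mN N0 PN]].
  exists (N `&` D); split => //; first exact: measurableI.
  by move=> x /= /not_implyP[Dx nP]; split => //; exact: PN.
exists (N `|` ~` D); split.
- by apply: measurableU => //; exact: measurableC.
- rewrite /= /mrestr setIUl setICl setU0; apply: subset_measure0 N0 => //.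
  exact: measurableI.
- move=> x /= nP; have [Dx|nDx] := pselect (D x); last by right.
  by left; apply: PN => /= /(_ Dx).
Qed.

Section slice_sup.
Local Open Scope ereal_scope.
Context d d1 d2 (T : measurableType d) (X : measurableType d1)
  (Y : measurableType d2) (R : realType).
Variables (mu : {measure set T -> \bar R})
  (m1 : {sigma_finite_measure set X -> \bar R})
  (m2 : {sigma_finite_measure set Y -> \bar R}) (g : X * Y -> T).
Hypothesis mg : measurable_fun setT g.
Hypothesis pg : forall A, measurable A -> mu A = (m1 \x m2) (g @^-1` A).
Variables (D1 : set X) (D2 : set Y).
Hypotheses (mD1 : measurable D1) (mD2 : measurable D2).

(** The common form of the two envelopes: [g] splits off the coordinates over which one
    integrates, and [D1], [D2] are the corresponding factors of the box. *)
Let slice_sup (f : T -> R) : \bar R :=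
  ess_sup (mrestr m1 mD1) (fun w => \int[m2]_(t in D2) `|f (g (w, t))|%:E).

Let measurable_slice (f : T -> R) w : measurable_fun setT f ->
  measurable_fun D2 (fun t => `|f (g (w, t))|%:E).
Proof.
move=> mf; apply/measurable_EFinP; apply: measurable_funTS.
apply: measurableT_comp => //; apply: (measurableT_comp mf).
exact: (measurableT_comp mg (pair1_measurable w)).
Qed.

Lemma eq_slice_sup (D : set T) (f f' : T -> R) :
  measurable_fun setT f -> measurable_fun setT f' ->
  (forall w t, D1 w -> D2 t -> D (g (w, t))) ->
  {ae mu, forall x, D x -> f x = f' x} -> slice_sup f = slice_sup f'.
Proof.
move=> mf mf' gD /(split_ae mg pg) ff'; apply: eq_ess_sup; apply/ae_mrestr.
apply: filterS ff' => w fw D1w.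
apply: ae_eq_integral => //; [exact: measurable_slice|exact: measurable_slice|].
case: fw => N [mN N0 fN]; exists N; split => // t /= ft; apply: fN => /= fgt; apply: ft.
by move=> D2t; congr (`| _ |%:E); apply: fgt; exact: gD.
Qed.

(** By Tonelli, almost every slice contributes at most the essential supremum to the
    integral over [A]. The supremum is finite because [f] is bounded and [D2] has finite
    measure, and nonnegative because [D1] is not a null set. *)
Lemma slice_sup_bound (f : T -> R) (C : R) : measurable_fun setT f ->
  (forall x, `|f x| <= C)%R -> 0 < m1 D1 -> m2 D2 < +oo ->
  exists M : R, [/\ (0 <= M)%R, slice_sup f = M%:E &
  forall A E, measurable A -> measurable E -> E `<=` D1 ->
    (forall w t, A (g (w, t)) -> E w /\ D2 t) ->
    \int[mu]_(x in A) `|f x|%:E <= M%:E * m1 E].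
Proof.
move=> mf fC D10 D2oo.
have sup0 : 0 <= slice_sup f.
  apply: ess_sup_gee; first by rewrite /= /mrestr setTI.
  by apply: nearW => w; apply: integral_ge0 => t _; rewrite lee_fin.
have supoo : slice_sup f < +oo.
  apply: (@le_lt_trans _ _ (`|C|%:E * m2 D2)).
    apply/ess_supP; apply: nearW => w; rewrite -integral_cst//.
    apply: ge0_le_integral => //; [exact: measurable_slice|].
    by move=> t _; rewrite lee_fin; apply: le_trans (fC _) (ler_norm _).
  by rewrite lte_mul_pinfty ?lee_fin// ge0_fin_numE.
have supfin : slice_sup f \is a fin_num by rewrite ge0_fin_numE.
exists (fine (slice_sup f)); split; [exact: fine_ge0|by rewrite fineK|].
move=> A E mA mE ED AE; rewrite fineK//.
have mfA : measurable_fun setT ((fun x => `|f x|%:E) \_ A).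
  apply/(measurable_restrictT _ _).1 => //.
  by apply/measurable_EFinP; apply: measurable_funTS; exact: measurableT_comp.
have fA0 x : 0 <= ((fun x => `|f x|%:E) \_ A) x.
  by rewrite patchE; case: ifP => // _; rewrite lee_fin.
rewrite integral_mkcond (split_tonelli mg pg)//.
apply: (@le_trans _ _ (\int[m1]_w (slice_sup f * (\1_E w)%:E))); last first.
  rewrite ge0_integralZl//; first by rewrite integral_indic// setIT.
  by apply/measurable_EFinP; exact: measurable_indic.
apply: ae_ge0_le_integral => //.
- by move=> w _; apply: integral_ge0.
- apply: (@measurable_fun_fubini_tonelli_F _ _ _ _ _ m2 (fun z => ((fun x => `|f x|%:E) \_ A) (g z))) => //.
  exact: (measurableT_comp mfA).
- by move=> w _; rewrite mule_ge0// lee_fin.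
- apply: measurable_funeM; apply/measurable_EFinP; exact: measurable_indic.
have /ae_mrestr := ess_sup_ge (mrestr m1 mD1) (fun w => \int[m2]_(t in D2) `|f (g (w, t))|%:E).
apply: filterS => w fw _.
have [Ew|nEw] := pselect (E w); last first.
  rewrite indicE memNset// mule0 integral0_eq// => t _.
  by rewrite patchE memNset// => /AE[].
rewrite indicE mem_set// mule1; apply: le_trans (fw (ED _ Ew)).
rewrite [leRHS]integral_mkcond; apply: ge0_le_integral => //.
- exact: (measurableT_comp mfA (measurableT_comp mg (pair1_measurable w))).
- by apply/(measurable_restrictT _ _).1 => //; exact: measurable_slice.
- move=> t _; rewrite !patchE; case: ifPn => [|_]; last by case: ifP => // _; rewrite lee_fin.
  by rewrite inE => /AE[_ D2t]; rewrite mem_set.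
Qed.

End slice_sup.

Section envelopes.
Context {R : realType} {d : nat}.
Variables (a b : 'rV[R]_d).
Hypothesis hab : forall i, a ord0 i < b ord0 i.
Local Notation leb := (@lebesgue_rV R d).
Local Notation S := (box a b).
Local Open Scope ereal_scope.

Lemma lebesgue_box_gt0 n (u v : 'rV[R]_n) : (forall j, u ord0 j < v ord0 j)%R ->
  0 < lebesgue_rV n (box u v).
Proof.
move=> uv; rewrite boxE lebesgue_rV_cyl//.
rewrite (eq_bigr (fun j => (v ord0 j - u ord0 j)%:E)).
  by rewrite prodEFin lte_fin; apply: prodr_gt0 => j _; rewrite subr_gt0.
by move=> j _; rewrite lebesgue_measure_itv/= lte_fin uv.
Qed.

Lemma proj_lt (J : {set 'I_d}) k : (rV_proj J a ord0 k < rV_proj J b ord0 k)%R.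
Proof. by rewrite !mxE. Qed.

Lemma box_glue (J : {set 'I_d}) (w : 'rV[R]_#|~: J|) t :
  S (rV_glue w t) <-> box (rV_proj (~: J) a) (rV_proj (~: J) b) w /\
    box (rV_proj J a) (rV_proj J b) t.
Proof.
rewrite !boxE cyl_glue; split=> -[h1 h2]; split => k.
- by have := h1 k; rewrite !mxE.
- by have := h2 k; rewrite !mxE.
- by have := h1 k; rewrite !mxE.
- by have := h2 k; rewrite !mxE.
Qed.

Lemma eq_Lambda_mix J f f' : measurable_fun setT f -> measurable_fun setT f' ->
  {ae leb, forall x, S x -> f x = f' x} -> Lambda_mix a b J f = Lambda_mix a b J f'.
Proof.
move=> mf mf' ff'.
apply: (@eq_slice_sup _ _ _ _ _ _ R leb (lebesgue_rV #|~: J|) (lebesgue_rV #|J|)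
  (fun z => rV_glue z.1 z.2) (@measurable_rV_glue R d J) (@lebesgue_rV_glue R d J)
  _ _ (measurable_box _ _) (measurable_box _ _) S) => //.
by move=> w t w1 t1; exact/box_glue.
Qed.

Lemma lebesgue_hbox_proj (J : {set 'I_d}) (u v : 'rV[R]_d) :
  (forall j, u ord0 j <= v ord0 j)%R ->
  lebesgue_rV #|J| (hbox (rV_proj J u) (rV_proj J v)) =
  (\prod_(j in J) (v ord0 j - u ord0 j))%:E.
Proof.
move=> uv; rewrite lebesgue_hbox; last by move=> j; rewrite !mxE.
rewrite [in RHS]big_enum_val; congr (_%:E); apply: eq_bigr => k _; by rewrite !mxE.
Qed.

Lemma hbox_sub_box (J : {set 'I_d}) (u v : 'rV[R]_d) :
  (forall j, a ord0 j <= u ord0 j <= v ord0 j)%R ->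
  (forall j, v ord0 j <= b ord0 j)%R ->
  hbox (rV_proj J u) (rV_proj J v) `<=` box (rV_proj J a) (rV_proj J b).
Proof.
move=> auv vb x xuv k; have /= := xuv k; rewrite in_itv/= !mxE => /andP[ux xv].
have /andP[au _] := auv (enum_val k).
by rewrite (le_trans au ux) (le_trans (ltW xv) (vb _)).
Qed.

Lemma Lambda_mix_slab J (f : 'rV[R]_d -> R) (C : R) : measurable_fun setT f ->
  (forall x, `|f x| <= C)%R ->
  exists M : R, [/\ (0 <= M)%R, Lambda_mix a b J f = M%:E & slab_bound a b J f M].
Proof.
move=> mf fC.
have [||M [M0 LM slab]] := @slice_sup_bound _ _ _ _ _ _ R leb (lebesgue_rV #|~: J|) (lebesgue_rV #|J|)
  (fun z => rV_glue z.1 z.2) (@measurable_rV_glue R d J) (@lebesgue_rV_glue R d J)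
  _ _ (measurable_box (rV_proj (~: J) a) (rV_proj (~: J) b))
  (measurable_box (rV_proj J a) (rV_proj J b)) f C mf fC.
- by apply: lebesgue_box_gt0; exact: proj_lt.
- exact: lebesgue_box_lty.
exists M; split => // u v auv vb _.
have uv j : (u ord0 j <= v ord0 j)%R by have /andP[] := auv j.
rewrite EFinM -lebesgue_hbox_proj//; apply: slab.
- exact: measurable_hbox.
- exact: measurable_hbox.
- exact: hbox_sub_box.
- move=> w t /= /cyl_glue[h1 h2]; split.
    by move=> k; have := h1 k; rewrite !mxE.
  by apply: (hbox_sub_box auv vb) => k; have := h2 k; rewrite !mxE.
Qed.

(** The [i]-th term of the maximum defining [Lambda_sl]. *)
Definition slice_norm i (f : 'rV[R]_d -> R) : \bar R :=
  ess_sup (mrestr (@lebesgue_rV R #|~: [set i]|)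
    (measurable_box (rV_proj (~: [set i]) a) (rV_proj (~: [set i]) b)))
  (fun w => \int[lebesgue_measure]_(t in `[a ord0 i, b ord0 i]) `|f (rV_insert w t)|%:E).

Lemma eq_slice_norm i f f' : measurable_fun setT f -> measurable_fun setT f' ->
  {ae leb, forall x, S x -> f x = f' x} -> slice_norm i f = slice_norm i f'.
Proof.
move=> mf mf' ff'.
apply: (@eq_slice_sup _ _ _ _ _ _ R leb (lebesgue_rV #|~: [set i]|) lebesgue_measure
  (fun z => rV_insert z.1 z.2) (@measurable_rV_insert R d i) (@lebesgue_rV_insert R d i)
  _ _ (measurable_box _ _) (measurable_itv `[a ord0 i, b ord0 i]) S) => //.
by move=> w t w1 t1; exact/box_insert.
Qed.

Lemma slice_norm_slab i (f : 'rV[R]_d -> R) (C : R) : measurable_fun setT f ->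
  (forall x, `|f x| <= C)%R ->
  exists M : R, [/\ (0 <= M)%R, slice_norm i f = M%:E & slab_bound a b [set i] f M].
Proof.
move=> mf fC.
have [||M [M0 LM slab]] := @slice_sup_bound _ _ _ _ _ _ R leb (lebesgue_rV #|~: [set i]|) lebesgue_measure
  (fun z => rV_insert z.1 z.2) (@measurable_rV_insert R d i) (@lebesgue_rV_insert R d i)
  _ _ (measurable_box (rV_proj (~: [set i]) a) (rV_proj (~: [set i]) b))
  (measurable_itv `[a ord0 i, b ord0 i]) f C mf fC.
- by apply: lebesgue_box_gt0; exact: proj_lt.
- by rewrite /= lebesgue_measure_itv/=; case: ifP => _; rewrite ltry.
exists M; split => // u v auv vb ui.
have uv j : (u ord0 j <= v ord0 j)%R by have /andP[] := auv j.
rewrite EFinM -lebesgue_hbox_proj//; apply: slab.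
- exact: measurable_hbox.
- exact: measurable_hbox.
- exact: hbox_sub_box.
- move=> w t /= /hbox_insert[h1]; have [|-> ->] := ui i; first by rewrite inE.
  rewrite in_itv/= => /andP[-> /ltW ->]; split => //.
  by move=> k; have := h1 k; rewrite !mxE.
Qed.

End envelopes.

(** * Variation of the density *)

Section charge_bound.
Local Open Scope ereal_scope.
Context d (T : measurableType d) (R : realType) (nu : {charge set T -> \bar R}).

Lemma charge_total_variation_ge0 U : 0 <= charge_total_variation nu U.
Proof. by rewrite /charge_total_variation /charge_variation adde_ge0. Qed.

Lemma charge_integral_le U (f : T -> R) (C : R) : measurable U ->
  measurable_fun U f -> (0 <= C)%R -> (forall x, U x -> `|f x| <= C)%R ->
  `|charge_integral nu U f| <= C%:E * charge_total_variation nu U.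
Proof.
move=> mU mf C0 fC.
have bound (m : {measure set T -> \bar R}) :
    `|\int[m]_(x in U) (f x)%:E| <= C%:E * m U.
  rewrite -integral_cst//; apply: le_trans (le_abse_integral _ _ _) _ => //.
    exact/measurable_EFinP.
  apply: ge0_le_integral => //.
  by apply: measurableT_comp => //; exact/measurable_EFinP.
apply: le_trans (lee_abs_sub _ _) _.
rewrite /charge_total_variation /charge_variation ge0_muleDr//.
by apply: leeD; exact: bound.
Qed.

End charge_bound.

(** When [c = 0] the right-hand side is 0 whatever the infimum, and an element of [A]
    is what shows [x <= 0]. *)
Lemma le_mul_ereal_inf (R : realType) (A : set (\bar R)) (x : \bar R) (c : R) :
  0 <= c -> A !=set0 -> (forall V, A V -> x <= c%:E * V)%E ->
  (x <= c%:E * ereal_inf A)%E.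
Proof.
move=> c0 [V0 AV0] xA; have [c1|c1] := ltP 0 c; last first.
  have -> : c = 0 by apply/eqP; rewrite eq_le c1 c0.
  rewrite mul0e; apply: le_trans (xA _ AV0) _.
  by have -> : c = 0 by [apply/eqP; rewrite eq_le c1 c0]; rewrite mul0e.
rewrite -[c]invrK lee_pdivlMl ?invr_gt0//.
apply: le_ereal_inf_tmp => V AV.
by rewrite -lee_pdivlMl ?invr_gt0// invrK; exact: xA.
Qed.

Section distribution_bounds.
Context {R : realType} {d : nat}.
Variables (a b : 'rV[R]_d).
Hypothesis hab : forall i, a ord0 i < b ord0 i.
Local Notation leb := (@lebesgue_rV R d).
Local Notation S := (box a b).
Local Open Scope ereal_scope.

(** The test function is supported in the interior of the box, where [h] and [p] agree,
    so it can be tested against the derivative of [h] on the larger set [U]. For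
    functions of bounded variation [U] is the interior of the box, for extensions it is
    the whole space. *)
Lemma test_bound_distr (J : {set 'I_d}) (U : set 'rV[R]_d) (h p : 'rV[R]_d -> R)
    (nu : {charge set 'rV[R]_d -> \bar R}) :
  open U -> S° `<=` U -> leb.-integrable U (EFin \o h) ->
  leb.-integrable S° (EFin \o p) ->
  {ae leb, forall x, S° x -> h x = p x} ->
  distr_deriv_is U J h nu ->
  test_bound a b J p (charge_total_variation nu U).
Proof.
move=> oU SU ih ip hp hnu Z a' b' C dZ ab' Z0 ZC.
have [cZ _] := dZ.
set al := foldr incr (fun=> 0%N) (enum J).
have sK : box a' b' `<=` S°.
  rewrite interior_box => x xK j /=; rewrite in_itv/=; have [h1 h2] := ab' j.
  by have /andP[h3 h4] := xK j; rewrite (lt_le_trans h1 h3) (le_lt_trans h4 h2).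
have Zal0 (x : 'rV[R]_d) : ~ box a' b' x -> Z al x = 0%R.
  rewrite /al; elim: (enum J) x => [|i s IH] x /=; first exact: Z0.
  exact: (dfamily_support _ dZ IH).
have mZ be (A : set 'rV[R]_d) : measurable_fun A (Z be).
  apply: measurable_funTS; apply: continuous_measurable_rV; first exact: openT.
  by move=> x _; exact: cZ.
have tZ : test_function U (Z (fun=> 0%N)).
  have [t1 t2 t3] := dfamily_test dZ ab' Z0; split => //.
  exact: subset_trans t3 SU.
have mp : measurable_fun S° p by case/integrableP : ip => /measurable_EFinP.
have mh : measurable_fun U h by case/integrableP : ih => /measurable_EFinP.
have mU := open_measurable_rV oU.
have mS := @measurable_interior R d S.
have -> : \int[leb]_(x in S°) (p x * Z al x)%:E = \int[leb]_(x in U) (h x * Z al x)%:E.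
  transitivity (\int[leb]_(x in S°) (h x * Z al x)%:E).
    apply: ae_eq_integral => //.
    - by apply/measurable_EFinP; exact: measurable_funM.
    - by apply/measurable_EFinP; apply: measurable_funM => //; exact: measurable_funS mh.
    - by apply: filterS hp => x hx Sx; rewrite hx.
  rewrite integral_mkcond [RHS]integral_mkcond; apply: eq_integral => x _.
  rewrite !patchE; case: ifPn => [|]; rewrite ?inE ?notin_setE => Sx.
    by rewrite mem_set//; exact: SU.
  by case: ifP => // _; rewrite Zal0 ?mulr0// => /sK.
have -> : `|\int[leb]_(x in U) (h x * Z al x)%:E| = `|charge_integral nu U (Z (fun=> 0%N))|.
  rewrite hnu// abseM /= normrX normrN1 expr1n mul1e.
  by rewrite /partials dfamily_partials.
apply: charge_integral_le => //.
exact: le_trans (normr_ge0 _) (ZC 0%R).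
Qed.

Lemma test_bound_deriv (J : {set 'I_d}) (p : 'rV[R]_d -> R) :
  C_upto #|J| S p ->
  test_bound a b J p (\int[leb]_(x in S°) `|partials J p x|%:E).
Proof.
move=> cp Z a' b' C dZ ab' Z0 ZC.
by apply: (@ibp_le R d a b a' b') => //; rewrite -cardE.
Qed.

End distribution_bounds.

(** * The bounds on the expectation *)

Section bounded_parts.
Context {R : realType} {d : nat}.
Variables (a b : 'rV[R]_d).
Hypothesis hab : forall i, a ord0 i < b ord0 i.
Local Notation leb := (@lebesgue_rV R d).
Local Notation S := (box a b).
Local Open Scope ereal_scope.

Lemma ae_le_Linfty (f : 'rV[R]_d -> R) :
  {ae leb, forall x, S x -> `|f x|%:E <= Linfty_norm a b f}.
Proof.
apply/(@ae_mrestr _ _ _ leb S (measurable_box a b)).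
rewrite /Linfty_norm unlock ifT; first exact: (ess_sup_ge _ (abse \o (EFin \o f))).
by rewrite /= /mrestr setTI; exact: lebesgue_box_gt0.
Qed.

Lemma Linfty_norm_ge0 (f : 'rV[R]_d -> R) : 0 <= Linfty_norm a b f.
Proof. exact: Lnorm_ge0. Qed.

(** Truncation at the level of the essential supremum. *)
Lemma ex_bounded_version (f : 'rV[R]_d -> R) : measurable_fun setT f ->
  Linfty_norm a b f < +oo -> exists g : 'rV[R]_d -> R, exists B : R,
  [/\ measurable_fun setT g, (forall x, `|g x| <= B)%R &
      {ae leb, forall x, S x -> f x = g x}].
Proof.
move=> mf foo; have f0 := Linfty_norm_ge0 f.
have ffin : Linfty_norm a b f \is a fin_num by rewrite ge0_fin_numE.
pose B := fine (Linfty_norm a b f).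
exists (fun x => if (`|f x| <= B)%R then f x else 0%R), B; split.
- apply: measurable_fun_ifT => //; apply: measurable_fun_ler => //.
  exact: measurableT_comp.
- by move=> x; case: ifP => //; rewrite normr0 fine_ge0.
- apply: filterS (ae_le_Linfty f) => x fx Sx; rewrite ifT//.
  by rewrite -lee_fin fineK//; exact: fx.
Qed.

Lemma integrable_bounded_mul (f g p : 'rV[R]_d -> R) (B : R) :
  measurable_fun setT f -> measurable_fun setT g -> (forall x, `|g x| <= B)%R ->
  {ae leb, forall x, S x -> f x = g x} ->
  leb.-integrable S (EFin \o p) ->
  leb.-integrable S (fun x => (f x * p x)%:E).
Proof.
move=> mf mg gB fg ip.
have mS := measurable_box a b.
have mp : measurable_fun S p by case/integrableP : ip => /measurable_EFinP.
have mgp : measurable_fun S (fun x => (g x * p x)%:E).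
  by apply/measurable_EFinP; apply: measurable_funM => //; exact: measurable_funTS.
have mfp : measurable_fun S (fun x => (f x * p x)%:E).
  by apply/measurable_EFinP; apply: measurable_funM => //; exact: measurable_funTS.
have /integrableP[_ goo] : leb.-integrable S (fun x => (g x * p x)%:E).
  apply: (@le_integrable _ _ _ _ _ mS _ (fun x => B%:E * (EFin \o p) x)) => //.
    move=> x _; rewrite /= lee_fin !normrM ler_wpM2r//.
    exact: le_trans (gB _) (ler_norm _).
  exact: integrableZl.
apply/integrableP; split=> //; apply: le_lt_trans goo.
rewrite (ae_eq_integral (fun x => `|(g x * p x)%:E|))//; [exact: measurableT_comp..|].
by apply: filterS fg => x fx Sx; rewrite fx.
Qed.

Lemma ae_bound_integral (f p : 'rV[R]_d -> R) (N : \bar R) :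
  measurable_fun setT f -> leb.-integrable S (EFin \o p) ->
  (forall x, 0 <= p x)%R -> 0 <= N ->
  {ae leb, forall x, S x -> `|f x|%:E <= N} ->
  `|\int[leb]_(x in S) (f x * p x)%:E| <= \int[leb]_(x in S) (p x)%:E * N.
Proof.
move=> mf ip p0 N0 fN.
have mS := measurable_box a b.
have mp : measurable_fun S p by case/integrableP : ip => /measurable_EFinP.
have mfp : measurable_fun S (fun x => (f x * p x)%:E).
  by apply/measurable_EFinP; apply: measurable_funM => //; exact: measurable_funTS.
have mp' : measurable_fun S (fun x => (p x)%:E) by exact/measurable_EFinP.
apply: le_trans (le_abse_integral _ _ _) _ => //.
rewrite muleC -ge0_integralZl//; last by move=> x _; rewrite lee_fin.
apply: ae_ge0_le_integral => //.
- exact: measurableT_comp.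
- by move=> x _; rewrite mule_ge0// lee_fin.
- exact: measurable_funeM.
- apply: filterS fN => x fx Sx; rewrite abse_EFin normrM EFinM (ger0_norm (p0 x)).
  by rewrite lee_wpmul2r ?lee_fin// fx.
Qed.

End bounded_parts.

Section calP_pairing.
Context {R : realType} {d : nat}.
Variables (a b : 'rV[R]_d).
Hypothesis hab : forall i, a ord0 i < b ord0 i.
Local Notation leb := (@lebesgue_rV R d).
Local Notation S := (box a b).
Local Open Scope ereal_scope.
Variables (p phi : 'rV[R]_d -> R) (I : {set 'I_d}).
Hypotheses (p0 : forall x, (0 <= p x)%R) (ip : leb.-integrable S (EFin \o p)).
Hypotheses (mphi : measurable_fun setT phi) (phioo : Linfty_norm a b phi < +oo).

Local Notation X := (\int[leb]_(x in S) (calP a b I phi x * p x)%:E).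

Let measurable_calP : measurable_fun setT (calP a b I phi).
Proof. exact: measurable_centering. Qed.

(** Apply [calP] to a bounded version of [phi]: averages are unchanged almost everywhere
    on the box, and the result is bounded everywhere. *)
Lemma ex_bounded_calP : exists psi : 'rV[R]_d -> R, exists C : R,
  [/\ measurable_fun setT psi, (forall x, `|psi x| <= C)%R,
      (forall i, i \in I -> slab_mean0 a b i psi) &
      {ae leb, forall x, S x -> calP a b I phi x = psi x}].
Proof.
have [g [B [mg gB phig]]] := ex_bounded_version hab mphi phioo.
have [mpsi [C [psiC psi0]]] := centering_bounded_mean0 hab (enum I) mg gB.
exists (calP a b I g), C; split => //.
- by move=> i iI; apply: psi0; rewrite mem_enum.
- exact: centering_ae.
Qed.

Let integral_calP psi : measurable_fun setT psi ->
  {ae leb, forall x, S x -> calP a b I phi x = psi x} ->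
  X = \int[leb]_(x in S) (psi x * p x)%:E.
Proof.
move=> mpsi cpsi.
have mp : measurable_fun S p by case/integrableP : ip => /measurable_EFinP.
have mM (f : 'rV[R]_d -> R) : measurable_fun setT f ->
    measurable_fun S (fun x => (f x * p x)%:E).
  by move=> mf; apply/measurable_EFinP; apply: measurable_funM => //; exact: measurable_funTS.
apply: ae_eq_integral => //; [exact: measurable_box|exact: mM|exact: mM|].
by apply: filterS cpsi => x fx Sx; rewrite fx.
Qed.

Lemma calP_pairing_mix (V : \bar R) : test_bound a b I p V ->
  `|X| <= (2 ^- #|I|)%:E * Lambda_mix a b I (calP a b I phi) * V.
Proof.
move=> tb; have [psi [C [mpsi psiC psi0 cpsi]]] := ex_bounded_calP.
have [M [M0 LM slab]] := Lambda_mix_slab hab I mpsi psiC.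
rewrite (eq_Lambda_mix I measurable_calP mpsi cpsi) LM -EFinM -exprVn.
rewrite (integral_calP mpsi cpsi).
exact: mean_zero_pairing_bound tb mpsi psiC psi0 slab.
Qed.

Lemma Lambda_mix_fin : exists2 M : R, (0 <= M)%R & Lambda_mix a b I (calP a b I phi) = M%:E.
Proof.
have [psi [C [mpsi psiC psi0 cpsi]]] := ex_bounded_calP.
have [M [M0 LM slab]] := Lambda_mix_slab hab I mpsi psiC.
by exists M => //; rewrite (eq_Lambda_mix I measurable_calP mpsi cpsi).
Qed.

Lemma Lambda_sl_fin : I != finset.set0 ->
  exists2 l : R, (0 <= l)%R & Lambda_sl a b I (calP a b I phi) = l%:E.
Proof.
have [psi [C [mpsi psiC psi0 cpsi]]] := ex_bounded_calP.
have fin i : exists2 M : R, (0 <= M)%R & slice_norm a b i (calP a b I phi) = M%:E.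
  have [M [M0 LM _]] := slice_norm_slab hab i mpsi psiC.
  by exists M => //; rewrite (eq_slice_norm i measurable_calP mpsi cpsi).
case/set0Pn => i0 i0I.
have L0 : 0 <= Lambda_sl a b I (calP a b I phi).
  have [M M0 iM] := fin i0; apply: (@le_trans _ _ M%:E); rewrite ?lee_fin// -iM.
  exact: (le_bigmax_cond -oo (fun i => slice_norm a b i (calP a b I phi)) i0I).
have Loo : Lambda_sl a b I (calP a b I phi) < +oo.
  by apply: bigmax_lt => // i iI; have [M M0 iM] := fin i; rewrite [ltLHS]iM ltry.
by exists (fine (Lambda_sl a b I (calP a b I phi))); rewrite ?fine_ge0// fineK// ge0_fin_numE.
Qed.

Lemma calP_pairing_slice i (V : \bar R) : i \in I -> 0 <= V -> test_bound a b [set i] p V ->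
  `|X| <= (2^-1)%:E * Lambda_sl a b I (calP a b I phi) * V.
Proof.
move=> iI V0 tb; have [psi [C [mpsi psiC psi0 cpsi]]] := ex_bounded_calP.
have [M [M0 LM slab]] := slice_norm_slab hab i mpsi psiC.
have MX : M%:E <= Lambda_sl a b I (calP a b I phi).
  rewrite -LM -(eq_slice_norm i measurable_calP mpsi cpsi).
  exact: (le_bigmax_cond -oo (fun i => slice_norm a b i (calP a b I phi)) iI).
apply: (@le_trans _ _ ((2^-1 * M)%:E * V)); last first.
  by rewrite lee_wpmul2r// EFinM lee_wpmul2l// lee_fin.
rewrite (integral_calP mpsi cpsi).
have := mean_zero_pairing_bound hab ip tb mpsi psiC _ slab; rewrite finset.cards1 expr1; apply.
by move=> j; rewrite inE => /eqP ->; exact: psi0.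
Qed.

Lemma distr_deriv_mass_ge0 (U : set 'rV[R]_d) J (h : 'rV[R]_d -> R) :
  0 <= distr_deriv_mass U J h.
Proof.
by apply: le_ereal_inf_tmp => _ [nu _ <-]; exact: charge_total_variation_ge0.
Qed.

Lemma distr_mass_bound (J : {set 'I_d}) U (h : 'rV[R]_d -> R) (x : \bar R) (c : R) :
  open U -> S° `<=` U -> leb.-integrable U (EFin \o h) ->
  {ae leb, forall x, S° x -> h x = p x} ->
  (0 <= c)%R -> distr_deriv_measure U J h ->
  (forall V, 0 <= V -> test_bound a b J p V -> x <= c%:E * V) ->
  x <= c%:E * distr_deriv_mass U J h.
Proof.
move=> oU SU ih hp c0 [nu0 hnu0] xV; apply: le_mul_ereal_inf => //.
  by exists (charge_total_variation nu0 U), nu0.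
move=> _ [nu hnu <-]; apply: xV; first exact: charge_total_variation_ge0.
apply: (test_bound_distr oU SU ih _ hp hnu).
apply: integrableS ip; [exact: measurable_box|exact: measurable_interior|].
exact: interior_subset.
Qed.

Lemma Vext_bound (x : \bar R) (c : R) : (0 <= c)%R -> Vext S I p < +oo ->
  (forall V, 0 <= V -> test_bound a b I p V -> x <= c%:E * V) ->
  x <= c%:E * Vext S I p.
Proof.
move=> c0 Voo xV; apply: le_mul_ereal_inf => //.
  by apply/set0P; apply: contraTN Voo => /eqP E0; rewrite /Vext E0 ereal_inf0.
move=> _ [h [ih hp hm] <-].
apply: (distr_mass_bound openT _ ih) => //.
by apply: filterS hp => y hy Sy; apply: hy; exact: interior_subset Sy.
Qed.

(** For the first bound the estimates for the single directions [i \in I] are averaged;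
    for the third one the estimate holds for every extension of [p]. *)
Lemma calP_pairing_bounds : I != finset.set0 ->
  [/\ BV S p ->
      `|X| <= ((2 * #|I|%:R)^-1)%:E * Lambda_sl a b I (calP a b I phi) * TV S I p,
      C_upto #|I| S p ->
      `|X| <= (2 ^- #|I|)%:E * Lambda_mix a b I (calP a b I phi)
                * \int[leb]_(w in S°) `|partials I p w|%:E &
      Vext S I p < +oo ->
      `|X| <= (2 ^- #|I|)%:E * Lambda_mix a b I (calP a b I phi) * Vext S I p].
Proof.
move=> I0; have [M M0 LM] := Lambda_mix_fin.
split.
- move=> [_ hBV].
  set L := Lambda_sl a b I (calP a b I phi).
  have n0 : (0 < #|I|%:R :> R)%R by rewrite ltr0n finset.card_gt0.
  have [Lx L0 LE] : exists2 l : R, (0 <= l)%R & L = l%:E.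
    exact: Lambda_sl_fin.
  have slice i : i \in I -> `|X| <= (2^-1 * Lx)%:E * distr_deriv_mass S° [set i] p.
    move=> iI; apply: (distr_mass_bound (@open_interior _ S)) => //.
    + apply: integrableS ip; [exact: measurable_box|exact: measurable_interior|].
      exact: interior_subset.
    + exact: nearW.
    + by rewrite mulr_ge0.
    + by move=> V V0 tb; rewrite EFinM -LE; exact: (calP_pairing_slice iI).
  have -> : ((2 * #|I|%:R)^-1)%:E * L * TV S I p =
      (#|I|%:R^-1)%:E * ((2^-1 * Lx)%:E * TV S I p).
    by rewrite LE [RHS]muleA -!EFinM invfM [in RHS]mulrCA mulrA.
  have nE : (#|I|%:R)%:E = \sum_(i in I) 1 :> \bar R by rewrite sumEFin sumr_const.
  rewrite lee_pdivlMl// nE ge0_sume_distrl// ge0_sume_distrr.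
    by apply: lee_sum => i iI; rewrite mul1e; exact: slice.
  by move=> i _; exact: distr_deriv_mass_ge0.
- by move=> cp; apply: calP_pairing_mix; exact: test_bound_deriv.
- move=> Voo; rewrite LM -EFinM; apply: Vext_bound => //.
    by rewrite mulr_ge0// invr_ge0 exprn_ge0.
  by move=> V V0 tb; rewrite EFinM -LM; exact: calP_pairing_mix.
Qed.

End calP_pairing.

Local Open Scope ereal_scope.

Section expectation.
Context {R : realType} {d : nat}.
Variables (a b : 'rV[R]_d).
Hypothesis hab : forall i, (a ord0 i < b ord0 i)%R.
Local Notation leb := (@lebesgue_rV R d).
Local Notation S := (box a b).

(** On the box [phi = calP phi + calR phi], and both parts are integrable against [p]
    because they are essentially bounded. *)
Lemma expectation_bound (p phi : 'rV[R]_d -> R) (I : {set 'I_d}) :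
  (forall x, (0 <= p x)%R) -> leb.-integrable setT (EFin \o p) ->
  measurable_fun setT phi -> Linfty_norm a b phi < +oo ->
  \int[leb]_(w in ~` S) (`|phi w| * p w)%:E < +oo ->
  `|\int[leb]_w (phi w * p w)%:E| <=
    `|\int[leb]_(x in S) (calP a b I phi x * p x)%:E| +
    \int[leb]_(w in S) (p w)%:E * Linfty_norm a b (calR a b I phi) +
    \int[leb]_(w in ~` S) (`|phi w| * p w)%:E.
Proof.
move=> p0 ipT mphi phioo hout.
have mS := measurable_box a b.
have mSC : measurable (~` S) by exact: measurableC.
have ip : leb.-integrable S (EFin \o p) by exact: integrableS ipT.
have mp : measurable_fun setT p by case/integrableP : ipT => /measurable_EFinP.
have mcalP : measurable_fun setT (calP a b I phi) by exact: measurable_centering.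
have mcalR : measurable_fun setT (calR a b I phi) by exact: measurable_funB.
have mM (D : set 'rV[R]_d) (f : 'rV[R]_d -> R) : measurable_fun setT f ->
    measurable_fun D (fun x => (f x * p x)%:E).
  by move=> mf; apply/measurable_EFinP; apply: measurable_funTS; exact: measurable_funM.
have -> : \int[leb]_w (phi w * p w)%:E =
    \int[leb]_(w in S) (phi w * p w)%:E + \int[leb]_(w in ~` S) (phi w * p w)%:E.
  rewrite -integral_setU//; first by rewrite setUv.
    exact: mM.
  by apply/disj_setPS; rewrite setICr.
apply: le_trans (lee_abs_add _ _) _; apply: leeD; last first.
  apply: le_trans (le_abse_integral _ mSC (mM _ _ mphi)) _.
  rewrite le_eqVlt; apply/orP; left; apply/eqP.
  by apply: eq_integral => w _; rewrite abse_EFin normrM (ger0_norm (p0 w)).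
have [psi [C [mpsi psiC _ cpsi]]] := ex_bounded_calP hab I mphi phioo.
have [g [B [mg gB phig]]] := ex_bounded_version hab mphi phioo.
have iphi := integrable_bounded_mul mphi mg gB phig ip.
have icalP := integrable_bounded_mul mcalP mpsi psiC cpsi ip.
have -> : \int[leb]_(w in S) (phi w * p w)%:E =
    \int[leb]_(w in S) (calP a b I phi w * p w)%:E +
    \int[leb]_(w in S) (calR a b I phi w * p w)%:E.
  rewrite -integralD//.
    by apply: eq_integral => w _; rewrite -EFinD -mulrDl /calR addrC subrK.
  apply: eq_integrable (integrableB mS iphi icalP) => // w _.
  by rewrite /= -EFinB -mulrBl.
apply: le_trans (lee_abs_add _ _) _; apply: leeD => //.
by apply: ae_bound_integral => //; [exact: Linfty_norm_ge0|exact: ae_le_Linfty].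
Qed.

End expectation.

Theorem corollary2p28 (R : realType) (d : nat) (hd : (1 <= d)%N)
    (a b : 'rV[R]_d) (hab : forall i, (a ord0 i < b ord0 i)%R)
    (p : 'rV[R]_d -> R) (hp : prob_density p)
    (hZ : 0 < \int[lebesgue_rV d]_(w in box a b) (p w)%:E)
    (I : {set 'I_d}) (hI : I != finset.set0)
    (phi : 'rV[R]_d -> R) (hphi : measurable_fun [set: 'rV[R]_d] phi)
    (hout : \int[lebesgue_rV d]_(w in ~` box a b) (`|phi w| * p w)%:E < +oo) :
  let S := box a b in
  let leb := @lebesgue_rV R d in
  let Z := \int[leb]_(w in S) (p w)%:E in
  let E := \int[leb]_w (phi w * p w)%:E in
  let tail := \int[leb]_(w in ~` S) (`|phi w| * p w)%:E in
  [/\ BV S p -> Linfty_norm a b phi < +oo ->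
      `|E| <= ((2 * #|I|%:R)^-1)%:E * Lambda_sl a b I (calP a b I phi)
                * TV S I p
              + Z * Linfty_norm a b (calR a b I phi) + tail,
      C_upto #|I| S p -> Linfty_norm a b phi < +oo ->
      `|E| <= (2 ^- #|I|)%:E * Lambda_mix a b I (calP a b I phi)
                * \int[leb]_(w in S°) `|partials I p w|%:E
              + Z * Linfty_norm a b (calR a b I phi) + tail,
      Vext S I p < +oo -> Linfty_norm a b phi < +oo ->
      `|E| <= (2 ^- #|I|)%:E * Lambda_mix a b I (calP a b I phi)
                * Vext S I p
              + Z * Linfty_norm a b (calR a b I phi) + tail
    & distr_deriv_measure setT I p ->
      Vext S I p <= distr_deriv_mass setT I p].
Proof.
move=> S leb Z E tail; have [p0 ipT _] := hp.
have ip : leb.-integrable S (EFin \o p).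
  by apply: integrableS ipT => //; exact: measurable_box.
have bound (Y : \bar R) : Linfty_norm a b phi < +oo ->
    `|\int[leb]_(x in S) (calP a b I phi x * p x)%:E| <= Y ->
    `|E| <= Y + Z * Linfty_norm a b (calR a b I phi) + tail.
  move=> phioo XY; apply: le_trans (expectation_bound hab I p0 ipT hphi phioo hout) _.
  by rewrite leeD2r// leeD2r.
split=> [hBV phioo|hC phioo|hV phioo|hD].
- by have [h _ _] := calP_pairing_bounds hab ip hphi phioo hI; apply: bound => //; exact: h.
- by have [_ h _] := calP_pairing_bounds hab ip hphi phioo hI; apply: bound => //; exact: h.
- by have [_ _ h] := calP_pairing_bounds hab ip hphi phioo hI; apply: bound => //; exact: h.
- by apply: ereal_inf_lbound; exists p => //; split => //; exact: nearW.
Qed.
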